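(* Let $(f_n)_{n\in\mathbb N}$ be an approximate identity for $(C_u(\mathbb R^d),* )$ such that for all $n$: $f_n\in C_c(\mathbb R^d)$, $\mathrm{supp}(f_n)\subseteq K$ for a fixed compact set $K$ independent of $n$, $f_n\ge0$, $\int f_n(x)\,dx=1$, and $f_n$ is positive definite. Let $\mu$ be a measure on $\mathbb R^d$. Then $\mu$ is Fourier transformable if and only if $\mu$ is tempered and there exists a sequence of finite measures $(\nu_n)_{n\in\mathbb N}$ such that the set $\{\nu_n:n\in\mathbb N\}$ is equi translation bounded and $\check{\nu_n}=(f_n*\mu)\,\lambda$ for all $n$.
   Context: $C_u(\mathbb R^d)$ is the space of bounded uniformly continuous functions; $(f_n)$ being an approximate identity means $f_n*g\to g$ uniformly for every $g\in C_u(\mathbb R^d)$. $\lambda$ denotes Lebesgue measure. Measures on $\mathbb R^d$ are complex Radon measures; $|\mu|$ is the total variation. Conventions: $\check f(y)=\int f(x)e^{2\pi ixy}dx$, $\widetilde f(x)=\overline{f(-x)}$; for a finite measure $\nu$, $\check\nu$ is the function $x\mapsto\int e^{2\pi ixy}\,d\nu(y)$, viewed as the measure with that density. A measure $\mu$ is Fourier transformable if there is a measure $\widehat\mu$ with $\check f\in L^2(\widehat\mu)$ and $\mu(f*\widetilde f)=\widehat\mu(|\check f|^2)$ for all $f\in C_c(\mathbb R^d)$. Tempered: defines a tempered distribution. A function $f$ is positive definite if $\sum_{i,j}c_i\overline{c_j}f(x_i-x_j)\ge0$ for all finite choices. Equi translation bounded: $\sup_n\sup_t|\nu_n|(t+W)<\infty$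 for every compact $W$. *)

(* Defs.v *)
From HB Require Import structures.
From mathcomp Require Import all_boot all_order all_algebra.
From mathcomp Require Import all_classical all_reals all_analysis.
From mathcomp Require Import complex.
Set Implicit Arguments. Unset Strict Implicit. Unset Printing Implicit Defensive.
Import Order.TTheory GRing.Theory Num.Theory numFieldNormedType.Exports.
Local Open Scope classical_set_scope.
Local Open Scope ring_scope.
Local Open Scope complex_scope.

(* Iterated Lebesgue integral on R^n of a real function (for continuous
   compactly supported functions this is the Lebesgue integral, by Fubini). *)
Fixpoint lebR {R : realType} (n : nat) : ('rV[R]_n -> R) -> R :=
  match n with
  | 0 => fun g => g 0
  | n'.+1 => fun g =>
      Rintegral (@lebesgue_measure R) setT
        (fun t : R => @lebR R n' (fun y => g (row_mx (const_mx t : 'rV[R]_1) y)))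
  end.

Section Defs.
Variable R : realType.
Variable d : nat.
Local Notation V := 'rV[R]_d.
Local Notation C := R[i].

Definition leb (f : V -> C) : C :=
  (lebR (fun x => complex.Re (f x))) +i* (lebR (fun x => complex.Im (f x))).

Definition dotv (x y : V) : R := \sum_i x ord0 i * y ord0 i.

Definition expi2pi (t : R) : C := (cos (2 * pi * t)) +i* (sin (2 * pi * t)).

Definition cont (f : V -> C) := forall (x : V) (e : R), 0 < e ->
  exists2 del : R, 0 < del & forall y, `|x - y| < del -> `|f x - f y| < e%:C.

Definition unif_cont (f : V -> C) := forall e : R, 0 < e ->
  exists2 del : R, 0 < del & forall x y, `|x - y| < del -> `|f x - f y| < e%:C.

Definition bounded_by (f : V -> C) (b : R) := forall x, `|f x| <= b%:C.

(* {x | f x <> 0} is contained in K (for compact K this is supp f ⊆ K) *)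
Definition supported_in (f : V -> C) (K : set V) := forall x, f x != 0 -> K x.

Definition Cc (f : V -> C) := cont f /\ exists K : set V, compact K /\ supported_in f K.

Definition Cu (f : V -> C) := (exists b : R, bounded_by f b) /\ unif_cont f.

Definition conv (f g : V -> C) : V -> C := fun x => leb (fun y => f (x - y) * g y).

Definition tilde (f : V -> C) : V -> C := fun x => (f (- x))^*.

Definition checkf (f : V -> C) : V -> C :=
  fun y => leb (fun x => f x * expi2pi (dotv x y)).

Definition posdef (f : V -> C) := forall (n : nat) (c : 'I_n -> C) (x : 'I_n -> V),
  0 <= \sum_(i < n) \sum_(j < n) c i * (c j)^* * f (x i - x j).

Definition approx_identity (f : nat -> V -> C) := forall g, Cu g ->
  forall e : R, 0 < e -> exists N : nat, forall n, (N <= n)%N ->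
    forall x, `|conv (f n) g x - g x| < e%:C.

(* Complex Radon measures, as linear functionals on C_c(R^d) which are
   continuous for the inductive limit topology (Bourbaki / Riesz). *)
Definition is_measure (mu : (V -> C) -> C) :=
  [/\ forall f g, Cc f -> Cc g -> mu (fun x => f x + g x) = mu f + mu g,
      forall (c : C) f, Cc f -> mu (fun x => c * f x) = c * mu f &
      forall K : set V, compact K -> exists M : R, forall f (b : R),
        Cc f -> supported_in f K -> bounded_by f b -> `|mu f| <= (M * b)%:C].

(* |mu|(h) for h in C_c, h >= 0 *)
Definition varm (mu : (V -> C) -> C) (h : V -> C) : \bar R :=
  ereal_sup [set (complex.Re `|mu g|)%:E | g in [set g | Cc g /\ forall x, `|g x| <= h x]].

(* |mu|(K) for K compact (outer regularity) *)
Definition varK (mu : (V -> C) -> C) (K : set V) : \bar R :=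
  ereal_inf [set varm mu h | h in
    [set h | Cc h /\ (forall x, 0 <= h x) /\ (forall x, K x -> 1 <= h x)]].

Definition finite_measure (mu : (V -> C) -> C) :=
  is_measure mu /\ exists M : R, forall h, Cc h -> (forall x, 0 <= h x <= 1) ->
    (varm mu h <= M%:E)%E.

Definition equi_translation_bounded (nu : nat -> (V -> C) -> C) :=
  forall W : set V, compact W -> exists M : R, forall (n : nat) (t : V),
    (varK (nu n) ((fun w => (t + w)%R) @` W) <= M%:E)%E.

(* int |h| d|mu| < oo, for continuous h *)
Definition integrable (mu : (V -> C) -> C) (h : V -> C) :=
  exists M : R, forall phi, Cc phi -> (forall x, 0 <= phi x <= 1) ->
    (varm mu (fun x => (phi x * `|h x|)%R) <= M%:E)%E.

(* I = int h dmu for continuous mu-integrable h: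
   I = lim mu(phi h) as the cut-off phi in C_c, 0 <= phi <= 1 tends to 1 *)
Definition mint (mu : (V -> C) -> C) (h : V -> C) (I : C) :=
  forall e : R, 0 < e -> exists K : set V, compact K /\
    forall phi, Cc phi -> (forall x, 0 <= phi x <= 1) -> (forall x, K x -> phi x = 1) ->
      `|mu (fun x => phi x * h x) - I| < e%:C.

Definition Fourier_transformable (mu : (V -> C) -> C) :=
  exists hatmu : (V -> C) -> C, is_measure hatmu /\
    forall f, Cc f ->
      integrable hatmu (fun y => `|checkf f y| ^+ 2) /\
      mint hatmu (fun y => `|checkf f y| ^+ 2) (mu (conv f (tilde f))).

(* Tempered : the distribution defined by mu on C_c^oo is continuous for the
   Schwartz topology (bounded by finitely many Schwartz seminorms), i.e. it
   extends to a tempered distribution. *)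
Definition pd (j : 'I_d) (u : V -> R) : V -> R := fun x => 'D_(delta_mx 0 j) u x.
Definition pds (js : seq 'I_d) (u : V -> R) : V -> R := foldr pd u js.
Definition smoothR (u : V -> R) :=
  forall js : seq 'I_d, continuous (pds js u) /\
    forall (j : 'I_d) (x : V), derivable (pds js u) x (delta_mx 0 j).
Definition test_function (u : V -> R) :=
  smoothR u /\ exists K : set V, compact K /\ forall x, u x != 0 -> K x.
Definition monom (al : seq 'I_d) (x : V) : R := \prod_(i <- al) x ord0 i.

Definition tempered (mu : (V -> C) -> C) :=
  exists (N : nat) (Cst : R), forall u, test_function u -> forall b : R,
    (forall (al js : seq 'I_d) (x : V), (size al <= N)%N -> (size js <= N)%N ->
        `|monom al x * pds js u x| <= b) ->
    `|mu (fun x => (u x)%:C)| <= (Cst * b)%:C.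

Definition conv_m (f : V -> C) (mu : (V -> C) -> C) : V -> C :=
  fun x => mu (fun y => f (x - y)).

Definition check_eq_density (nu : (V -> C) -> C) (h : V -> C) :=
  exists2 cn : V -> C, (forall x, mint nu (fun y => expi2pi (dotv x y)) (cn x)) &
    forall phi, Cc phi -> leb (fun x => phi x * cn x) = leb (fun x => phi x * h x).

End Defs.

(* Main.v *)
(* The transform of a g in C_c is small on average over the lattice Z^d: a large sieve inequality, obtained
   from Schur's test for the transform of a compactly supported majorant theta, bounds the sums of
   |check g|^2, and of check f for a positive definite f in C_c, over points lying near distinct lattice
   points.  A translation bounded measure therefore integrates such functions, with tails that are uniform
   over equi translation bounded families.
   If mu is transformable, the uniform boundedness principle makes hatmu translation bounded; polarization
   and mollification extend the defining identity to mu h = int check h dhatmu whenever check h is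
   lattice-summable.  Applied to test functions h this gives temperedness, and applied to the translates of
   f_n it shows that nu_n := check f_n . hatmu has inverse transform f_n * mu.
   Conversely, hatmu is the limit of the nu_n along an ultrafilter: by Fubini mu (f_n * h) = int check h dnu_n
   for h = g * tilde g, where the left side tends to mu h because (f_n) is an approximate identity, and the
   uniform tails allow passing to the limit on the right.
   All facts on the iterated integral [leb], Fubini's theorem included, come from Riemann sums whose nodes
   serve all functions with a common modulus of continuity. *)
Require Import Defs.
From HB Require Import structures.
From mathcomp Require Import all_boot all_order all_algebra.
From mathcomp Require Import all_classical all_reals all_analysis.
From mathcomp Require Import complex.
From mathcomp Require Import ring lra zify.
Import Order.TTheory GRing.Theory Num.Theory numFieldNormedType.Exports.
Local Open Scope classical_set_scope.
Local Open Scope ring_scope.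
Local Open Scope complex_scope.
Set Implicit Arguments. Unset Strict Implicit. Unset Printing Implicit Defensive.
Local Notation "z ^*" := (conjc z) : ring_scope.

(** * Integrals over the line *)

(** The measures here may be singular, so the integral of the square of check g over space, which
    Plancherel's theorem would bound, says nothing about their mass; what must be finite is the sum
    over lattice cells of the suprema of that square. Sampling it at one arbitrary point per cell is
    exactly what a large sieve controls. Finite total mass of check f_n . hatmu needs such a sum for
    the first power of check f_n, and here positive definiteness enters: f_n (u - v) is itself a
    Gram kernel, so check f_n is a value of a positive form and not the square root of one.
    Transforms of functions in C_c are in general not compactly supported, while measures act on C_c
    only. Hence every integral is a limit over cut-offs, and tail estimates replace dominated
    convergence. An ultrafilter provides the limits of nu_n g for all g in C_c at once, without
    extracting subsequences. *)

Section OneDim.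
Variable R : realType.
Implicit Types (psi F : R -> R) (L a b x y e s : R).
Local Notation mu := (@lebesgue_measure R).

Lemma integrable_cc psi L : continuous psi -> (forall x, L < `|x| -> psi x = 0) ->
  mu.-integrable setT (EFin \o psi).
Proof.
move=> cpsi psi0.
have h : mu.-integrable `[- L, L] (EFin \o psi).
  by apply: continuous_compact_integrable;
    [exact: segment_compact | exact: continuous_subspaceT].
rewrite (_ : EFin \o psi = (EFin \o psi) \_ (`[- L, L])).
  by rewrite -integrable_mkcond.
apply/funext => x; rewrite patchE; case: ifPn => // /negP; rewrite inE /= in_itv /= => hx.
rewrite psi0// ltNge; apply/negP => hxL; apply: hx; by rewrite -ler_norml.
Qed.

(** Shift, reflection and Riemann sums below become statements about increments of [F], which the
    mean value theorem settles. *)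
Lemma antiderivative_cc psi L : continuous psi -> (forall x, L < `|x| -> psi x = 0) ->
  exists F, (forall x : R, is_derive x (1:R) F (psi x)) /\
    forall a b, a < - L -> L < b -> Rintegral mu setT psi = F b - F a.
Proof.
move=> cpsi psi0.
pose F x := (\int[mu]_(t in [set` `]-oo, x]]) (psi t))%R.
have ipsi := integrable_cc cpsi psi0.
exists F; split.
  move=> x; have xu : x < x + 1 by rewrite ltrDl.
  have ixu : mu.-integrable [set` Interval -oo%O (BRight (x + 1))] (EFin \o psi).
    by apply: integrableS ipsi.
  have [] := @continuous_FTC1 R psi -oo%O x (x + 1) xu ixu (ltNyr _) (cpsi x).
  by move=> dF F'; rewrite -F' derive1E; exact/derivableP.
move=> a b aL Lb.
have -> : F b = Rintegral mu setT psi.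
  rewrite /F Rintegral_mkcond; congr Rintegral; apply/funext => x.
  rewrite patchE; case: ifPn => // /negP; rewrite inE /= in_itv /= => hx.
  rewrite psi0//; move/negP: hx; rewrite -ltNge => /(lt_trans Lb) h.
  by apply: lt_le_trans h (ler_norm _).
have -> : F a = 0.
  rewrite /F Rintegral_mkcond (_ : psi \_ _ = cst 0).
    by rewrite Rintegral_cst// mul0r.
  apply/funext => x; rewrite patchE; case: ifPn => //; rewrite inE /= in_itv /= => hx.
  rewrite psi0//; have := le_lt_trans hx aL; rewrite ltrNr => h.
  by apply: lt_le_trans h _; rewrite -normrN ler_norm.
by rewrite subr0.
Qed.

Lemma Rintegral_shift psi L s : continuous psi -> (forall x, L < `|x| -> psi x = 0) ->
  Rintegral mu setT (fun t => psi (t + s)) = Rintegral mu setT psi.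
Proof.
move=> cpsi psi0.
have cps : continuous (fun t => psi (t + s)).
  move=> x; apply: (@continuous_comp _ _ _ (fun t => t + s) psi); last exact: cpsi.
  by apply: continuousD; [exact: id | exact: cst_continuous].
have ps0 : forall x, L + `|s| < `|x| -> psi (x + s) = 0.
  move=> x hx; apply: psi0; have := ler_normB (x + s) s; rewrite addrK; lra.
have [F [dF IF]] := antiderivative_cc cpsi psi0.
have [G [dG IG]] := antiderivative_cc cps ps0.
(* Large enough for [[-M, M]] and its translate by [s] to contain the relevant supports strictly
   inside. *)
pose M := `|L| + `|s| + `|s| + 1.
have sM : `|s| <= M by rewrite /M; have := normr_ge0 L; have := normr_ge0 s; lra.
have LM : `|L| + `|s| < M by rewrite /M; have := normr_ge0 L; have := normr_ge0 s; lra.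
have L1 := ler_norm L; have s1 := ler_norm s; have s2 : - s <= `|s| by rewrite -normrN ler_norm.
have s0 := normr_ge0 s.
rewrite (IG (- M) M ltac:(lra) ltac:(lra)) (IF (- M + s) (M + s) ltac:(lra) ltac:(lra)).
(* The two integrals are increments of [G] and of the shifted [F]; their difference has derivative
   0, hence no increment. *)
pose H x := G x - F (x + s).
have dH (x : R) : is_derive x (1:R) H (psi (x + s) - psi (x + s)).
  rewrite /H; apply: is_deriveB.
  have h1 : is_derive x (1:R) (fun t : R => t + s) 1.
    by have := is_deriveD (is_derive_id x (1:R)) (is_derive_cst s x (1:R)); rewrite addr0.
  have := @is_derive1_comp R F (fun t : R => t + s) x (psi (x + s)) 1 (dF (x + s)) h1.
  by rewrite mulr1.
have [c _] := @MVT_segment R H (fun x => psi (x + s) - psi (x + s)) (- M) M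
  ltac:(lra) (fun x _ => dH x) ltac:(apply: continuous_subspaceT => x;
     apply/differentiable_continuous/derivable1_diffP; exact: ex_derive).
by rewrite /H subrr mul0r; lra.
Qed.

Lemma Rintegral_opp_arg psi L : continuous psi -> (forall x, L < `|x| -> psi x = 0) ->
  Rintegral mu setT (fun t => psi (- t)) = Rintegral mu setT psi.
Proof.
move=> cpsi psi0.
have cps : continuous (fun t => psi (- t)).
  by move=> x; apply: (@continuous_comp _ _ _ (fun t => - t) psi); [exact: oppr_continuous | exact: cpsi].
have ps0 : forall x, L < `|x| -> psi (- x) = 0 by move=> x hx; apply: psi0; rewrite normrN.
have [F [dF IF]] := antiderivative_cc cpsi psi0.
have [G [dG IG]] := antiderivative_cc cps ps0.
pose M := `|L| + 1.
have L1 := ler_norm L.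
rewrite (IG (- M) M ltac:(rewrite /M; lra) ltac:(rewrite /M; lra)).
rewrite (IF (- M) M ltac:(rewrite /M; lra) ltac:(rewrite /M; lra)).
pose H x := G x + F (- x).
have dH (x : R) : is_derive x (1:R) H (psi (- x) + - psi (- x)).
  rewrite /H; apply: is_deriveD.
  have h1 : is_derive x (1:R) (fun t : R => - t) (-1) by have := is_deriveN (is_derive_id x (1:R)).
  have := @is_derive1_comp R F (fun t : R => - t) x (psi (- x)) (-1) (dF (- x)) h1.
  by rewrite mulrN1.
have [c _] := @MVT_segment R H (fun x => psi (- x) - psi (- x)) (- M) M
  ltac:(have := normr_ge0 L; rewrite /M; lra) (fun x _ => dH x) ltac:(apply: continuous_subspaceT => x;
     apply/differentiable_continuous/derivable1_diffP; exact: ex_derive).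
by rewrite /H subrr mul0r opprK /M; lra.
Qed.

(** The nodes are equally spaced in [[-(L+1), L+1]]: the margin 1 is there because
    [antiderivative_cc] wants end points strictly beyond the support. *)
Lemma riemann_sum1 (L : R) (del : R) : 0 <= L -> 0 < del ->
  exists (m : nat) (t : 'I_m -> R), (0 < m)%N /\
    forall (psi : R -> R) (e : R), continuous psi -> (forall x : R, L < `|x| -> psi x = 0) ->
      (forall x y : R, `|x - y| < del -> `|psi x - psi y| <= e) ->
      `|Rintegral mu setT psi - \sum_i (2 * (L + 1)) / m%:R * psi (t i)| <= e * (2 * (L + 1)).
Proof.
move=> L0 d0; set A := 2 * (L + 1).
have A0 : 0 < A by rewrite /A; lra.
have [m m1 m2] : exists2 m, (0 < m)%N & A / m%:R < del.
  exists (Num.bound (A / del)).+1 => //.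
  rewrite ltr_pdivrMr ?ltr0n// mulrC -ltr_pdivrMr//.
  apply: lt_trans (archi_boundP _) _; first by rewrite divr_ge0// ltW.
  by rewrite ltr_nat.
set h := A / m%:R in m2.
have h0 : 0 < h by rewrite /h divr_gt0// ltr0n.
pose t (i : nat) := - (L + 1) + i%:R * h.
exists m, (fun i => t i); split => // psi e cpsi psi0 mod.
have [F [dF IF]] := antiderivative_cc cpsi psi0.
have tS i : t i.+1 = t i + h by rewrite /t -natr1; ring.
have tm : t m = L + 1.
  rewrite /t /h mulrC divfK ?pnatr_eq0 -?lt0n//; rewrite /A; ring.
have t0 : t 0%N = - (L + 1) by rewrite /t mul0r addr0.
rewrite (IF (t 0%N) (t m) ltac:(rewrite t0; lra) ltac:(rewrite tm; lra)).
rewrite -(telescope_sumr (fun i => F (t i))) // big_mkord -sumrB.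
apply: le_trans (ler_norm_sum _ _ _) _.
have -> : e * A = \sum_(i < m) e * h.
  rewrite sumr_const card_ord -mulr_natr /h; field; by rewrite pnatr_eq0 -lt0n.
apply: ler_sum => i _.
(* The increment of [F] over a cell is the cell length times a value of [psi] in that cell, and the
   cell is shorter than [del]. *)
have [c + ->] := @MVT_segment R F psi (t i) (t i.+1) ltac:(rewrite tS; lra) (fun x _ => dF x)
  ltac:(apply: continuous_subspaceT => x;
     apply/differentiable_continuous/derivable1_diffP; exact: ex_derive).
rewrite in_itv /= tS => /andP[c1 c2].
rewrite -/h [t i + h - t i](_ : _ = h); last by ring.
rewrite [h * _]mulrC -mulrBl normrM (gtr0_norm h0) ler_pM2r//.
by apply: mod; rewrite ger0_norm; lra.
Qed.

End OneDim.

(** * Iterated integrals and Riemann sums *)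

Section RowNorm.
Variables (R : realType) (n : nat).
Implicit Types (x y : 'rV[R]_n) (r : R).

Lemma rV_norm_le x r : 0 <= r -> (forall i, `|x ord0 i| <= r) -> `|x| <= r.
Proof.
move=> r0 h; rewrite [`|x|]/Num.norm /= mx_normrE; apply/bigmax_leP; split => //.
by move=> [i j] _ /=; rewrite (ord1 i).
Qed.

Lemma rV_norm_ge x i : `|x ord0 i| <= `|x|.
Proof.
rewrite [leRHS]/Num.norm /= mx_normrE; apply/bigmax_geP; right => /=.
by exists (ord0, i).
Qed.
End RowNorm.

Section RiemannSums.
Variable R : realType.

Lemma row_mx_norm n (t : R) (y : 'rV[R]_n) : `|row_mx (const_mx t : 'rV[R]_1) y| = Order.max `|t| `|y|.
Proof.
apply/eqP; rewrite eq_le; apply/andP; split.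
  apply: rV_norm_le => [|i]; first by rewrite le_max normr_ge0.
  rewrite mxE; case: splitP => j _; first by rewrite mxE le_max lexx.
  by rewrite le_max; apply/orP; right; apply: rV_norm_ge.
rewrite ge_max; apply/andP; split.
  have := rV_norm_ge (row_mx (const_mx t : 'rV[R]_1) y) (lshift n ord0).
  by rewrite row_mxEl mxE.
apply: rV_norm_le => // i.
have := rV_norm_ge (row_mx (const_mx t : 'rV[R]_1) y) (rshift 1 i).
by rewrite row_mxEr.
Qed.

Lemma row_mx_sub n (t s : R) (x y : 'rV[R]_n) :
  row_mx (const_mx t : 'rV[R]_1) x - row_mx (const_mx s : 'rV[R]_1) y =
  row_mx (const_mx (t - s) : 'rV[R]_1) (x - y).
Proof.
rewrite opp_row_mx add_row_mx; congr row_mx.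
by apply/rowP => i; rewrite !mxE.
Qed.

(** The class on which the iterated integral is studied: it is stable under slicing with the same
    [L], and the slices inherit the modulus of continuity. *)
Definition ucr n (L : R) (g : 'rV[R]_n -> R) := (forall x : 'rV[R]_n, L < `|x| -> g x = 0) /\
  forall e : R, 0 < e -> exists2 del : R, 0 < del & forall x y : 'rV[R]_n, `|x - y| < del -> `|g x - g y| < e.

Lemma ucr_slice n (L : R) (g : 'rV[R]_n.+1 -> R) (t : R) : ucr L g ->
  ucr L (fun y : 'rV[R]_n => g (row_mx (const_mx t : 'rV[R]_1) y)).
Proof.
move=> [g0 gu]; split.
  by move=> x Lx; apply: g0; rewrite row_mx_norm lt_max Lx orbT.
move=> e e0; have [del d0 h] := gu e e0; exists del => // x y xy.
by apply: h; rewrite row_mx_sub row_mx_norm subrr normr0 gt_max d0.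
Qed.

Lemma ucr_slice0 n (L : R) (g : 'rV[R]_n.+1 -> R) (t : R) : ucr L g -> L < `|t| ->
  (fun y : 'rV[R]_n => g (row_mx (const_mx t : 'rV[R]_1) y)) = (fun=> 0).
Proof.
by move=> [g0 _] Lt; apply/funext => y; apply: g0; rewrite row_mx_norm lt_max Lt.
Qed.

Lemma lebR0 n : lebR (fun _ : 'rV[R]_n => 0) = 0.
Proof.
elim: n => [//|n IH] /=.
under eq_Rintegral do rewrite IH.
by rewrite Rintegral_cst// mul0r.
Qed.

Lemma eq_continuousR (psi : R -> R) :
  (forall e : R, 0 < e -> exists2 del : R, 0 < del & forall x y : R, `|x - y| < del -> `|psi x - psi y| <= e) ->
  continuous psi.
Proof.
move=> h x; apply/cvgrPdist_le => e e0; have [del d0 hd] := h e e0.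
near=> y; apply: hd.
by near: y; apply: (@cvgr_dist_lt _ _ _ _ _ id x) => //; exact: cvg_id.
Unshelve. all: by end_near. Qed.

(** One constant [A], the same for all [del], bounds both the total weight and the ratio of the
    error to the oscillation. *)
Definition riemann_rule n (L A : R) := forall del : R, 0 < del -> exists (I : finType) (w : R) (v : I -> 'rV[R]_n),
  [/\ 0 <= w, w * #|I|%:R <= A &
  forall (g : 'rV[R]_n -> R) (e : R), ucr L g -> (forall x y : 'rV[R]_n, `|x - y| < del -> `|g x - g y| <= e) ->
    `|lebR g - w * \sum_i g (v i)| <= A * e].

(** Both integrals are compared with Riemann sums over the same nodes, where closeness is termwise.
    This works before any linearity of [lebR] is known, and it gives the continuity of slice
    integrals that the induction on dimension needs. *)
Lemma riemann_rule_close n (L A : R) : 0 <= A -> riemann_rule n L A ->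
  forall (g h : 'rV[R]_n -> R) (e : R), ucr L g -> ucr L h ->
    (forall x, `|g x - h x| <= e) -> `|lebR g - lebR h| <= A * e.
Proof.
move=> A0 HA g h e gu hu gh.
have e0 : 0 <= e := le_trans (normr_ge0 _) (gh 0).
apply/ler_addgt0Pr => eta eta0.
have eta1 : 0 < eta / (2 * A + 1) by rewrite divr_gt0//; lra.
have [d1 d10 h1] := gu.2 _ eta1; have [d2 d20 h2] := hu.2 _ eta1.
have [|I [w [v [w0 wA Iv]]]] := HA (Order.min d1 d2); first by rewrite lt_min d10.
have k1 : `|lebR g - w * \sum_i g (v i)| <= A * (eta / (2 * A + 1)).
  by apply: Iv => // x y; rewrite lt_min => /andP[/h1/ltW].
have k2 : `|lebR h - w * \sum_i h (v i)| <= A * (eta / (2 * A + 1)).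
  by apply: Iv => // x y; rewrite lt_min => /andP[_ /h2/ltW].
have k3 : `|w * \sum_i g (v i) - w * \sum_i h (v i)| <= A * e.
  rewrite -mulrBr -sumrB normrM (ger0_norm w0).
  apply: (@le_trans _ _ (w * (#|I|%:R * e))); last by rewrite mulrA ler_wpM2r.
  rewrite ler_wpM2l//; apply: le_trans (ler_norm_sum _ _ _) _.
  by rewrite mulr_natl -sumr_const; apply: ler_sum => i _.
have : 2 * (A * (eta / (2 * A + 1))) <= eta.
  by rewrite !mulrA ler_pdivrMr; [nra | lra].
move: (lebR _) (lebR _) (w * _) (w * _) (A * (eta / _)) k1 k2 k3 => p q p' q' z.
rewrite !ler_norml => /andP[? ?] /andP[? ?] /andP[? ?] ?.
by apply/andP; split; lra.
Qed.

Section Slices.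
Variables (n : nat) (L A : R) (g : 'rV[R]_n.+1 -> R).
Hypotheses (A0 : 0 <= A) (HA : riemann_rule n L A) (gu : ucr L g).

Lemma slice_close (e del : R) : (forall x y : 'rV[R]_n.+1, `|x - y| < del -> `|g x - g y| <= e) ->
  forall t s : R, `|t - s| < del ->
  `|lebR (fun y : 'rV[R]_n => g (row_mx (const_mx t : 'rV[R]_1) y)) -
    lebR (fun y : 'rV[R]_n => g (row_mx (const_mx s : 'rV[R]_1) y))| <= A * e.
Proof.
move=> ge t s ts; apply: (riemann_rule_close A0 HA (ucr_slice t gu) (ucr_slice s gu)) => y.
by apply: ge; rewrite row_mx_sub row_mx_norm subrr normr0 gt_max ts (le_lt_trans _ ts).
Qed.

Lemma slice_continuous :
  continuous (fun t : R => lebR (fun y : 'rV[R]_n => g (row_mx (const_mx t : 'rV[R]_1) y))).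
Proof.
apply: eq_continuousR => e e0; have A1 := A0.
have e1 : 0 < e / (A + 1) by rewrite divr_gt0//; lra.
have [del d0 hd] := gu.2 _ e1; exists del => // t s ts.
apply: le_trans (slice_close (fun x y xy => ltW (hd x y xy)) ts) _.
by rewrite mulrA ler_pdivrMr; [nra | lra].
Qed.
End Slices.

(* One family of nodes serves all functions with a common modulus of continuity; this uniformity
   is what later gives linearity, monotonicity and Fubini for [lebR]. *)
Lemma riemann_sum n (L : R) : 0 <= L -> exists2 A : R, 0 <= A & riemann_rule n L A.
Proof.
move=> L0; elim: n => [|n [A A0 IH]].
  exists 1 => // del d0; exists unit, 1, (fun=> 0); split => //.
    by rewrite card_unit mulr1.
  move=> g e gu ge; rewrite big_const card_unit /= addr0 mul1r subrr normr0 mul1r.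
  by have := ge 0 0; rewrite !subrr !normr0; apply.
set a : R := 2 * (L + 1); have a0 : 0 < a by rewrite /a; lra.
(* One [a * A] pays for the outer rule applied to the slice integrals, the other for the inner rule
   at every outer node. *)
exists (2 * (a * A)); first by rewrite mulr_ge0// mulr_ge0// ltW.
move=> del d0.
have [m [t [m0 ht]]] := riemann_sum1 L0 d0.
have [I [w [v [w0 wA Iv]]]] := IH del d0.
have aA0 : 0 <= a * A by rewrite mulr_ge0// ltW.
have m0' : (m%:R : R) != 0 by rewrite pnatr_eq0 -lt0n.
exists ('I_m * I)%type, (a / m%:R * w), (fun p => row_mx (const_mx (t p.1) : 'rV[R]_1) (v p.2)); split.
- by rewrite mulr_ge0 ?divr_ge0 ?ler0n ?(ltW a0).
- rewrite card_prod card_ord natrM.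
  rewrite (_ : _ * _ = a * (w * #|I|%:R)); last by field.
  apply: (@le_trans _ _ (a * A)); [by rewrite ler_pM2l | lra].
move=> g e gu ge.
pose psi (t : R) := lebR (fun y : 'rV[R]_n => g (row_mx (const_mx t : 'rV[R]_1) y)).
have cpsi : continuous psi := slice_continuous A0 IH gu.
have psi0 (x : R) : L < `|x| -> psi x = 0.
  by move=> Lx; rewrite /psi (ucr_slice0 gu Lx) lebR0.
have h1 := ht psi (A * e) cpsi psi0 (slice_close A0 IH gu ge).
have h2 : `|\sum_(j < m) a / m%:R * psi (t j) -
    a / m%:R * w * \sum_p g (row_mx (const_mx (t p.1) : 'rV[R]_1) (v p.2))| <= a * (A * e).
  rewrite -(pair_big xpredT xpredT (fun i j => g (row_mx (const_mx (t i) : 'rV[R]_1) (v j)))) /=.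
  have c0 : 0 < a / m%:R by rewrite divr_gt0 ?ltr0n.
  apply: (@le_trans _ _ (a / m%:R * (m%:R * (A * e)))); last by rewrite mulrA divfK.
  move: c0; set c := a / m%:R => c0.
  rewrite -mulr_sumr -(mulrA c) -mulrBr mulr_sumr -sumrB normrM (gtr0_norm c0) ler_pM2l//.
  apply: le_trans (ler_norm_sum _ _ _) _.
  rewrite mulr_natl -[X in _ *+ X]card_ord -sumr_const; apply: ler_sum => j _.
  apply: Iv; first exact: ucr_slice.
  by move=> x y xy; apply: ge; rewrite row_mx_sub row_mx_norm subrr normr0 gt_max d0.
rewrite /= -/psi.
move: h1 h2; rewrite -/a; move: (Rintegral _ _ _) => p.
move: (\sum_(j < m) _) (a / m%:R * w * _) => q r.
rewrite (_ : 2 * (a * A) * e = A * e * a + a * (A * e)); last by ring.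
move: (A * e * a) (a * (A * e)) => z z'.
by rewrite !ler_norml => /andP[? ?] /andP[? ?]; apply/andP; split; lra.
Qed.
End RiemannSums.

(** * Continuous complex-valued functions *)

Section ComplexNorm.
Variable R : realType.
Local Notation C := R[i].
Local Notation nc := (@Normc.normc R).
Implicit Types (z w : C) (b r : R).

Lemma normc_normE z : `|z| = (nc z)%:C. Proof. by []. Qed.

Lemma nc_le z b : (`|z| <= b%:C) = (nc z <= b).
Proof. by rewrite normc_normE lecR. Qed.

Lemma nc_lt z b : (`|z| < b%:C) = (nc z < b).
Proof. by rewrite normc_normE ltcR. Qed.

Lemma nc_ge0 z : 0 <= nc z.
Proof. by case: z => a b; apply: sqrtr_ge0. Qed.

Lemma nc_eq0 z : (nc z == 0) = (z == 0).
Proof. by apply/eqP/eqP => [/Normc.eq0_normc//|->]; exact: Normc.normc0. Qed.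

Lemma ncD z w : nc (z + w) <= nc z + nc w.
Proof. exact: le_normcD. Qed.

Lemma ncN z : nc (- z) = nc z.
Proof. exact: normcN. Qed.

Lemma ncBC z w : nc (z - w) = nc (w - z).
Proof. by rewrite -ncN opprB. Qed.

Lemma nc_triangle u z w : nc (z - w) <= nc (z - u) + nc (u - w).
Proof. by apply: le_trans (ncD _ _); rewrite addrA subrK. Qed.

Lemma ncR r : nc r%:C = `|r|.
Proof. by rewrite /= expr0n addr0 sqrtr_sqr. Qed.

Lemma nc_real r : 0 <= r -> nc r%:C = r.
Proof. by move=> r0; rewrite ncR ger0_norm. Qed.

Lemma ncJ z : nc z^* = nc z.
Proof. by case: z => a b /=; rewrite sqrrN. Qed.

Lemma nc_Re z : `|complex.Re z| <= nc z.
Proof. by rewrite -lecR; exact: normc_ge_Re. Qed.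

Lemma nc_Im z : `|complex.Im z| <= nc z.
Proof.
case: z => a b /=; rewrite -sqrtr_sqr ler_sqrt ?addr_ge0 ?sqr_ge0//.
by rewrite lerDr sqr_ge0.
Qed.

Lemma nc_ReIm z : nc z <= `|complex.Re z| + `|complex.Im z|.
Proof.
case: z => a b; rewrite [leRHS]/= (_ : a +i* b = a%:C + b%:C * 'i); last first.
  by simpc.
by apply: le_trans (ncD _ _) _; rewrite Normc.normcM !ncR/= expr0n expr1n add0r sqrtr1 mulr1.
Qed.

Lemma nc_sum (I : Type) (s : seq I) (P : pred I) (F : I -> C) :
  nc (\sum_(i <- s | P i) F i) <= \sum_(i <- s | P i) nc (F i).
Proof.
elim/big_ind2: _ => //; first by rewrite Normc.normc0.
by move=> x a y b xa yb; apply: le_trans (ncD _ _) _; exact: lerD.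
Qed.

Lemma nc_sqr z : z * z^* = ((nc z) ^+ 2)%:C.
Proof. by rewrite -sqr_normc normc_normE rmorphXn. Qed.

Lemma nc_distD z w : `|nc z - nc w| <= nc (z - w).
Proof.
have := ncD (z - w) w; have := ncD (w - z) z; rewrite !subrK (ncBC w) ler_norml => h1 h2.
by apply/andP; split; lra.
Qed.

Lemma nc_small z : (forall e : R, 0 < e -> nc z <= e) -> z = 0.
Proof.
move=> h; apply/eqP; rewrite -nc_eq0 eq_le nc_ge0 andbT.
by apply/ler_addgt0Pr => e e0; rewrite add0r h.
Qed.

Lemma cjM z w : (z * w)^* = z^* * w^*.
Proof. exact: rmorphM. Qed.

Lemma cjD z w : (z + w)^* = z^* + w^*.
Proof. exact: rmorphD. Qed.

Lemma cj_sum (I : Type) (s : seq I) (P : pred I) (F : I -> C) :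
  (\sum_(i <- s | P i) F i)^* = \sum_(i <- s | P i) (F i)^*.
Proof. exact: rmorph_sum. Qed.

Lemma ge0_complex z : 0 <= z -> z = (complex.Re z)%:C /\ 0 <= complex.Re z.
Proof.
by case: z => a b; rewrite lecE /= => /andP[/eqP -> a0].
Qed.

End ComplexNorm.

Section Cts.
Variable R : realType.
Local Notation C := R[i].
Local Notation nc := (@Normc.normc R).

(** Going through real and imaginary parts reduces everything to real-valued continuity, over any
    domain; pairs of points are used for kernels. *)
Definition cts (T : topologicalType) (g : T -> C) :=
  continuous (fun x => complex.Re (g x) : R) /\ continuous (fun x => complex.Im (g x) : R).

Section General.
Variable T : topologicalType.
Implicit Types (f g : T -> C).

Lemma cts_cst (c : C) : cts (fun _ : T => c).
Proof. by split; exact: cst_continuous. Qed.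

Lemma ctsD f g : cts f -> cts g -> cts (fun x => f x + g x).
Proof.
move=> [f1 f2] [g1 g2]; split => x.
  rewrite (_ : (fun x => _) = (fun x => complex.Re (f x) + complex.Re (g x))).
    by apply: cvgD; [exact: f1|exact: g1].
  by apply/funext => y; case: (f y) (g y) => ? ? [].
rewrite (_ : (fun x => _) = (fun x => complex.Im (f x) + complex.Im (g x))).
  by apply: cvgD; [exact: f2|exact: g2].
by apply/funext => y; case: (f y) (g y) => ? ? [].
Qed.

Lemma ctsM f g : cts f -> cts g -> cts (fun x => f x * g x).
Proof.
move=> [f1 f2] [g1 g2]; split => x.
  rewrite (_ : (fun x => _) = (fun x => complex.Re (f x) * complex.Re (g x)
                                       - complex.Im (f x) * complex.Im (g x))).
    by apply: cvgB; apply: cvgM; solve [exact: f1|exact: g1|exact: f2|exact: g2].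
  by apply/funext => y; case: (f y) (g y) => ? ? [].
rewrite (_ : (fun x => _) = (fun x => complex.Re (f x) * complex.Im (g x)
                                     + complex.Im (f x) * complex.Re (g x))).
  by apply: cvgD; apply: cvgM; solve [exact: f1|exact: g1|exact: f2|exact: g2].
by apply/funext => y; case: (f y) (g y) => ? ? [].
Qed.

Lemma ctsZ (c : C) f : cts f -> cts (fun x => c * f x).
Proof. by move=> h; apply: ctsM => //; exact: cts_cst. Qed.

Lemma ctsN f : cts f -> cts (fun x => - f x).
Proof.
move=> /(ctsZ (-1)); rewrite (_ : (fun x => _) = (fun x => - f x))//.
by apply/funext => x; rewrite mulN1r.
Qed.

Lemma ctsB f g : cts f -> cts g -> cts (fun x => f x - g x).
Proof. by move=> hf hg; apply: ctsD => //; exact: ctsN. Qed.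

Lemma ctsJ f : cts f -> cts (fun x => (f x)^*).
Proof.
move=> [f1 f2]; split => x.
  rewrite (_ : (fun x => _) = (fun x => complex.Re (f x))); first exact: f1.
  by apply/funext => y; case: (f y).
rewrite (_ : (fun x => _) = (fun x => - complex.Im (f x))); first by apply: cvgN; exact: f2.
by apply/funext => y; case: (f y).
Qed.

Lemma cts_real (u : T -> R) : continuous u -> cts (fun x => (u x)%:C).
Proof. by move=> cu; split => //; exact: cst_continuous. Qed.

Lemma continuous_nc f : cts f -> continuous (fun x => nc (f x)).
Proof.
move=> [f1 f2] x.
rewrite (_ : (fun x => _) = (fun x => Num.sqrt (complex.Re (f x) ^+ 2 + complex.Im (f x) ^+ 2))).
  apply: (@continuous_comp _ _ _ (fun x => complex.Re (f x) ^+ 2 + complex.Im (f x) ^+ 2) (@Num.sqrt R)).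
    by apply: cvgD; rewrite ?expr2; apply: cvgM; solve [exact: f1 | exact: f2].
  exact: sqrt_continuous.
by apply/funext => y; case: (f y).
Qed.

Lemma continuous_nc_sqr f : cts f -> continuous (fun x => nc (f x) ^+ 2).
Proof.
move=> /continuous_nc cf x.
by rewrite (_ : (fun x => _) = (fun x => nc (f x) * nc (f x))); [apply: cvgM; exact: cf|].
Qed.

Lemma cts_norm f : cts f -> cts (fun x => `|f x|).
Proof. by move=> hf; apply: cts_real; exact: continuous_nc. Qed.

Lemma cts_expi (u : T -> R) : continuous u -> cts (fun x => expi2pi (u x)).
Proof.
move=> cu; have h : continuous (fun x => 2 * pi * u x).
  by move=> x; apply: cvgM; [exact: cvg_cst|exact: cu].
split => x /=.
  by apply: (@continuous_comp _ _ _ (fun x => 2 * pi * u x) (@cos R)); [exact: h | exact: continuous_cos].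
by apply: (@continuous_comp _ _ _ (fun x => 2 * pi * u x) (@sin R)); [exact: h | exact: continuous_sin].
Qed.

Lemma cts_comp (T' : topologicalType) (h : T' -> T) f :
  continuous h -> cts f -> cts (fun x => f (h x)).
Proof.
move=> ch [f1 f2]; split => x.
  by apply: (@continuous_comp _ _ _ h (fun x => complex.Re (f x))); [exact: ch | exact: f1].
by apply: (@continuous_comp _ _ _ h (fun x => complex.Im (f x))); [exact: ch | exact: f2].
Qed.

Lemma cts_bounded (K : set T) f : compact K -> cts f ->
  exists2 b : R, 0 <= b & forall x, K x -> nc (f x) <= b.
Proof.
move=> cK /continuous_nc cf.
have := (compact_near_coveringP K).1 cK R (pinfty_nbhs R) (fun M x => nc (f x) <= M).
case.
- move=> x Kx; near=> y M => /=.
  apply: (@le_trans _ _ (nc (f x) + 1)); last by near: M; apply: nbhs_pinfty_ge; rewrite num_real.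
  have : `|nc (f x) - nc (f y)| <= 1.
    by near: y; apply: (@cvgr_dist_le _ _ _ _ _ (fun y => nc (f y)) (nc (f x))) => //; exact: cf.
  by rewrite ler_norml => /andP[? ?]; lra.
- move=> M [_ h]; exists (Order.max 0 (M + 1)); first by rewrite le_max lexx.
  by move=> x Kx; rewrite le_max; apply/orP; right; apply: h => //; rewrite ltrDl.
Unshelve. all: by end_near. Qed.
End General.

(** Only [x] is confined to [K]. This one-sided form also covers pairs that straddle the boundary of
    a support, so it yields global uniform continuity for compactly supported functions. *)
Lemma heine (T : pseudoMetricType R) (K : set T) (f : T -> C) : compact K -> cts f ->
  forall e : R, 0 < e -> exists2 del : R, 0 < del &
    forall x y, K x -> ball x del y -> nc (f x - f y) < e.
Proof.
move=> cK cf e e0.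
have := (compact_near_coveringP K).1 cK R (0^'+ : set_system R)
   (fun del x => forall y, ball x del y -> nc (f x - f y) < e).
case.
- move=> x Kx.
  have cg : continuous (fun y => nc (f y - f x)).
    by apply: continuous_nc; apply: ctsB => //; exact: cts_cst.
  have : \forall y \near x, nc (f y - f x) < e / 2.
    have := cg x; rewrite /continuous_at subrr Normc.normc0 => /cvgrPdist_lt /(_ (e / 2) ltac:(lra)).
    by apply: filterS => y; rewrite sub0r normrN ger0_norm ?nc_ge0.
  move=> /nbhs_ballP[r /= r0 hr].
  near=> x' del => /= y xy.
  have r2 : 0 < r / 2 by rewrite divr_gt0.
  have xx' : ball x (r / 2) x' by near: x'; apply: nbhsx_ballx; rewrite divr_gt0.
  have dr : del <= r / 2 by near: del; apply: nbhs_right_le; rewrite divr_gt0.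
  have h1 : nc (f x' - f x) < e / 2 by apply: hr; apply: le_ball xx'; rewrite ler_pdivrMr// ler_peMr ?ler1n// ltW.
  have h2 : nc (f y - f x) < e / 2.
    apply: hr; rewrite [r]splitr.
    by apply: ball_triangle xx' _; apply: le_ball xy.
  by have := nc_triangle (f x) (f x') (f y); rewrite (ncBC (f x) (f y)); lra.
- move=> M /= M0 h; exists (M / 2); first by move: M0 => /=; lra.
  move=> x y Kx; apply: (h (M / 2)) => //=; last by move: M0 => /=; lra.
  by rewrite sub0r normrN ger0_norm; move: M0 => /=; lra.
Unshelve. all: by end_near. Qed.
End Cts.

Arguments leb : simpl never.
Arguments Normc.normc : simpl never.

Section AbstractContinuity.
Variables (R : realType) (T U W : topologicalType) (V : normedModType R).

Lemma continuous_pair (a : T -> U) (b : T -> W) :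
  continuous a -> continuous b -> continuous (fun x => (a x, b x)).
Proof. by move=> ha hb x; apply: cvg_pair; [exact: ha | exact: hb]. Qed.

Lemma continuous_add (a b : T -> V) :
  continuous a -> continuous b -> continuous (fun x => a x + b x).
Proof. by move=> ha hb x; apply: cvgD; [exact: ha | exact: hb]. Qed.

Lemma continuous_sub (a b : T -> V) :
  continuous a -> continuous b -> continuous (fun x => a x - b x).
Proof. by move=> ha hb x; apply: cvgB; [exact: ha | exact: hb]. Qed.

Lemma continuous_fst : continuous (fun p : T * U => p.1).
Proof. by move=> p; exact: cvg_fst. Qed.

Lemma continuous_snd : continuous (fun p : T * U => p.2).
Proof. by move=> p; exact: cvg_snd. Qed.

Lemma continuous_idfun : continuous (fun x : T => x).
Proof. by move=> x; exact: cvg_id. Qed.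
Lemma continuous_max_cst (u : T -> R) (c : R) : continuous u -> continuous (fun x => Order.max (u x) c).
Proof. by move=> cu x; apply: continuous_max; [exact: cu | exact: cst_continuous]. Qed.

Lemma continuous_scale_inv (c : R) (u : T -> R) : (forall x, u x != 0) -> continuous u ->
  continuous (fun x => c * (u x)^-1).
Proof. by move=> u0 cu x; apply: cvgM; [exact: cvg_cst | apply: cvgV; [exact: u0 | exact: cu]]. Qed.
End AbstractContinuity.

Section CompactSupport.
Variables (R : realType) (d : nat).
Local Notation C := R[i].
Local Notation V := 'rV[R]_d.
Local Notation nc := (@Normc.normc R).
Implicit Types (f g : V -> C) (L A B : R) (x y : V).

(** The radius is explicit because the constants in the bounds for integrals and measures depend on
    a function only through it. *)
Definition cc L f := cts f /\ forall x, L < `|x| -> f x = 0.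

Lemma continuous_rVP (g : V -> R) : continuous g <-> forall x (e : R), 0 < e ->
  exists2 del : R, 0 < del & forall y, `|x - y| < del -> `|g x - g y| < e.
Proof.
have fl x : Filter (nbhs x) by exact: nbhs_filter.
split=> h x.
  move=> e e0; have := h x => /(@cvgrPdist_lt _ _ _ _ (fl x) g (g x)) /(_ e e0).
  move=> /nbhs_ballP[del /= d0 hd]; exists del => // y xy; apply: hd.
  by rewrite -ball_normE.
apply/(@cvgrPdist_lt _ _ _ _ (fl x) g (g x)) => e e0.
have [del d0 hd] := h x e e0; apply/nbhs_ballP; exists del => // y.
by rewrite -ball_normE; exact: hd.
Qed.

Lemma cont_cts f : cont f <-> cts f.
Proof.
split=> [h|[/continuous_rVP h1 /continuous_rVP h2] x e e0].
  split; apply/continuous_rVP => x e e0; have [del d0 hd] := h x e e0; exists del => // y /hd;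
  rewrite nc_lt => /(le_lt_trans _); apply; case: (f x) (f y) => a b [a' b'];
    [exact: (nc_Re (_ +i* _)) | exact: (nc_Im (_ +i* _))].
have e2 : 0 < e / 2 by rewrite divr_gt0.
have [d1 d10 k1] := h1 x _ e2; have [d2 d20 k2] := h2 x _ e2.
exists (Order.min d1 d2); first by rewrite lt_min d10.
move=> y; rewrite lt_min nc_lt => /andP[/k1 + /k2].
have := nc_ReIm (f x - f y); case: (f x) (f y) => a b [a' b'] /=; lra.
Qed.

Lemma box_compact L : compact [set x : V | `|x| <= L].
Proof.
apply: bounded_closed_compact.
  by exists L; split; [exact: num_real | move=> M LM x /= xL; exact: le_trans xL (ltW LM)].
apply: (@closed_comp _ _ (fun x : V => `|x|) [set r : R | r <= L]) => [x _|].
  exact: norm_continuous.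
exact: closed_le.
Qed.

Lemma compact_box (K : set V) : compact K -> exists2 L, 0 <= L & forall x, K x -> `|x| <= L.
Proof.
move=> /compact_bounded[M [_ hM]]; exists (`|M| + 1); first by rewrite addr_ge0.
by move=> x Kx; apply: hM => //; have := ler_norm M; lra.
Qed.

Lemma Cc_cc f : Cc f <-> exists2 L, 0 <= L & cc L f.
Proof.
split=> [[/cont_cts hf [K [/compact_box [L L0 KL] sK]]]|[L L0 [hf hL]]].
  exists L => //; split => // x Lx; apply/eqP; apply: contraTT Lx => /sK/KL.
  by rewrite leNgt.
split; first exact/cont_cts.
exists [set x : V | `|x| <= L]; split; first exact: box_compact.
by move=> x /=; apply: contraNT; rewrite -ltNge => /hL ->.
Qed.

Lemma cc_Cc L f : cc L f -> Cc f.
Proof.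
move=> [hf hL]; apply/Cc_cc; exists (Order.max 0 L); first by rewrite le_max lexx.
by split => // x; rewrite gt_max => /andP[_ /hL].
Qed.

Lemma ccW L L' f : L <= L' -> cc L f -> cc L' f.
Proof. by move=> LL [hf h]; split => // x /(le_lt_trans LL) /h. Qed.

Lemma ccD L f g : cc L f -> cc L g -> cc L (fun x => f x + g x).
Proof.
move=> [hf f0] [hg g0]; split; first exact: ctsD.
by move=> x Lx; rewrite f0// g0// addr0.
Qed.

Lemma ccMr L f g : cts g -> cc L f -> cc L (fun x => f x * g x).
Proof.
by move=> hg [hf f0]; split; [exact: ctsM | move=> x Lx; rewrite f0// mul0r].
Qed.

Lemma ccMl L f g : cts g -> cc L f -> cc L (fun x => g x * f x).
Proof.
by move=> hg [hf f0]; split; [exact: ctsM | move=> x Lx; rewrite f0// mulr0].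
Qed.

Lemma ccZ L (c : C) f : cc L f -> cc L (fun x => c * f x).
Proof. by apply: ccMl; exact: cts_cst. Qed.

Lemma ccB L f g : cc L f -> cc L g -> cc L (fun x => f x - g x).
Proof.
move=> hf hg; have := ccD hf (ccZ (-1) hg).
rewrite (_ : (fun x => _) = (fun x => f x - g x))//.
by apply/funext => x; rewrite mulN1r.
Qed.

Lemma ccJ L f : cc L f -> cc L (fun x => (f x)^*).
Proof.
by move=> [hf f0]; split; [exact: ctsJ | move=> x Lx; rewrite f0// conjc0].
Qed.

Lemma cc0 L : cc L (fun=> 0).
Proof. by split => //; exact: cts_cst. Qed.

Lemma cc_sum L (I : Type) (s : seq I) (P : pred I) (F : I -> V -> C) :
  (forall i, P i -> cc L (F i)) -> cc L (fun x => \sum_(i <- s | P i) F i x).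
Proof.
move=> h; elim: s => [|i s IH].
  by rewrite (_ : (fun x => _) = fun=> 0); [exact: cc0 | apply/funext => x; rewrite big_nil].
rewrite (_ : (fun x => _) = fun x => if P i then F i x + \sum_(i <- s | P i) F i x else \sum_(i <- s | P i) F i x); last first.
  by apply/funext => x; rewrite big_cons.
case Pi: (P i) => //.
by apply: ccD => //; exact: h.
Qed.

Lemma continuous_addl s : continuous (fun x : V => x + s).
Proof. by apply: continuous_add; [exact: continuous_idfun | exact: cst_continuous]. Qed.

Lemma continuous_subr s : continuous (fun x : V => s - x).
Proof. by apply: continuous_sub; [exact: cst_continuous | exact: continuous_idfun]. Qed.

Lemma cc_shift L f s : cc L f -> cc (L + `|s|) (fun x => f (x + s)).
Proof.
move=> [hf f0]; split; first by apply: (cts_comp (h := fun x : V => x + s)) => //; exact: continuous_addl.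
by move=> x Lx; apply: f0; have := ler_normB (x + s) s; rewrite addrK; lra.
Qed.

Lemma cc_refl L f s : cc L f -> cc (L + `|s|) (fun x => f (s - x)).
Proof.
move=> [hf f0]; split; first by apply: (cts_comp (h := fun x : V => s - x)) => //; exact: continuous_subr.
by move=> x Lx; apply: f0; have := ler_normB s (s - x); rewrite opprB addrCA subrr addr0; lra.
Qed.

Lemma cc_opp L f : cc L f -> cc L (fun x => f (- x)).
Proof.
move=> /cc_refl => /(_ 0); rewrite normr0 addr0.
by rewrite (_ : (fun x => _) = (fun x => f (- x)))//; apply/funext => x; rewrite sub0r.
Qed.

Lemma cc_unif L f : cc L f -> forall e : R, 0 < e -> exists2 del : R, 0 < del &
  forall x y, `|x - y| < del -> nc (f x - f y) < e.
Proof.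
move=> [hf f0] e e0; have [del d0 hd] := heine (@box_compact L) hf e0.
exists del => // x y xy.
have [xL|xL] := leP `|x| L; first by apply: hd => //; rewrite -ball_normE.
have [yL|yL] := leP `|y| L; last by rewrite !f0// subrr Normc.normc0.
by rewrite ncBC; apply: hd => //; rewrite -ball_normE /= distrC.
Qed.

Lemma cc_bounded L f : cc L f -> exists2 b : R, 0 <= b & forall x, nc (f x) <= b.
Proof.
move=> [hf f0]; have [b b0 hb] := cts_bounded (@box_compact L) hf.
exists b => // x; have [xL|xL] := leP `|x| L; first exact: hb.
by rewrite f0// Normc.normc0.
Qed.

Definition cc2 A B (F : V -> V -> C) := cts (fun p : V * V => F p.1 p.2) /\
  forall x y, F x y != 0 -> `|x| <= A /\ `|y| <= B.

Lemma cc2_unif A B F : cc2 A B F -> forall e : R, 0 < e -> exists2 del : R, 0 < del &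
  forall x x' y y', `|x - x'| < del -> `|y - y'| < del -> nc (F x y - F x' y') < e.
Proof.
move=> [hF F0] e e0.
have [del d0 hd] := heine (compact_setX (@box_compact A) (@box_compact B)) hF e0.
exists del => // x x' y y' xx yy.
have [h|h] := eqVneq (F x y) 0; last first.
  by apply: (hd (x, y) (x', y')); [exact: F0 | split; rewrite -ball_normE].
have [h'|h'] := eqVneq (F x' y') 0; first by rewrite h h' subrr Normc.normc0.
rewrite ncBC; apply: (hd (x', y') (x, y)); first exact: F0.
by split; rewrite -ball_normE /= distrC.
Qed.

Lemma cc2_swap A B F : cc2 A B F -> cc2 B A (fun y x => F x y).
Proof.
move=> [hF F0]; split; last by move=> y x /F0 [].
apply: (cts_comp (h := fun p : V * V => (p.2, p.1)) (f := fun p => F p.1 p.2)) => //.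
by apply: continuous_pair; [exact: continuous_snd | exact: continuous_fst].
Qed.

Lemma cc2_l A B F y : cc2 A B F -> cc A (fun x => F x y).
Proof.
move=> [hF F0]; split.
  apply: (cts_comp (h := fun x : V => (x, y)) (f := fun p => F p.1 p.2)) => //.
  by apply: continuous_pair; [exact: continuous_idfun | exact: cst_continuous].
by move=> x Ax; apply/eqP; apply: contraTT Ax => /F0[]; rewrite leNgt.
Qed.

Lemma cc2_r A B F x : cc2 A B F -> cc B (fun y => F x y).
Proof. by move=> /cc2_swap /cc2_l; exact. Qed.

Lemma cts_unif f : (forall e : R, 0 < e -> exists2 del : R, 0 < del &
  forall x y, `|x - y| < del -> nc (f x - f y) <= e) -> cts f.
Proof.
move=> h; apply/cont_cts => x e e0.
have [del d0 hd] := h (e / 2) ltac:(lra); exists del => // y /hd; rewrite nc_lt; lra.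
Qed.
End CompactSupport.

(** * The integral [leb] *)

Section ReIm.
Variable R : realType.
Local Notation C := R[i].
Implicit Types z w : C.

Lemma ReD z w : complex.Re (z + w) = complex.Re z + complex.Re w.
Proof. by case: z w => a b []. Qed.
Lemma ImD z w : complex.Im (z + w) = complex.Im z + complex.Im w.
Proof. by case: z w => a b []. Qed.
Lemma ReN z : complex.Re (- z) = - complex.Re z.
Proof. by case: z. Qed.
Lemma ImN z : complex.Im (- z) = - complex.Im z.
Proof. by case: z. Qed.
Lemma ReM z w : complex.Re (z * w) = complex.Re z * complex.Re w - complex.Im z * complex.Im w.
Proof. by case: z w => a b []. Qed.
Lemma ImM z w : complex.Im (z * w) = complex.Re z * complex.Im w + complex.Im z * complex.Re w.
Proof. by case: z w => a b []. Qed.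
Lemma Re_sum (I : Type) (s : seq I) (P : pred I) (F : I -> C) :
  complex.Re (\sum_(i <- s | P i) F i) = \sum_(i <- s | P i) complex.Re (F i).
Proof. exact: (big_morph _ ReD). Qed.
Lemma Im_sum (I : Type) (s : seq I) (P : pred I) (F : I -> C) :
  complex.Im (\sum_(i <- s | P i) F i) = \sum_(i <- s | P i) complex.Im (F i).
Proof. exact: (big_morph _ ImD). Qed.
Lemma complex_eq z w : complex.Re z = complex.Re w -> complex.Im z = complex.Im w -> z = w.
Proof. by case: z w => a b [a' b'] /= -> ->. Qed.
End ReIm.

Section Iterated.
Variable R : realType.

Lemma slice_lebR0 n (L : R) (g : 'rV[R]_n.+1 -> R) (t : R) : ucr L g -> L < `|t| ->
  lebR (fun y : 'rV[R]_n => g (row_mx (const_mx t : 'rV[R]_1) y)) = 0.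
Proof. by move=> gu Lt; rewrite (ucr_slice0 gu Lt) lebR0. Qed.

Lemma row_split n (s : 'rV[R]_n.+1) :
  s = row_mx (const_mx (s ord0 ord0) : 'rV[R]_1) (rsubmx (s : 'rV[R]_(1 + n))).
Proof.
have <- : lsubmx (s : 'rV[R]_(1 + n)) = const_mx (s ord0 ord0).
  by apply/rowP => i; rewrite !mxE ord1; congr (s _ _); exact/val_inj.
by rewrite (@hsubmxK R 1 1 n).
Qed.

Lemma lebR_shift n (L : R) (g : 'rV[R]_n -> R) s : 0 <= L -> ucr L g ->
  lebR (fun x => g (x + s)) = lebR g.
Proof.
move=> L0; elim: n g s => [|n IH] g s gu /=; first by rewrite (thinmx0 s) addr0.
have [A A0 HA] := riemann_sum n L0.
pose s0 : R := s ord0 ord0; pose s1 : 'rV[R]_n := rsubmx (s : 'rV[R]_(1 + n)).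
have e (t : R) (y : 'rV[R]_n) : row_mx (const_mx t : 'rV[R]_1) y + s =
    row_mx (const_mx (t + s0) : 'rV[R]_1) (y + s1).
  rewrite [s in LHS]row_split add_row_mx; congr row_mx.
  by apply/rowP => i; rewrite !mxE.
rewrite -[RHS](Rintegral_shift s0 (slice_continuous A0 HA gu) (fun t => slice_lebR0 (t := t) gu)).
apply: eq_Rintegral => t _.
rewrite -(IH _ s1 (ucr_slice (t + s0) gu)); congr (lebR _).
by apply/funext => y; rewrite e.
Qed.

Lemma lebR_opp n (L : R) (g : 'rV[R]_n -> R) : 0 <= L -> ucr L g ->
  lebR (fun x => g (- x)) = lebR g.
Proof.
move=> L0; elim: n g => [|n IH] g gu /=; first by rewrite oppr0.
have [A A0 HA] := riemann_sum n L0.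
rewrite -[RHS](Rintegral_opp_arg (slice_continuous A0 HA gu) (fun t => slice_lebR0 (t := t) gu)).
apply: eq_Rintegral => t _.
rewrite -(IH _ (ucr_slice (- t) gu)); congr (lebR _).
apply/funext => y; congr g; apply: etrans (@opp_row_mx R 1 1 n _ _) _; congr row_mx.
by apply/rowP => i; rewrite !mxE.
Qed.
End Iterated.

Section Leb.
Variables (R : realType) (d : nat).
Local Notation C := R[i].
Local Notation V := 'rV[R]_d.
Local Notation nc := (@Normc.normc R).
Implicit Types (f g : V -> C) (L A B : R) (x y : V).

Lemma cc_ucrRe L f : cc L f -> ucr L (fun x => complex.Re (f x)).
Proof.
move=> hf; split; first by move=> x Lx; rewrite hf.2.
move=> e e0; have [del d0 h] := cc_unif hf e0; exists del => // x y /h.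
by apply: le_lt_trans; rewrite -ReN -ReD; exact: nc_Re.
Qed.

Lemma cc_ucrIm L f : cc L f -> ucr L (fun x => complex.Im (f x)).
Proof.
move=> hf; split; first by move=> x Lx; rewrite hf.2.
move=> e e0; have [del d0 h] := cc_unif hf e0; exists del => // x y /h.
by apply: le_lt_trans; rewrite -ImN -ImD; exact: nc_Im.
Qed.

Lemma leb_riemann L : 0 <= L -> exists2 A : R, 0 <= A & forall del : R, 0 < del ->
  exists (I : finType) (w : R) (v : I -> V), [/\ 0 <= w, w * #|I|%:R <= A &
  forall f (e : R), cc L f -> (forall x y, `|x - y| < del -> nc (f x - f y) <= e) ->
    nc (leb f - w%:C * \sum_i f (v i)) <= A * e].
Proof.
move=> L0; have [A A0 HA] := riemann_sum d L0.
exists (2 * A); first by rewrite mulr_ge0.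
move=> del d0; have [I [w [v [w0 wA Iv]]]] := HA del d0.
exists I, w, v; split => //; first by apply: le_trans wA _; lra.
move=> f e hf mf; apply: le_trans (nc_ReIm _) _.
rewrite ReD ReN ReM ImD ImN ImM /= !mul0r subr0 addr0 Re_sum Im_sum.
rewrite (_ : 2 * A * e = A * e + A * e); last by ring.
apply: lerD; apply: Iv; [exact: cc_ucrRe| |exact: cc_ucrIm|] => x y xy.
  by apply: le_trans (mf x y xy); rewrite -ReN -ReD; exact: nc_Re.
by apply: le_trans (mf x y xy); rewrite -ImN -ImD; exact: nc_Im.
Qed.

(** Common nodes for a finite family: an algebraic relation between integrals follows from the same
    relation between finite sums, up to an arbitrarily small error. *)
Lemma leb_riemann_fam L : 0 <= L -> exists2 A : R, 0 <= A &
  forall (J : finType) (F : J -> V -> C) (e : R), 0 < e -> (forall j, cc L (F j)) ->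
  exists (I : finType) (w : R) (v : I -> V), [/\ 0 <= w, w * #|I|%:R <= A &
  forall j, nc (leb (F j) - w%:C * \sum_i F j (v i)) <= e].
Proof.
move=> L0; have [A A0 HA] := leb_riemann L0; exists A => // J F e e0 hF.
have e1 : 0 < e / (A + 1) by rewrite divr_gt0//; lra.
have : \forall del \near (0:R)^'+, forall j x y, `|x - y| < del -> nc (F j x - F j y) <= e / (A + 1).
  apply: filter_forall => j; have [del d0 hd] := cc_unif (hF j) e1.
  near=> r => x y xy; apply/ltW/hd; apply: lt_le_trans xy _.
  by near: r; apply: nbhs_right_le.
move=> h; have /filter_ex[del [d0 hd]] : \forall del \near (0:R)^'+, 0 < del /\
   forall j x y, `|x - y| < del -> nc (F j x - F j y) <= e / (A + 1).
  by near=> r; split; [near: r; exact: nbhs_right_gt | near: r].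
have [I [w [v [w0 wA Iv]]]] := HA del d0.
exists I, w, v; split => // j; apply: le_trans (Iv _ _ (hF j) (hd j)) _.
by rewrite mulrA ler_pdivrMr; [nra | lra].
Unshelve. all: by end_near. Qed.

Lemma leb0 : leb (fun _ : V => 0) = 0 :> C.
Proof. by rewrite /leb lebR0. Qed.

Lemma lebD L f g : 0 <= L -> cc L f -> cc L g -> leb (fun x => f x + g x) = leb f + leb g.
Proof.
move=> L0 hf hg; apply/subr0_eq/nc_small => e e0.
have [A A0 HA] := leb_riemann_fam L0.
pose F (j : option bool) := match j with Some true => f | Some false => g | None => fun x => f x + g x end.
have [|[[]|]|I [w [v [w0 _ Iv]]]] := HA _ F (e / 3); rewrite /F//; first by lra.
  exact: ccD.
have := Iv None; have := Iv (Some true); have := Iv (Some false); rewrite /= big_split/= mulrDr.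
move: (leb (fun x => f x + g x)) (leb f) (leb g) (w%:C * \sum_i f (v i)) (w%:C * \sum_i g (v i)).
move=> a b c a' b' h1 h2 h3.
rewrite (_ : a - (b + c) = (a - (a' + b')) - (b - a') - (c - b')); last by ring.
have := ncD (a - (a' + b') - (b - a')) (- (c - b')).
have := ncD (a - (a' + b')) (- (b - a')); rewrite !ncN; lra.
Qed.

Lemma lebZ L (c : C) f : 0 <= L -> cc L f -> leb (fun x => c * f x) = c * leb f.
Proof.
move=> L0 hf; apply/subr0_eq/nc_small => e e0.
have [A A0 HA] := leb_riemann_fam L0.
pose F (j : bool) := if j then f else fun x => c * f x.
have c0 := nc_ge0 c.
have e1 : 0 < e / (2 + nc c) by rewrite divr_gt0//; lra.
have [|[]|I [w [v [w0 _ Iv]]]] := HA _ F (e / (2 + nc c)); rewrite /F//.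
  exact: ccZ.
have := Iv true; have := Iv false; rewrite /= -mulr_sumr mulrCA.
move: (leb (fun x => c * f x)) (leb f) (w%:C * \sum_i f (v i)) => a b b' h1 h2.
rewrite (_ : a - c * b = (a - c * b') - c * (b - b')); last by ring.
apply: le_trans (ncD _ _) _; rewrite ncN Normc.normcM.
have h3 : nc c * nc (b - b') <= nc c * (e / (2 + nc c)) by rewrite ler_wpM2l.
apply: le_trans (lerD h1 h3) _.
have : e = (2 + nc c) * (e / (2 + nc c)) by rewrite mulrC divfK// gt_eqF//; lra.
by move: e1; move: (e / _) => z z0 ->; nra.
Qed.

Lemma lebB L f g : 0 <= L -> cc L f -> cc L g -> leb (fun x => f x - g x) = leb f - leb g.
Proof.
move=> L0 hf hg; have := lebD L0 hf (ccZ (-1) hg); rewrite (lebZ _ L0 hg) mulN1r => <-.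
by congr leb; apply/funext => x; rewrite mulN1r.
Qed.

Lemma leb_bound L : 0 <= L -> exists2 A : R, 0 <= A &
  forall f (b : R), cc L f -> (forall x, nc (f x) <= b) -> nc (leb f) <= A * b.
Proof.
move=> L0; have [A A0 HA] := leb_riemann_fam L0; exists A => // f b hf hb.
have b0 : 0 <= b := le_trans (nc_ge0 _) (hb 0).
apply/ler_addgt0Pr => e e0.
have [I [w [v [w0 wA /(_ tt) h]]]] := HA unit (fun=> f) e e0 (fun=> hf).
have h2 : nc (w%:C * \sum_i f (v i)) <= A * b.
  rewrite Normc.normcM (nc_real w0); apply: (@le_trans _ _ (w * (#|I|%:R * b))).
    rewrite ler_wpM2l//; apply: le_trans (nc_sum _ _ _) _.
    by rewrite mulr_natl -sumr_const; apply: ler_sum.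
  by rewrite mulrA ler_wpM2r.
move: h h2; move: (leb _) (w%:C * _) => p q h h2.
have := ncD (p - q) q; rewrite subrK; lra.
Qed.

Lemma leb_ge0 L f : 0 <= L -> cc L f -> (forall x, 0 <= f x) -> 0 <= leb f.
Proof.
move=> L0 hf f0; have [A A0 HA] := leb_riemann_fam L0.
have h (e : R) : 0 < e -> `|complex.Im (leb f)| <= e /\ - e <= complex.Re (leb f).
  move=> e0; have [I [w [v [w0 wA /(_ tt) hI]]]] := HA unit (fun=> f) e e0 (fun=> hf).
  have [hR h2] : w%:C * \sum_i f (v i) = (complex.Re (w%:C * \sum_i f (v i)))%:C /\
     0 <= complex.Re (w%:C * \sum_i f (v i)).
    by apply: ge0_complex; rewrite mulr_ge0 ?ler0c// sumr_ge0.
  have := le_trans (nc_Re _) hI; have := le_trans (nc_Im _) hI.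
  rewrite hR ReD ReN ImD ImN /= subr0 => h3; rewrite ler_norml => /andP[h4 _]; split=> //.
  by move: h2 h4; move: (complex.Re (w%:C * _)) => q; lra.
have i0 : complex.Im (leb f) = 0.
  apply/eqP; rewrite -normr_eq0 eq_le normr_ge0 andbT.
  by apply/ler_addgt0Pr => e /h [? _]; rewrite add0r.
have r0 : 0 <= complex.Re (leb f).
  by apply/ler_addgt0Pr => e /h [_ ?]; lra.
by rewrite lecE i0 r0 eqxx.
Qed.

Lemma leb_shift L f s : 0 <= L -> cc L f -> leb (fun x => f (x + s)) = leb f.
Proof.
move=> L0 hf; rewrite /leb; congr (_ +i* _).
  exact: (lebR_shift s L0 (cc_ucrRe hf)).
exact: (lebR_shift s L0 (cc_ucrIm hf)).
Qed.

Lemma leb_opp L f : 0 <= L -> cc L f -> leb (fun x => f (- x)) = leb f.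
Proof.
move=> L0 hf; rewrite /leb; congr (_ +i* _).
  exact: (lebR_opp L0 (cc_ucrRe hf)).
exact: (lebR_opp L0 (cc_ucrIm hf)).
Qed.

Lemma leb_conj L f : 0 <= L -> cc L f -> leb (fun x => (f x)^*) = (leb f)^*.
Proof.
move=> L0 hf; apply/subr0_eq/nc_small => e e0.
have [A A0 HA] := leb_riemann_fam L0.
pose F (j : bool) := if j then f else fun x => (f x)^*.
have e2 : 0 < e / 2 by lra.
have [|[]|I [w [v [w0 _ Iv]]]] := HA _ F (e / 2); rewrite /F//.
  exact: ccJ.
have h1 : nc (w%:C * (\sum_i f (v i))^* - (leb f)^*) <= e / 2.
  have -> : w%:C * (\sum_i f (v i))^* = (w%:C * \sum_i f (v i))^* by rewrite rmorphM /= oppr0.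
  by rewrite -rmorphB ncJ ncBC; exact: (Iv true).
have h2 := Iv false; rewrite /= -rmorph_sum /= in h2.
have := nc_triangle (w%:C * (\sum_i f (v i))^*) (leb (fun x => (f x)^*)) (leb f)^*; lra.
Qed.

(** Makes [leb] an instance of the results on abstract measures; [meas_fubini] then also exchanges
    two Lebesgue integrals, and [meas_cc2] gives the continuity of convolutions. *)
Lemma leb_measure : is_measure (@leb R d).
Proof.
split.
- move=> f g /Cc_cc[L L0 hf] /Cc_cc[L' L0' hg].
  have LL : L <= Order.max L L' by rewrite le_max lexx.
  have LL' : L' <= Order.max L L' by rewrite le_max lexx orbT.
  by apply: (@lebD (Order.max L L')); [exact: le_trans LL | exact: ccW hf | exact: ccW hg].
- by move=> c f /Cc_cc[L L0 hf]; exact: (lebZ _ L0 hf).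
- move=> K /compact_box[L L0 KL]; have [A A0 HA] := leb_bound L0; exists A => f b hf sf hb.
  rewrite nc_le; apply: HA; last by move=> x; rewrite -nc_le; exact: hb.
  have /Cc_cc[L' _ [cf _]] := hf; split => // x; apply: contraTeq => /sf/KL; by rewrite leNgt.
Qed.
End Leb.

(** * Measures as functionals, and Fubini's theorem *)

Section Measure.
Variables (R : realType) (d : nat).
Local Notation C := R[i].
Local Notation V := 'rV[R]_d.
Local Notation nc := (@Normc.normc R).
Variable mu : (V -> C) -> C.
Hypothesis hmu : is_measure mu.
Implicit Types (f g : V -> C) (L A B : R) (x y : V).

Lemma measD f g : Cc f -> Cc g -> mu (fun x => f x + g x) = mu f + mu g.
Proof. by case: hmu => h _ _; exact: h. Qed.

Lemma measZ (c : C) f : Cc f -> mu (fun x => c * f x) = c * mu f.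
Proof. by case: hmu => _ h _; exact: h. Qed.

Lemma meas0 : mu (fun=> 0) = 0.
Proof.
have h : Cc (fun _ : V => 0 : C) by apply: (cc_Cc (L := 0)); exact: cc0.
by rewrite -[RHS](mul0r (mu (fun=> 0))) -(measZ 0 h); congr mu; apply/funext => x; rewrite mul0r.
Qed.

Lemma CcZ (c : C) f : Cc f -> Cc (fun x => c * f x).
Proof. by move=> /Cc_cc[L L0 hf]; apply: (cc_Cc (L := L)); exact: ccZ. Qed.

Lemma CcD f g : Cc f -> Cc g -> Cc (fun x => f x + g x).
Proof.
move=> /Cc_cc[L L0 hf] /Cc_cc[L' L0' hg]; apply: (cc_Cc (L := Order.max L L')).
by apply: ccD; [apply: ccW hf | apply: ccW hg]; rewrite le_max lexx ?orbT.
Qed.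

Lemma CcMl f g : cts g -> Cc f -> Cc (fun x => g x * f x).
Proof. by move=> hg /Cc_cc[L L0 hf]; apply: (cc_Cc (L := L)); exact: ccMl. Qed.

Lemma CcMr f g : cts g -> Cc f -> Cc (fun x => f x * g x).
Proof. by move=> hg /Cc_cc[L L0 hf]; apply: (cc_Cc (L := L)); exact: ccMr. Qed.

Lemma Cc_cts f : Cc f -> cts f.
Proof. by move=> /Cc_cc[L _ []]. Qed.

Lemma measB f g : Cc f -> Cc g -> mu (fun x => f x - g x) = mu f - mu g.
Proof.
move=> hf hg; rewrite -mulN1r -measZ// -measD//; last exact: CcZ.
by congr mu; apply/funext => x; rewrite mulN1r.
Qed.

Lemma CcB f g : Cc f -> Cc g -> Cc (fun x => f x - g x).
Proof.
move=> hf hg; rewrite (_ : (fun x => _) = fun x => f x + -1 * g x).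
  by apply: CcD => //; exact: CcZ.
by apply/funext => x; rewrite mulN1r.
Qed.

Lemma meas_sum (I : Type) (s : seq I) (F : I -> V -> C) : (forall i, Cc (F i)) ->
  mu (fun x => \sum_(i <- s) F i x) = \sum_(i <- s) mu (F i).
Proof.
move=> h; elim: s => [|i s IH].
  by rewrite big_nil; apply: etrans meas0; congr mu; apply/funext => x; rewrite big_nil.
rewrite big_cons -IH -measD//; last first.
  elim: s {IH} => [|j s IH].
    rewrite (_ : (fun x => _) = fun=> 0); last by apply/funext => x; rewrite big_nil.
    by apply: (cc_Cc (L := 0)); exact: cc0.
  rewrite (_ : (fun x => _) = fun x => F j x + \sum_(i <- s) F i x); first exact: CcD.
  by apply/funext => x; rewrite big_cons.
by congr mu; apply/funext => x; rewrite big_cons.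
Qed.

Lemma meas_bound L : exists2 M : R, 0 <= M &
  forall f (b : R), cc L f -> (forall x, nc (f x) <= b) -> nc (mu f) <= M * b.
Proof.
case: hmu => _ _ /(_ _ (@box_compact R d L))[M hM].
exists (Order.max 0 M); first by rewrite le_max lexx.
move=> f b hf hb; have b0 : 0 <= b := le_trans (nc_ge0 _) (hb 0).
apply: (@le_trans _ _ (M * b)); last by rewrite ler_wpM2r// le_max lexx orbT.
rewrite -nc_le; apply: hM; first exact: cc_Cc hf.
  by move=> x /=; apply: contraNT; rewrite -ltNge => /hf.2 ->.
by move=> x; rewrite nc_le.
Qed.

Lemma meas_cc2 A B (F : V -> V -> C) : cc2 A B F -> cc B (fun y => mu (fun x => F x y)).
Proof.
move=> hF; split.
  have [M M0 hM] := meas_bound A.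
  apply: cts_unif => e e0.
  have e1 : 0 < e / (M + 1) by rewrite divr_gt0//; lra.
  have [del d0 hd] := cc2_unif hF e1.
  exists del => // y y' yy; rewrite -measB; try exact: cc_Cc (cc2_l _ hF).
  apply: le_trans (hM _ (e / (M + 1)) _ _) _.
  - by apply: ccB; exact: cc2_l hF.
  - by move=> x; apply/ltW/hd => //; rewrite subrr normr0.
  - by rewrite mulrA ler_pdivrMr; [nra | lra].
move=> y By; rewrite -meas0; congr mu; apply/funext => x; exact: (cc2_r x hF).2.
Qed.

(** A Riemann sum in [y] approximates the inner integral uniformly in [x], and [mu] passes through a
    finite sum by linearity. Both sides are thus within [M * A' * z] of one and the same finite
    sum. *)
Lemma meas_fubini A B (F : V -> V -> C) : 0 <= B -> cc2 A B F ->
  mu (fun x => leb (fun y => F x y)) = leb (fun y => mu (fun x => F x y)).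
Proof.
move=> B0 hF; apply/subr0_eq/nc_small => e e0.
have [M M0 hM] := meas_bound A.
have [A' A'0 HA] := leb_riemann d B0.
have MA : 0 <= M * A' by rewrite mulr_ge0.
set z := e / (2 * (M * A') + 1).
have z0 : 0 < z by rewrite divr_gt0//; lra.
have ez : 2 * (M * A' * z) <= e.
  by rewrite /z !mulrA ler_pdivrMr; [nra | lra].
have [del d0 hd] := cc2_unif hF z0.
have [I [w [v [w0 wA Iv]]]] := HA del d0.
have hG := meas_cc2 hF.
have h1 : nc (leb (fun y => mu (fun x => F x y)) - w%:C * \sum_i mu (fun x => F x (v i))) <= A' * (M * z).
  apply: Iv => // y y' yy; rewrite -measB; try exact: cc_Cc (cc2_l _ hF).
  apply: hM; first by apply: ccB; exact: cc2_l hF.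
  by move=> x; apply/ltW/hd => //; rewrite subrr normr0.
have h2 x : nc (leb (fun y => F x y) - w%:C * \sum_i F x (v i)) <= A' * z.
  apply: Iv; first exact: cc2_r hF.
  by move=> y y' yy; apply/ltW/hd => //; rewrite subrr normr0.
have hlA : cc A (fun x => leb (fun y => F x y)).
  have [hc h0] := cc2_swap hF.
  split; last first.
    move=> x Ax; rewrite -[RHS](leb0 R d); congr leb; apply/funext => y; exact: (cc2_l y hF).2.
  apply: cts_unif => e' e'0; have [b b0 hb] := leb_bound d B0.
  have e1 : 0 < e' / (b + 1) by rewrite divr_gt0//; lra.
  have [del' d'0 hd'] := cc2_unif hF e1.
  exists del' => // x x' xx; rewrite -(lebB B0); try exact: cc2_r hF.
  apply: le_trans (hb _ (e' / (b + 1)) _ _) _.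
  - by apply: ccB; exact: cc2_r hF.
  - by move=> y; apply/ltW/hd' => //; rewrite subrr normr0.
  - by rewrite mulrA ler_pdivrMr; [nra | lra].
have hsA : cc A (fun x => w%:C * \sum_i F x (v i)).
  by apply: ccZ; apply: cc_sum => i _; exact: cc2_l hF.
have h3 : nc (mu (fun x => leb (fun y => F x y)) - w%:C * \sum_i mu (fun x => F x (v i))) <= M * (A' * z).
  rewrite -meas_sum; last by move=> i; exact: cc_Cc (cc2_l _ hF).
  rewrite -measZ; last by apply: (cc_Cc (L := A)); apply: cc_sum => i _; exact: cc2_l hF.
  rewrite -measB; [|exact: cc_Cc hlA|exact: cc_Cc hsA].
  by apply: hM => //; exact: ccB.
have := nc_triangle (w%:C * \sum_i mu (fun x => F x (v i))) (mu (fun x => leb (fun y => F x y)))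
  (leb (fun y => mu (fun x => F x y))).
rewrite ncBC in h1.
rewrite (_ : M * (A' * z) = M * A' * z) in h3; last by ring.
rewrite (_ : A' * (M * z) = M * A' * z) in h1; last by ring.
lra.
Qed.

End Measure.

Section Exponential.
Variables (R : realType) (d : nat).
Local Notation V := 'rV[R]_d.
Local Notation nc := (@Normc.normc R).
Local Notation e2 := (@expi2pi R).
Implicit Types (s t : R) (x y z : V).

Lemma expiD s t : e2 (s + t) = e2 s * e2 t.
Proof.
by rewrite /expi2pi mulrDr; apply: complex_eq; rewrite ?ReM ?ImM /= ?cosD ?sinD//; ring.
Qed.

Lemma expi0 : e2 0 = 1.
Proof. by rewrite /expi2pi mulr0 cos0 sin0. Qed.

Lemma expiN t : e2 (- t) = (e2 t)^*.
Proof. by rewrite /expi2pi mulrN cosN sinN. Qed.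

Lemma nc_expi t : nc (e2 t) = 1.
Proof. by rewrite /Normc.normc /expi2pi cos2Dsin2 sqrtr1. Qed.

Lemma nc_expi_lip s t : nc (e2 s - e2 t) <= 4 * pi * `|s - t|.
Proof.
have pi0 := pi_ge0 R.
have lip (f df : R -> R) (a b : R) : (forall x : R, is_derive x (1:R) f (df x)) ->
    (forall x : R, `|df x| <= 1) -> `|f b - f a| <= `|b - a|.
  move=> hf hdf; wlog ab : a b / a <= b.
    by move=> h; have [/h//|/ltW/h] := leP a b; rewrite distrC (distrC b).
  have [c _ ->] := @MVT_segment R f df a b ab (fun (x:R) _ => hf x)
    ltac:(apply: continuous_subspaceT => x;
     apply/differentiable_continuous/derivable1_diffP; exact: ex_derive).
  by rewrite normrM ler_piMl.
apply: le_trans (nc_ReIm _) _.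
rewrite /expi2pi ReD ReN ImD ImN /=.
have h1 : `|cos (2 * pi * s) - cos (2 * pi * t)| <= `|2 * pi * s - 2 * pi * t|.
  apply: (lip (@cos R) (fun x : R => - sin x) (2 * pi * t) (2 * pi * s)) => x; rewrite ?normrN ?ler_norml.
  by rewrite sin_geN1 sin_le1.
have h2 : `|sin (2 * pi * s) - sin (2 * pi * t)| <= `|2 * pi * s - 2 * pi * t|.
  apply: (lip (@sin R) (@cos R) (2 * pi * t) (2 * pi * s)) => x; rewrite ?ler_norml.
  by rewrite cos_geN1 cos_le1.
have h3 : `|2 * pi * s - 2 * pi * t| = 2 * pi * `|s - t|.
  by rewrite -mulrBr normrM ger0_norm// mulr_ge0.
rewrite h3 in h1 h2; lra.
Qed.

Lemma dotvDl x y z : dotv (x + y) z = dotv x z + dotv y z.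
Proof. by rewrite /dotv -big_split; apply: eq_bigr => i _; rewrite mxE mulrDl. Qed.

Lemma dotvC x y : dotv x y = dotv y x.
Proof. by apply: eq_bigr => i _; rewrite mulrC. Qed.

Lemma dotvNl x z : dotv (- x) z = - dotv x z.
Proof. by rewrite /dotv -sumrN; apply: eq_bigr => i _; rewrite mxE mulNr. Qed.

Lemma dotvBl x y z : dotv (x - y) z = dotv x z - dotv y z.
Proof. by rewrite dotvDl dotvNl. Qed.

Lemma dotvDr x y z : dotv x (y + z) = dotv x y + dotv x z.
Proof. by rewrite dotvC dotvDl !(dotvC x). Qed.

Lemma dotvBr x y z : dotv x (y - z) = dotv x y - dotv x z.
Proof. by rewrite dotvC dotvBl !(dotvC x). Qed.

Lemma dotv_bound x y : `|dotv x y| <= d%:R * (`|x| * `|y|).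
Proof.
apply: le_trans (ler_norm_sum _ _ _) _.
rewrite (_ : d%:R * _ = \sum_(i < d) `|x| * `|y|); last by rewrite sumr_const card_ord mulr_natl.
apply: ler_sum => i _.
by rewrite normrM ler_pM// rV_norm_ge.
Qed.

Lemma continuous_dotv : continuous (fun p : V * V => dotv p.1 p.2).
Proof.
have h (i : 'I_d) : continuous (fun x : V => x ord0 i) by exact: coord_continuous.
have h1 (i : 'I_d) : continuous (fun p : V * V => p.1 ord0 i * p.2 ord0 i).
  move=> p; apply: cvgM.
    apply: (@continuous_comp _ _ _ (fun p : V * V => p.1) (fun x : V => x ord0 i)); last exact: h.
    exact: continuous_fst.
  apply: (@continuous_comp _ _ _ (fun p : V * V => p.2) (fun x : V => x ord0 i)); last exact: h.
  exact: continuous_snd.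
rewrite /dotv; elim: (index_enum _) => [|i s IH] p.
  rewrite (_ : (fun p => _) = fun=> 0); first exact: cvg_cst.
  by apply/funext => q; rewrite big_nil.
rewrite (_ : (fun p => _) = fun p : V * V => p.1 ord0 i * p.2 ord0 i + \sum_(i <- s) p.1 ord0 i * p.2 ord0 i).
  by apply: cvgD; [exact: h1 | exact: IH].
by apply/funext => q; rewrite big_cons.
Qed.

Lemma cts_expdot : cts (fun p : V * V => e2 (dotv p.1 p.2)).
Proof. by apply: cts_expi; exact: continuous_dotv. Qed.

Lemma cts_expdotl y : cts (fun x : V => e2 (dotv x y)).
Proof.
apply: (cts_comp (h := fun x : V => (x, y)) (f := fun p : V * V => e2 (dotv p.1 p.2))).
  by apply: continuous_pair; [exact: continuous_idfun | exact: cst_continuous].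
exact: cts_expdot.
Qed.

Lemma cts_expdotr x : cts (fun y : V => e2 (dotv x y)).
Proof. by under eq_fun do rewrite dotvC; exact: cts_expdotl. Qed.

End Exponential.

(** * Transforms and convolutions *)

Section Check.
Variables (R : realType) (d : nat).
Local Notation C := R[i].
Local Notation V := 'rV[R]_d.
Local Notation nc := (@Normc.normc R).
Local Notation cv := (@Defs.conv R d).
Local Notation e2 := (@expi2pi R).
Implicit Types (f g : V -> C) (L A B : R) (x y t : V).

Lemma cc_exp L f y : cc L f -> cc L (fun x => f x * e2 (dotv x y)).
Proof. by apply: ccMr; exact: cts_expdotl. Qed.

Lemma check_bound L : 0 <= L -> exists2 A : R, 0 <= A &
  forall f (b : R), cc L f -> (forall x, nc (f x) <= b) -> forall y, nc (checkf f y) <= A * b.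
Proof.
move=> L0; have [A A0 HA] := leb_bound d L0; exists A => // f b hf hb y.
by apply: HA; [exact: cc_exp | move=> x; rewrite Normc.normcM nc_expi mulr1].
Qed.

Lemma checkD L f g y : 0 <= L -> cc L f -> cc L g ->
  checkf (fun x => f x + g x) y = checkf f y + checkf g y.
Proof.
move=> L0 hf hg; rewrite /checkf -(lebD L0); try exact: cc_exp.
by congr leb; apply/funext => x; rewrite mulrDl.
Qed.

Lemma checkZ L (c : C) f y : 0 <= L -> cc L f -> checkf (fun x => c * f x) y = c * checkf f y.
Proof.
move=> L0 hf; rewrite /checkf -(lebZ _ L0); last exact: cc_exp.
by congr leb; apply/funext => x; rewrite mulrA.
Qed.

Lemma checkB L f g y : 0 <= L -> cc L f -> cc L g ->
  checkf (fun x => f x - g x) y = checkf f y - checkf g y.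
Proof.
move=> L0 hf hg; rewrite /checkf -(lebB L0); try exact: cc_exp.
by congr leb; apply/funext => x; rewrite mulrBl.
Qed.

Lemma check_lip L f : 0 <= L -> cc L f -> exists2 K : R, 0 <= K &
  forall y y', nc (checkf f y - checkf f y') <= K * `|y - y'|.
Proof.
move=> L0 hf; have [A A0 HA] := leb_bound d L0.
have [b b0 hb] := cc_bounded hf.
have pi0 := pi_ge0 R.
exists (A * (b * (4 * pi * (d%:R * L)))); first by rewrite !mulr_ge0.
move=> y y'; rewrite /checkf -(lebB L0); try exact: cc_exp.
rewrite -mulrA; apply: HA; first by apply: ccB; exact: cc_exp.
move=> x; rewrite -mulrBr Normc.normcM.
have [xL|xL] := leP `|x| L; last first.
  by rewrite hf.2// Normc.normc0 mul0r !mulr_ge0.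
rewrite -mulrA ler_pM ?nc_ge0//; apply: le_trans (nc_expi_lip _ _) _.
rewrite -dotvBr -!mulrA ler_wpM2l// ler_wpM2l//.
apply: le_trans (dotv_bound _ _) _.
by rewrite ler_wpM2l// ler_wpM2r.
Qed.

Lemma cts_check L f : 0 <= L -> cc L f -> cts (checkf f).
Proof.
move=> L0 hf; have [K K0 hK] := check_lip L0 hf.
apply: cts_unif => e e0; exists (e / (K + 1)); first by rewrite divr_gt0//; lra.
move=> y y'; rewrite ltr_pdivlMr; last by lra.
move=> h; apply: le_trans (hK y y') _; have := normr_ge0 (y - y'); nra.
Qed.

Lemma check_mod f t y : checkf (fun x => f x * e2 (dotv x t)) y = checkf f (y + t).
Proof.
rewrite /checkf; congr leb; apply/funext => x.
by rewrite -mulrA -expiD dotvDr addrC.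
Qed.

Lemma check_shift L f t y : 0 <= L -> cc L f ->
  checkf (fun x => f (x - t)) y = e2 (dotv t y) * checkf f y.
Proof.
move=> L0 hf.
rewrite {2}/checkf -(lebZ _ L0); last exact: cc_exp.
have h : cc L (fun x => e2 (dotv t y) * (f x * e2 (dotv x y))) by apply: ccZ; exact: cc_exp.
rewrite -(leb_shift (- t) L0 h) /checkf; congr leb; apply/funext => x.
by rewrite mulrCA -expiD -dotvDl (addrC t) subrK.
Qed.

Lemma cc2_conv Lf Lg f g : cc Lf f -> cc Lg g -> cc2 (Lf + Lg) Lg (fun x y => f (x - y) * g y).
Proof.
move=> [hf f0] [hg g0]; split.
  apply: ctsM.
    apply: (cts_comp (h := fun p : V * V => p.1 - p.2)) => //.
    by apply: continuous_sub; [exact: continuous_fst | exact: continuous_snd].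
  by apply: (cts_comp (h := fun p : V * V => p.2)) => //; exact: continuous_snd.
move=> x y; rewrite mulf_eq0 negb_or => /andP[fn gn].
have h1 : `|x - y| <= Lf by rewrite leNgt; apply/negP => /f0 h; rewrite h eqxx in fn.
have h2 : `|y| <= Lg by rewrite leNgt; apply/negP => /g0 h; rewrite h eqxx in gn.
by split => //; have := ler_normD (x - y) y; rewrite subrK; lra.
Qed.

Lemma cc_conv Lf Lg f g : cc Lf f -> cc Lg g -> cc (Lf + Lg) (cv f g).
Proof. by move=> hf hg; exact: (meas_cc2 (leb_measure R d) (cc2_swap (cc2_conv hf hg))). Qed.

Lemma cc2M A B (F G : V -> V -> C) : cts (fun p : V * V => G p.1 p.2) -> cc2 A B F ->
  cc2 A B (fun x y => F x y * G x y).
Proof.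
move=> hG [hF F0]; split; first exact: ctsM.
by move=> x y; rewrite mulf_eq0 negb_or => /andP[/F0].
Qed.

Lemma check_conv Lf Lg f g y : 0 <= Lf -> 0 <= Lg -> cc Lf f -> cc Lg g ->
  checkf (cv f g) y = checkf f y * checkf g y.
Proof.
move=> Lf0 Lg0 hf hg.
have h1 : cc2 (Lf + Lg) Lg (fun x z => f (x - z) * g z * e2 (dotv x y)).
  apply: (cc2M (G := fun x _ => e2 (dotv x y))); last exact: cc2_conv.
  apply: (cts_comp (h := fun p : V * V => p.1) (f := fun x : V => e2 (dotv x y))).
    exact: continuous_fst.
  exact: cts_expdotl.
have -> : checkf (cv f g) y = leb (fun x => leb (fun z => f (x - z) * g z * e2 (dotv x y))).
  rewrite /checkf; congr leb; apply/funext => x; rewrite mulrC /Defs.conv -(lebZ _ Lg0).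
    by congr leb; apply/funext => z; rewrite mulrC.
  exact: cc2_r (cc2_conv hf hg).
rewrite (meas_fubini (leb_measure R d) Lg0 h1).
rewrite [X in _ * X]/checkf -(lebZ _ Lg0); last exact: cc_exp.
congr leb; apply/funext => z.
have hs : cc (Lf + `|- z|) (fun x => f (x - z)) by exact: cc_shift.
transitivity (g z * checkf (fun x => f (x - z)) y).
  rewrite /checkf -(lebZ (g z) (L := Lf + `|- z|)) ?addr_ge0//; last exact: cc_exp.
  by congr leb; apply/funext => x; ring.
by rewrite (check_shift z y Lf0 hf); ring.
Qed.

Lemma cc_tilde L f : cc L f -> cc L (tilde f).
Proof. by move=> hf; apply: ccJ; exact: cc_opp. Qed.

Lemma check_tilde L f y : 0 <= L -> cc L f -> checkf (tilde f) y = (checkf f y)^*.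
Proof.
move=> L0 hf; rewrite /checkf -(leb_conj L0); last exact: cc_exp.
rewrite -(leb_opp L0 (ccJ (cc_exp y hf))); congr leb; apply/funext => x.
by rewrite /tilde cjM -expiN dotvNl opprK.
Qed.

Lemma convDl Lf Lg f f' g x : 0 <= Lg -> cc Lf f -> cc Lf f' -> cc Lg g ->
  cv (fun x => f x + f' x) g x = cv f g x + cv f' g x.
Proof.
move=> Lg0 hf hf' hg; rewrite /Defs.conv -(lebD Lg0); last 2 first.
- exact: (cc2_r x (cc2_conv hf hg)).
- exact: (cc2_r x (cc2_conv hf' hg)).
by congr leb; apply/funext => y; rewrite mulrDl.
Qed.

Lemma convDr Lf Lg f g g' x : 0 <= Lg -> cc Lf f -> cc Lg g -> cc Lg g' ->
  cv f (fun x => g x + g' x) x = cv f g x + cv f g' x.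
Proof.
move=> Lg0 hf hg hg'; rewrite /Defs.conv -(lebD Lg0); last 2 first.
- exact: (cc2_r x (cc2_conv hf hg)).
- exact: (cc2_r x (cc2_conv hf hg')).
by congr leb; apply/funext => y; rewrite mulrDr.
Qed.

Lemma convZl Lf Lg (c : C) f g x : 0 <= Lg -> cc Lf f -> cc Lg g ->
  cv (fun x => c * f x) g x = c * cv f g x.
Proof.
move=> Lg0 hf hg; rewrite /Defs.conv -(lebZ _ Lg0); last exact: (cc2_r x (cc2_conv hf hg)).
by congr leb; apply/funext => y; rewrite mulrA.
Qed.

Lemma convZr Lf Lg (c : C) f g x : 0 <= Lg -> cc Lf f -> cc Lg g ->
  cv f (fun x => c * g x) x = c * cv f g x.
Proof.
move=> Lg0 hf hg; rewrite /Defs.conv -(lebZ _ Lg0); last exact: (cc2_r x (cc2_conv hf hg)).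
by congr leb; apply/funext => y; rewrite mulrCA.
Qed.
End Check.

(** * Tent functions and a majorant with decaying transform *)

Section Tent.
Variable R : realType.
Implicit Types (r s t x : R).

Definition tent r s : R := Order.max 0 (r - `|s|).

Lemma tent_ge0 r s : 0 <= tent r s.
Proof. by rewrite le_max lexx. Qed.

Lemma tent_out r s : r <= `|s| -> tent r s = 0.
Proof. by move=> h; rewrite /tent max_l//; lra. Qed.

Lemma tent_le r s : 0 <= r -> tent r s <= r.
Proof. by move=> r0; rewrite ge_max r0 /=; have := normr_ge0 s; lra. Qed.

Lemma tent_lip r s t : `|tent r s - tent r t| <= `|s - t|.
Proof.
have := ler_dist_dist s t; rewrite /tent.
by case: (leP 0 (r - `|s|)) => h1; case: (leP 0 (r - `|t|)) => h2; rewrite !ler_norml => /andP[a b];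
  apply/andP; split; have := normr_ge0 (s - t); lra.
Qed.

Lemma tentN r s : tent r (- s) = tent r s.
Proof. by rewrite /tent normrN. Qed.

Lemma continuous_tent r : continuous (tent r).
Proof.
apply: eq_continuousR => e e0; exists e => // x y xy.
by apply: le_trans (tent_lip _ _ _) (ltW xy).
Qed.

Definition ramp x : R := Order.max 0 (Order.min 1 x).

Lemma rampP x : [\/ x <= 0 /\ ramp x = 0, (0 <= x /\ x <= 1) /\ ramp x = x | 1 <= x /\ ramp x = 1].
Proof.
have [h|h] : x <= 0 \/ 0 < x by case: (lerP x 0) => h; [left|right].
  by constructor 1; rewrite /ramp (min_r (_ : x <= 1)) ?max_l//; lra.
have [h'|h'] : x <= 1 \/ 1 < x by case: (lerP x 1) => h'; [left|right].
  by constructor 2; rewrite /ramp (min_r h') max_r//; lra.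
by constructor 3; rewrite /ramp (min_l (_ : 1 <= x)) ?max_r//; lra.
Qed.

(** As a difference of consecutive ramps, the tent makes sums over integer translates telescope. *)
Lemma tent_ramp x : tent 1 x = ramp (x + 1) - ramp x.
Proof.
have tE : tent 1 x = Order.max 0 (1 - `|x|) by [].
case: (rampP x) => -[h1 ->]; case: (rampP (x + 1)) => -[h2 ->]; rewrite tE;
case: (lerP 0 x) => h3; case: (lerP 0 (1 - `|x|)); rewrite ?(ger0_norm h3) ?(ltr0_norm h3); lra.
Qed.

Lemma tent_partition (N : nat) x : `|x| <= N%:R ->
  \sum_(i < (2 * N).+1) tent 1 (x - (i%:R - N%:R)) = 1.
Proof.
move=> xN.
transitivity (\sum_(0 <= i < (2 * N).+1) (- ramp (x + N%:R + 1 - i.+1%:R) - - ramp (x + N%:R + 1 - i%:R))).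
  rewrite big_mkord; apply: eq_bigr => i _; rewrite tent_ramp opprK [RHS]addrC.
  congr (ramp _ - ramp _); rewrite -?natr1; ring.
rewrite (telescope_sumr (fun i => - ramp (x + N%:R + 1 - i%:R)))//.
move: xN; rewrite ler_norml => /andP[h1 h2].
rewrite -natr1 natrM subr0.
by case: (rampP (x + N%:R + 1)) => -[h3 ->];
  case: (rampP (x + N%:R + 1 - (2 * N%:R + 1))) => -[h4 ->]; lra.
Qed.

Lemma sum_inv_sqr (N : nat) : \sum_(i < (2 * N).+1) (1 + (i%:R - N%:R : R) ^+ 2)^-1 <= 8.
Proof.
(* A bounded increasing function whose increments over unit steps are at least a quarter of the
   summands. The sum telescopes to [4 * 2], since [G] takes values in [[-1, 1]]. *)
pose G (x : R) := x / (1 + `|x|).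
have G1 x : `|G x| <= 1.
  rewrite /G normrM normfV (ger0_norm (_ : 0 <= 1 + `|x|)) ?addr_ge0//.
  by rewrite ler_pdivrMr ?mul1r; have := normr_ge0 x; lra.
have step (i : nat) : (1 + (i%:R - N%:R : R) ^+ 2)^-1 <= 4 * (G (i.+1%:R - N%:R) - G (i%:R - N%:R)).
  set x : R := i%:R - N%:R.
  have -> : i.+1%:R - N%:R = x + 1 by rewrite /x -natr1; ring.
  have x2 : 0 < 1 + x ^+ 2 by have := sqr_ge0 x; lra.
  rewrite -div1r ler_pdivrMr//.
  have [iN|iN] := leqP N i.
    have x0 : 0 <= x by rewrite subr_ge0 ler_nat.
    rewrite /G !ger0_norm//; last by lra.
    have -> : 4 * ((x + 1) / (1 + (x + 1)) - x / (1 + x)) * (1 + x ^+ 2) =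
       4 * (1 + x ^+ 2) / ((1 + x) * (2 + x)) by field; rewrite ?andbT; do ?(apply/andP; split); apply/eqP; lra.
    rewrite ler_pdivlMr ?mulr_gt0//; try lra.
    nra.
  have x1 : x <= - 1.
    by rewrite /x lerBlDr addrC -lerBlDr opprK natr1 ler_nat.
  rewrite /G !ler0_norm; try lra.
  have -> : 4 * ((x + 1) / (1 - (x + 1)) - x / (1 - x)) * (1 + x ^+ 2) =
       4 * (1 + x ^+ 2) / ((- x) * (1 - x)).
    by field; rewrite ?andbT; do ?(apply/andP; split); apply/eqP; lra.
  rewrite ler_pdivlMr ?mulr_gt0//; try lra.
  nra.
apply: (@le_trans _ _ (\sum_(0 <= i < (2 * N).+1) 4 * (G (i.+1%:R - N%:R) - G (i%:R - N%:R)))).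
  by rewrite big_mkord; apply: ler_sum => i _.
rewrite -mulr_sumr (telescope_sumr (fun i => G (i%:R - N%:R)))//.
have := G1 ((2 * N).+1%:R - N%:R); have := G1 (0%:R - N%:R).
by rewrite !ler_norml => /andP[? ?] /andP[? ?]; lra.
Qed.

Lemma Rintegral_tent r : 0 < r -> 0 < Rintegral (@lebesgue_measure R) setT (tent r).
Proof.
move=> r0.
have h0 (x : R) : r < `|x| -> tent r x = 0 by move=> /ltW/tent_out.
have [F [dF IF]] := antiderivative_cc (@continuous_tent r) h0.
rewrite (IF (- (2 * r)) (2 * r) ltac:(lra) ltac:(lra)).
have mvt (a b : R) : a <= b -> exists2 c, c \in `[a, b] & F b - F a = tent r c * (b - a).
  move=> ab; apply: (@MVT_segment R F (tent r) a b ab (fun x _ => dF x)).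
  apply: continuous_subspaceT => x.
  by apply/differentiable_continuous/derivable1_diffP; exact: ex_derive.
have [c1 _ e1] := mvt (- (2 * r)) (- (r/2)) ltac:(lra).
have [c2 _ e3] := mvt (r/2) (2 * r) ltac:(lra).
have [c3 + e2] := mvt (- (r/2)) (r/2) ltac:(lra).
rewrite in_itv /= -ler_norml => c3h.
have t1 := tent_ge0 r c1; have t2 := tent_ge0 r c2.
have t3 : r/2 <= tent r c3 by rewrite /tent le_max; apply/orP; right; lra.
have := mulr_gt0 r0 r0; nra.
Qed.
End Tent.

Section Products.
Variable R : realType.
Local Notation C := R[i].
Local Notation nc := (@Normc.normc R).
Local Notation e2 := (@expi2pi R).

Lemma cts_coord n (i : 'I_n) (h : R -> C) : cts h -> cts (fun x : 'rV[R]_n => h (x ord0 i)).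
Proof.
move=> hh; apply: (cts_comp (h := fun x : 'rV[R]_n => x ord0 i)) => //.
exact: coord_continuous.
Qed.

Lemma cts_prod (T : topologicalType) (I : Type) (s : seq I) (F : I -> T -> C) :
  (forall i, cts (F i)) -> cts (fun x => \prod_(i <- s) F i x).
Proof.
move=> h; elim: s => [|i s IH].
  rewrite (_ : (fun x => _) = fun=> 1); first exact: cts_cst.
  by apply/funext => x; rewrite big_nil.
rewrite (_ : (fun x => _) = fun x => F i x * \prod_(i <- s) F i x); first exact: ctsM.
by apply/funext => x; rewrite big_cons.
Qed.

Lemma cc_prod n (L : R) (h : 'I_n -> R -> C) : 0 <= L -> (forall i, cts (h i)) ->
  (forall i (s : R), L < `|s| -> h i s = 0) -> cc L (fun x : 'rV[R]_n => \prod_i h i (x ord0 i)).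
Proof.
move=> L0 hc h0; split; first by apply: cts_prod => i; exact: cts_coord.
move=> x Lx; have [i hi] : exists i, L < `|x ord0 i|.
  apply: contrapT => hn; suff : `|x| <= L by rewrite leNgt Lx.
  by apply: rV_norm_le => // i; rewrite leNgt; apply/negP => hi; apply: hn; exists i.
by rewrite (bigD1 i)//= h0// mul0r.
Qed.

Lemma cc_coord1 (L : R) (h : R -> C) : 0 <= L -> cts h ->
  (forall s : R, L < `|s| -> h s = 0) -> cc L (fun x : 'rV[R]_1 => h (x ord0 ord0)).
Proof.
move=> L0 hc h0; have := @cc_prod 1 L (fun=> h) L0 (fun=> hc) (fun=> h0).
by rewrite (_ : (fun x => _) = fun x : 'rV[R]_1 => h (x ord0 ord0))//; apply/funext => x; rewrite big_ord1.
Qed.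

Lemma leb_prod n (L : R) (h : 'I_n -> R -> C) : 0 <= L -> (forall i, cts (h i)) ->
  (forall i (s : R), L < `|s| -> h i s = 0) ->
  leb (fun x : 'rV[R]_n => \prod_i h i (x ord0 i)) =
  \prod_i leb (fun x : 'rV[R]_1 => h i (x ord0 ord0)).
Proof.
move=> L0; elim: n h => [|n IH] h hc h0.
  by rewrite /leb /= !big_ord0.
rewrite big_ord_recl -(IH (fun i => h (lift ord0 i))) => [|i|i]; [|exact: hc|exact: h0].
set P := leb (fun x : 'rV[R]_n => _).
rewrite mulrC -(lebZ P L0); last by apply: cc_coord1 => //; exact: h0.
have e0 (t : R) m (y : 'rV[R]_m) : (row_mx (const_mx t : 'rV[R]_1) y) ord0 (ord0 : 'I_m.+1) = t.
  have := @row_mxEl R 1 1 m (const_mx t) y ord0 ord0; rewrite [X in _ = X -> _]mxE.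
  by rewrite (_ : @lshift 1 m ord0 = @ord0 m); [exact | exact: val_inj].
have eS (t : R) (y : 'rV[R]_n) i : (row_mx (const_mx t : 'rV[R]_1) y) ord0 (lift ord0 i : 'I_n.+1) = y ord0 i.
  have := @row_mxEr R 1 1 n (const_mx t) y ord0 i.
  by rewrite (_ : @rshift 1 n i = lift ord0 i); [exact | exact: val_inj].
have key (t : R) : leb (fun y : 'rV[R]_n => \prod_i h i ((row_mx (const_mx t : 'rV[R]_1) y) ord0 i)) = h ord0 t * P.
  rewrite -(lebZ _ L0); last by apply: (@cc_prod n L (fun i => h (lift ord0 i))) => // i; exact: h0.
  congr leb; apply/funext => y; rewrite big_ord_recl e0; congr (_ * _).
  by apply: eq_bigr => i _; rewrite eS.
apply: complex_eq; rewrite /leb /=; apply: eq_Rintegral => t _.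
  by rewrite e0 mulrC -key.
by rewrite e0 mulrC -key.
Qed.

Definition bump n (r : R) (x : 'rV[R]_n) : C := \prod_i (tent r (x ord0 i))%:C.

Definition tenthat (r eta : R) : C :=
  checkf (fun x : 'rV[R]_1 => (tent r (x ord0 ord0))%:C) (const_mx eta).

Lemma cts_tent r : cts (fun s : R => (tent r s)%:C).
Proof. by apply: cts_real; exact: continuous_tent. Qed.

Lemma tentC_out r (s : R) : r < `|s| -> (tent r s)%:C = 0.
Proof. by move=> /ltW/tent_out ->. Qed.

Lemma cc_bump n r : 0 <= r -> cc r (@bump n r).
Proof. by move=> r0; apply: (@cc_prod n r (fun _ s => (tent r s)%:C)) => // i; [exact: cts_tent | exact: tentC_out]. Qed.

Lemma bump_real n r (x : 'rV[R]_n) : bump r x = (\prod_i tent r (x ord0 i))%:C.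
Proof. by rewrite /bump rmorph_prod. Qed.

Lemma bump_ge0 n r (x : 'rV[R]_n) : 0 <= bump r x.
Proof. by rewrite bump_real ler0c prodr_ge0// => i _; exact: tent_ge0. Qed.

Lemma nc_bump1 n (x : 'rV[R]_n) : nc (bump 1 x) <= 1.
Proof.
rewrite bump_real nc_real ?prodr_ge0// => [|i _]; last exact: tent_ge0.
rewrite -[leRHS](@expr1n _ n) -[X in 1 ^+ X](card_ord n) -prodr_const; apply: ler_prod => i _.
by rewrite tent_ge0 tent_le.
Qed.

Lemma bumpN n r (x : 'rV[R]_n) : bump r (- x) = bump r x.
Proof. by apply: eq_bigr => i _; rewrite mxE tentN. Qed.

Lemma cc_tent1 r : 0 <= r -> cc r (fun x : 'rV[R]_1 => (tent r (x ord0 ord0))%:C).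
Proof. by move=> r0; apply: (@cc_coord1 r (fun s => (tent r s)%:C)) => //; [exact: cts_tent | exact: tentC_out]. Qed.

Lemma check_bump n r (y : 'rV[R]_n) : 0 <= r -> checkf (bump r) y = \prod_i tenthat r (y ord0 i).
Proof.
move=> r0.
pose h (i : 'I_n) (s : R) : C := (tent r s)%:C * e2 (s * y ord0 i).
transitivity (leb (fun x : 'rV[R]_n => \prod_i h i (x ord0 i))).
  congr leb; apply/funext => x; rewrite /h big_split; congr (_ * _).
  by rewrite /dotv (big_morph e2 (@expiD R) (@expi0 R)).
rewrite (@leb_prod n r)//.
- apply: eq_bigr => i _; rewrite /tenthat /checkf; congr leb; apply/funext => x.
  by rewrite /h /dotv big_ord1 mxE.
- move=> i; apply: ctsM; first exact: cts_tent.
  apply: cts_expi => x; apply: (@mulrr_continuous R (y ord0 i)).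
- by move=> i s rs; rewrite /h tentC_out// mul0r.
Qed.

Lemma expi_half : e2 (1 / 2) = -1.
Proof.
rewrite /expi2pi (_ : 2 * pi * (1 / 2) = pi); last by field.
by rewrite cospi sinpi; apply: complex_eq; rewrite ?ReN ?ImN /= ?oppr0.
Qed.

(* Translating by s with <s, y> = 1/2 flips the sign of the transform at y. *)
Lemma check_decay n (L : R) (f : 'rV[R]_n -> C) : 0 <= L -> cc L f ->
  (forall x x', nc (f x - f x') <= `|x - x'|) ->
  exists2 B : R, 0 <= B & forall y s, `|s| <= 1 -> dotv s y = 1 / 2 -> nc (checkf f y) <= B * `|s|.
Proof.
move=> L0 hf lip; have L1 : 0 <= L + 1 by lra.
have [A A0 HA] := check_bound n L1.
exists A => // y s s1 sy.
have hs : cc (L + 1) (fun x => f (x - s)).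
  by apply: ccW (cc_shift (- s) hf); rewrite normrN lerD2l.
have hf' : cc (L + 1) f by apply: ccW hf; lra.
have e : checkf (fun x => f x - f (x - s)) y = 2%:C * checkf f y.
  rewrite (checkB _ L1)//.
  rewrite (check_shift _ _ L0 hf) sy expi_half; ring.
have h := HA _ `|s| (ccB hf' hs) _ y.
have : nc (checkf (fun x => f x - f (x - s)) y) <= A * `|s|.
  by apply: h => x; apply: le_trans (lip _ _) _; rewrite opprB addrCA subrr addr0.
rewrite e Normc.normcM nc_real//; have := nc_ge0 (checkf f y); lra.
Qed.

(** Two regimes: for [|eta| <= 1] the trivial bound suffices, and beyond it the Lipschitz decay of
    [check_decay], once squared, gives the inverse square. The square is what the transform of an
    autocorrelation supplies. *)
Lemma tenthat_bound r : 0 <= r -> exists2 B : R, 0 <= B &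
  forall eta, nc (tenthat r eta) ^+ 2 <= B * (1 + eta ^+ 2)^-1.
Proof.
move=> r0; have [A A0 HA] := check_bound 1 r0.
have hA eta : nc (tenthat r eta) <= A * r.
  apply: HA; first exact: cc_tent1.
  by move=> x; rewrite nc_real ?tent_ge0// tent_le.
have [|B B0 HB] := @check_decay 1 r _ r0 (cc_tent1 r0).
  move=> x x'; rewrite -rmorphB ncR; apply: le_trans (tent_lip _ _ _) _.
  by have := rV_norm_ge (x - x') ord0; rewrite !mxE.
exists (2 * (A * r) ^+ 2 + B ^+ 2); first by have := sqr_ge0 (A * r); have := sqr_ge0 B; lra.
move=> eta; have e0 : 0 < 1 + eta ^+ 2 by have := sqr_ge0 eta; lra.
rewrite ler_pdivlMr//; have b2 := sqr_ge0 B.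
have [e1|e1] := lerP `|eta| 1.
  have e2 : eta ^+ 2 <= 1 by rewrite -real_normK ?num_real// expr_le1.
  have : nc (tenthat r eta) ^+ 2 <= (A * r) ^+ 2.
    by rewrite ler_sqr ?nnegrE ?nc_ge0 ?mulr_ge0// hA.
  have := sqr_ge0 (nc (tenthat r eta)); nra.
(* The half-period shift, [s * eta = 1 / 2]; as [|eta| > 1] it is shorter than 1, which
   [check_decay] requires. *)
pose s : R := 1 / (2 * eta).
have en : eta != 0 by apply/eqP => h; rewrite h normr0 in e1; lra.
have sn : `|const_mx s : 'rV[R]_1| <= `|s|.
  by apply: rV_norm_le => // i; rewrite mxE.
have sE : `|s| * (2 * `|eta|) = 1.
  by rewrite -[2]ger0_norm// -!normrM /s divfK ?normr1// mulf_neq0.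
have s0 := normr_ge0 s.
have := HB (const_mx eta) (const_mx s) _ _; rewrite -/(tenthat r eta).
have -> : dotv (const_mx s : 'rV[R]_1) (const_mx eta) = 1 / 2.
  by rewrite /dotv big_ord1 !mxE /s; field.
move=> /(_ (le_trans sn _) erefl) h.
have {}h : nc (tenthat r eta) <= B * `|s|.
  apply: le_trans (h _) _; first nra.
  by rewrite ler_wpM2l.
have h2 : nc (tenthat r eta) ^+ 2 <= (B * `|s|) ^+ 2.
  by rewrite ler_sqr ?nnegrE ?nc_ge0 ?mulr_ge0.
apply: (@le_trans _ _ ((B * `|s|) ^+ 2 * (1 + eta ^+ 2))); first by rewrite ler_wpM2r// ltW.
rewrite exprMn -[eta ^+ 2]real_normK ?num_real//.
have k : `|s| ^+ 2 * (1 + `|eta| ^+ 2) <= 1 by nra.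
by rewrite -mulrA; have := sqr_ge0 (A * r); nra.
Qed.

Lemma leb_real_mono n (L : R) (f g : 'rV[R]_n -> C) : 0 <= L -> cc L f -> cc L g ->
  (forall x, f x <= g x) -> leb f <= leb g.
Proof.
move=> L0 hf hg fg; rewrite -subr_ge0 -(lebB L0)//.
by apply: (leb_ge0 L0); [exact: ccB | move=> x; rewrite subr_ge0].
Qed.

Lemma leb_bump_gt0 n r : 0 < r -> 0 < leb (@bump n r).
Proof.
move=> r0; rewrite (@leb_prod n r (fun _ s => (tent r s)%:C)) ?ltW//.
- apply: prodr_gt0 => _ _.
  rewrite (_ : leb _ = (Rintegral (@lebesgue_measure R) setT (tent r))%:C).
    by rewrite ltcR Rintegral_tent.
  apply: complex_eq; rewrite /leb; last exact: lebR0.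
  apply: eq_Rintegral => t _ /=; congr tent.
  have := @row_mxEl R 1 1 0 (const_mx t) 0 ord0 ord0; rewrite [X in _ = X -> _]mxE.
  by rewrite (_ : @lshift 1 0 ord0 = @ord0 0); [exact | exact: val_inj].
- by move=> i; exact: cts_tent.
- by move=> i; exact: tentC_out.
Qed.

(** The normalized autocorrelation of a wide product of tents. Its transform is a squared modulus, a
    product over coordinates, so the one-dimensional decay gives decay in each coordinate
    separately. *)
Lemma majorant n (L : R) : 0 <= L -> exists (theta : 'rV[R]_n -> C) (L' B : R),
  [/\ 0 <= L', cc L' theta, (forall x, 0 <= theta x), (forall x, `|x| <= L -> 1 <= theta x) &
      0 <= B /\ forall y, nc (checkf theta y) <= B * \prod_i (1 + (y ord0 i) ^+ 2)^-1].
Proof.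
(* For [|x| <= L] and [|y| <= 1] the coordinates of [x - y] and of [y] stay below [L + 1], where the
   tent of radius [L + 2] is at least 1. So the autocorrelation at [x] dominates the integral [beta]
   of [bump 1]. *)
move=> L0; pose r : R := L + 2; have r0 : 0 <= r by rewrite /r; lra.
pose b := @bump n r; have hb : cc r b := cc_bump n r0.
have htb : cc r (tilde b) := cc_tilde hb.
pose beta := leb (@bump n 1); have b0 : 0 < beta := leb_bump_gt0 n ltr01.
have bi0 : 0 <= beta^-1 by rewrite invr_ge0 ltW.
have tb y : tilde b y = b y.
  by rewrite /tilde /b bumpN bump_real conjc_real.
have hcv : cc (r + r) (Defs.conv b (tilde b)) := cc_conv hb htb.
have rr0 : 0 <= r + r by rewrite addr_ge0.
have [B B0 HB] := tenthat_bound r0.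
exists (fun x => beta^-1 * Defs.conv b (tilde b) x), (r + r), (nc beta^-1 * B ^+ n); split => //.
- exact: ccZ.
- move=> x; rewrite mulr_ge0// (leb_ge0 r0)//; first exact: (cc2_r x (cc2_conv hb htb)).
  by move=> y; rewrite tb mulr_ge0// bump_ge0.
- move=> x xL; rewrite mulrC ler_pdivlMr// mul1r.
  apply: (leb_real_mono r0); first by apply: ccW (cc_bump n ler01); rewrite /r; lra.
    exact: (cc2_r x (cc2_conv hb htb)).
  move=> y; rewrite tb /b !bump_real -rmorphM lecR -big_split /=.
  have [y1|y1] := leP `|y| 1; last first.
    have := (cc_bump n ler01).2 y y1; rewrite bump_real => -[->].
    by apply: prodr_ge0 => i _; rewrite mulr_ge0 ?tent_ge0.
  apply: ler_prod => i _; rewrite tent_ge0 /=.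
  apply: le_trans (tent_le _ ler01) _.
  have yi := le_trans (rV_norm_ge y i) y1; have xi := le_trans (rV_norm_ge x i) xL.
  have xy : `|(x - y) ord0 i| <= L + 1 by rewrite !mxE; apply: le_trans (ler_normB _ _) _; lra.
  have t1 : 1 <= tent r ((x - y) ord0 i) by rewrite le_max; apply/orP; right; rewrite /r; lra.
  have t2 : 1 <= tent r (y ord0 i) by rewrite le_max; apply/orP; right; rewrite /r; lra.
  nra.
- split; first by rewrite mulr_ge0 ?nc_ge0// exprn_ge0.
  move=> y; rewrite (checkZ _ _ rr0 hcv) (check_conv _ r0 r0 hb htb) (check_tilde _ r0 hb).
  rewrite nc_sqr Normc.normcM -mulrA ler_wpM2l ?nc_ge0// nc_real ?sqr_ge0//.
  rewrite (check_bump _ r0) (big_morph nc (@Normc.normcM R) (@Normc.normc1 R)).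
  rewrite -prodrXl -[X in B ^+ X](card_ord n) -prodr_const -big_split /=.
  by apply: ler_prod => i _; rewrite sqr_ge0 HB.
Qed.
End Products.

(** * Translation bounded measures and amalgam norms *)

Section Lattice.
Variables (R : realType) (d : nat).
Local Notation C := R[i].
Local Notation V := 'rV[R]_d.
Local Notation Z := 'rV[int]_d.
Implicit Types (k l : Z) (J : seq Z).

Definition ez k : V := \row_j (k ord0 j)%:~R.

Definition Zpt (N : nat) (f : {ffun 'I_d -> 'I_(2 * N).+1}) : Z := \row_j ((f j : nat)%:Z - N%:Z).

Definition Zbox (N : nat) : seq Z := [seq Zpt f | f <- enum {ffun 'I_d -> 'I_(2 * N).+1}].

Lemma Zbox_uniq N : uniq (Zbox N).
Proof.
rewrite map_inj_uniq ?enum_uniq// => f g /rowP h; apply/ffunP => j.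
by have := h j; rewrite !mxE => /addIr [] /val_inj.
Qed.

Lemma mem_Zbox N k : (forall j, `|k ord0 j| <= N%:Z) -> k \in Zbox N.
Proof.
move=> h; apply/mapP.
have hN j : (`|(k ord0 j + N%:Z)%R|%N < (2 * N).+1)%N by have := h j; lia.
exists [ffun j => Ordinal (hN j)]; first by rewrite mem_enum.
apply/rowP => j; rewrite !mxE ffunE /= abszE ger0_norm; first by rewrite addrK.
by have := h j; rewrite ler_norml => /andP[? _]; rewrite addrC -lerBlDl sub0r.
Qed.

Lemma Zbox_exists J : exists N, {subset J <= Zbox N}.
Proof.
exists (\sum_(k <- J) \sum_j `|k ord0 j|)%N => k kJ; apply: mem_Zbox => j.
by rewrite (big_rem k kJ) /= (bigD1 j)//= -abszE lez_nat -addnA leq_addr.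
Qed.

Lemma sum_Zbox N (F : 'I_d -> R -> R) :
  \sum_(k <- Zbox N) \prod_j F j (k ord0 j)%:~R = \prod_j \sum_(i < (2 * N).+1) F j (i%:R - N%:R).
Proof.
rewrite big_map big_enum /= bigA_distr_bigA /=; apply: eq_bigr => f _.
by apply: eq_bigr => j _; rewrite mxE rmorphB /=.
Qed.

Lemma bump_partition N (x : V) : `|x| <= N%:R -> \sum_(k <- Zbox N) bump 1 (x - ez k) = 1.
Proof.
move=> xN; transitivity ((\sum_(k <- Zbox N) \prod_j tent 1 (x ord0 j - (k ord0 j)%:~R))%:C : C).
  rewrite rmorph_sum /=; apply: eq_bigr => k _; rewrite bump_real; congr (_%:C).
  by apply: eq_bigr => j _; rewrite !mxE.
rewrite (sum_Zbox N (fun j s => tent 1 (x ord0 j - s))) big1// => j _.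
by apply: tent_partition; apply: le_trans (rV_norm_ge x j) xN.
Qed.

Lemma ler_sum_sub (T : eqType) (s s' : seq T) (F : T -> R) : uniq s -> uniq s' -> {subset s <= s'} ->
  (forall i, 0 <= F i) -> \sum_(i <- s) F i <= \sum_(i <- s') F i.
Proof.
move=> us us' ss F0; have hp : perm_eq s [seq i <- s' | i \in s].
  apply: uniq_perm => //; first exact: filter_uniq.
  by move=> i; rewrite mem_filter /=; case: (boolP (i \in s)) => // /ss ->.
rewrite (perm_big _ hp) /= big_filter [X in X <= _]big_mkcond /=.
by apply: ler_sum => i _; case: ifP.
Qed.

Lemma inv_sqr_ge0 (s : R) : 0 <= (1 + s ^+ 2)^-1.
Proof. by rewrite invr_ge0; have := sqr_ge0 s; lra. Qed.

Lemma sum_lattice J : uniq J -> \sum_(k <- J) \prod_j (1 + ((k ord0 j)%:~R : R) ^+ 2)^-1 <= 8 ^+ d.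
Proof.
move=> uJ; have [N sJ] := Zbox_exists J.
apply: le_trans (ler_sum_sub uJ (Zbox_uniq N) sJ _) _.
  by move=> k; apply: prodr_ge0 => j _; exact: inv_sqr_ge0.
rewrite (sum_Zbox N (fun j s => (1 + s ^+ 2)^-1)) -[X in 8 ^+ X](card_ord d) -prodr_const.
apply: ler_prod => j _; rewrite sum_inv_sqr andbT.
by apply: sumr_ge0 => i _; exact: inv_sqr_ge0.
Qed.

(* Schur-test constant: the points y k lie in unit cells around lattice points, so their mutual
   distances are comparable with those of the lattice up to the factor 9. *)
Lemma sum_separated J (y : Z -> V) k0 (p : V) : uniq J -> `|p - ez k0| <= 1 ->
  (forall k, k \in J -> `|y k - ez k| <= 1) ->
  \sum_(k <- J) \prod_j (1 + ((y k - p) ord0 j) ^+ 2)^-1 <= 72 ^+ d.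
Proof.
move=> uJ h0 hJ.
pose J' := [seq k - k0 | k <- J].
have uJ' : uniq J' by rewrite map_inj_uniq//; exact: addIr.
have h := sum_lattice uJ'.
rewrite (_ : 72 = 9 * 8) ?exprMn; last by ring.
apply: le_trans (_ : 9 ^+ d * \sum_(k <- J') \prod_j (1 + ((k ord0 j)%:~R : R) ^+ 2)^-1 <= _); last first.
  by rewrite ler_wpM2l// exprn_ge0.
rewrite big_map mulr_sumr big_seq [X in _ <= X]big_seq; apply: ler_sum => k kJ.
rewrite -[X in 9 ^+ X](card_ord d) -prodr_const -big_split /=.
apply: ler_prod => j _; rewrite inv_sqr_ge0 /=.
set m : R := ((k - k0) ord0 j)%:~R; set z := (y k - p) ord0 j.
have e1 := sqr_ge0 m; have e2 := sqr_ge0 z.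
have m1 : 0 < 1 + m ^+ 2 by lra.
have z1 : 0 < 1 + z ^+ 2 by lra.
rewrite -[X in X <= _]div1r ler_pdivrMr// mulrAC ler_pdivlMr// mul1r.
have hm : `|z - m| <= 2.
  have -> : z - m = (y k - ez k) ord0 j - (p - ez k0) ord0 j.
    by rewrite /z /m !mxE rmorphB /=; ring.
  apply: le_trans (ler_normB _ _) _.
  have := le_trans (rV_norm_ge _ j) h0; have := le_trans (rV_norm_ge _ j) (hJ k kJ); lra.
move: hm m1 z1 e1 e2; move: z m => a b; rewrite ler_norml => /andP[h1 h2] _ _ _ e2.
have h4 : (a - b) * (a - b) <= 4 by nra.
(* Combined with [h4] this gives [b ^+ 2 <= 8 + 2 * a ^+ 2], hence the factor 9. *)
have := sqr_ge0 (b - 2 * a); rewrite !expr2 in e2 *; lra.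
Qed.

End Lattice.

Section Amalgam.
Variables (R : realType) (d : nat).
Local Notation C := R[i].
Local Notation V := 'rV[R]_d.
Local Notation Z := 'rV[int]_d.
Local Notation nc := (@Normc.normc R).
Local Notation ez := (@ez R d).
Implicit Types (k l : Z) (J : seq Z) (f g h : V -> C) (nu : (V -> C) -> C) (M S L : R).

(** A bound on test functions living in a unit cube (the norm is the sup norm) stands for a bound on
    the total variation of translated cubes. In this form it passes to pointwise limits of measures
    at once. *)
Definition translation_bounded nu M := forall (t : V) g (b : R), Cc g ->
  (forall x, 1 < `|x - t| -> g x = 0) -> (forall x, nc (g x) <= b) -> nc (nu g) <= M * b.

Lemma tb_of_pos nu M : is_measure nu -> (forall (t : V) g (b : R), 0 < b -> Cc g ->
    (forall x, 1 < `|x - t| -> g x = 0) -> (forall x, nc (g x) <= b) -> nc (nu g) <= M * b) ->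
  translation_bounded nu M.
Proof.
move=> mnu h t g b hg gt gb; have [b0|b0] := eqVneq b 0.
  rewrite (_ : g = fun=> 0); first by rewrite (meas0 mnu) Normc.normc0 b0 mulr0.
  by apply/funext => x; apply/eqP; rewrite -nc_eq0 eq_le nc_ge0 andbT -b0.
by apply: (h t) => //; rewrite lt_neqAle eq_sym b0 (le_trans (nc_ge0 _) (gb 0)).
Qed.

(* The Wiener amalgam norm of h, locally sup and globally l^1 over the lattice, is at most S. *)
Definition amalgam h S := forall J (y : Z -> V), uniq J ->
  (forall k, k \in J -> `|y k - ez k| <= 1) -> \sum_(k <- J) nc (h (y k)) <= S.

(** The supremum over a cell is attained, so bounding sums over all choices of sample points bounds
    the sum of the cellwise suprema. *)
Lemma cell_max g k : cts g -> exists y : V, `|y - ez k| <= 1 /\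
  forall x, `|x - ez k| <= 1 -> nc (g x) <= nc (g y).
Proof.
move=> hg; have cg : continuous (fun z : V => nc (g (z + ez k))).
  by apply: continuous_nc; apply: (cts_comp (h := fun z : V => z + ez k)) => //; exact: continuous_addl.
have [|c c1 hc] := @compact_EVT_max V R _ [set z : V | `|z| <= 1] _ (@box_compact R d 1) (continuous_subspaceT cg).
  by exists 0; rewrite /= normr0.
exists (c + ez k); rewrite addrK; split; first by rewrite inE in c1.
by move=> x xk; have := hc (x - ez k); rewrite subrK; apply; rewrite inE.
Qed.

Lemma cc_cell g k : cts g -> Cc (fun x => g x * bump 1 (x - ez k)).
Proof.
move=> hg; apply: (cc_Cc (L := 1 + `|- ez k|)); apply: ccMl => //.
exact: cc_shift (cc_bump d ler01).
Qed.

(** A partition of unity by lattice translates of [bump 1] cuts [g] into pieces, each controlled by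
    [M] times the maximum of [g] on its cell. The predicate [P] discards cells that [g] does not
    meet, so that the same argument serves the tail estimate. *)
Lemma tb_sum nu M S g (P : pred Z) : is_measure nu -> translation_bounded nu M -> 0 <= M -> Cc g ->
  (forall k x, ~~ P k -> g x * bump 1 (x - ez k) = 0) ->
  (forall J (y : Z -> V), uniq J -> all P J -> (forall k, k \in J -> `|y k - ez k| <= 1) ->
     \sum_(k <- J) nc (g (y k)) <= S) -> nc (nu g) <= M * S.
Proof.
move=> mnu tb M0 hg hP hS.
have cg := Cc_cts hg.
have /Cc_cc[L L0 [_ gL]] := hg.
pose N := (Num.bound L).
have LN : L <= N%:R by apply/ltW/archi_boundP.
have gE : g = fun x => \sum_(k <- Zbox d N) g x * bump 1 (x - ez k).
  apply/funext => x; rewrite -mulr_sumr; have [xN|xN] := leP `|x| N%:R.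
    by rewrite bump_partition// mulr1.
  by rewrite gL ?mul0r//; apply: le_lt_trans xN.
have /choice[y hy] := fun k => cell_max k cg.
rewrite gE (meas_sum mnu); last by move=> k; exact: cc_cell.
apply: le_trans (nc_sum _ _ _) _.
apply: (@le_trans _ _ (\sum_(k <- Zbox d N | P k) M * nc (g (y k)))).
  rewrite [X in _ <= X]big_mkcond /=; apply: ler_sum => k _; case: ifPn => Pk.
    apply: (tb (ez k)); first exact: cc_cell.
      by move=> x hx; rewrite (cc_bump d ler01).2// mulr0.
    move=> x; have [xk|xk] := leP `|x - ez k| 1; last first.
      by rewrite (cc_bump d ler01).2// mulr0 Normc.normc0 nc_ge0.
    rewrite Normc.normcM; apply: le_trans (_ : nc (g x) * 1 <= _); last by rewrite mulr1; exact: (hy k).2.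
    by rewrite ler_wpM2l ?nc_ge0// nc_bump1.
  rewrite (_ : (fun x => _) = fun=> 0); last by apply/funext => x; exact: hP.
  by rewrite (meas0 mnu) Normc.normc0.
rewrite -mulr_sumr ler_wpM2l// -big_filter; apply: hS.
- by rewrite filter_uniq// Zbox_uniq.
- exact: filter_all.
- by move=> k _; exact: (hy k).1.
Qed.

Lemma tb_amalgam nu M S g h : is_measure nu -> translation_bounded nu M -> 0 <= M -> amalgam h S ->
  Cc g -> (forall x, nc (g x) <= nc (h x)) -> nc (nu g) <= M * S.
Proof.
move=> mnu tb M0 am hg gh; apply: (tb_sum (P := xpredT) mnu tb M0 hg) => // J y uJ _ hy.
by apply: le_trans (am J y uJ hy); apply: ler_sum.
Qed.

(** A finite sample whose sum is within [e] of the supremum leaves at most [e] to any sample over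
    disjoint cells: the two together form one admissible sample. *)
Lemma amalgam_tail h S : amalgam h S -> forall e : R, 0 < e -> exists N : nat, forall J (y : Z -> V),
  uniq J -> (forall k, k \in J -> k \notin Zbox d N) -> (forall k, k \in J -> `|y k - ez k| <= 1) ->
  \sum_(k <- J) nc (h (y k)) <= e.
Proof.
move=> am e e0.
pose E := [set s : R | exists (J : seq Z) (y : Z -> V), [/\ uniq J,
   forall k, k \in J -> `|y k - ez k| <= 1 & s = \sum_(k <- J) nc (h (y k))]].
have hE : has_sup E.
  split; first by exists 0, [::], (fun=> 0); split => //; rewrite big_nil.
  by exists S => _ [J [y [uJ hy ->]]]; exact: am.
have [s [J0 [y0 [uJ0 hy0 ->]]] hs] := sup_adherent e0 hE.
have [N sJ0] := Zbox_exists J0; exists N => J y uJ JN hy.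
have hdis k : k \in J -> k \notin J0 by move=> kJ; apply: contra (JN k kJ); exact: sJ0.
have : \sum_(k <- J0 ++ J) nc (h (if k \in J0 then y0 k else y k)) <= sup E.
  apply: sup_upper_bound => //; exists (J0 ++ J), (fun k => if k \in J0 then y0 k else y k).
  split => //.
    rewrite cat_uniq uJ0 uJ andbT /=; apply/hasPn => k; exact: hdis.
  move=> k; rewrite mem_cat; case: ifPn => [kJ0 _|kJ0 /= kJ]; first exact: hy0.
  exact: hy.
rewrite big_cat /= [X in X + _ <= _](_ : _ = \sum_(k <- J0) nc (h (y0 k))); last first.
  by apply: eq_big_seq => k ->.
rewrite [X in _ + X <= _](_ : _ = \sum_(k <- J) nc (h (y k))); last first.
  by apply: eq_big_seq => k /hdis/negbTE ->.
move: hs; lra.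
Qed.

(** The radius is chosen before the measure. This uniformity is what permits the passage to the
    limit along a translation bounded sequence. The extra 1 in the radius is the size of a cell. *)
Lemma tb_amalgam_tail h S : amalgam h S -> forall e : R, 0 < e -> exists2 L : R, 0 <= L &
  forall nu M g, is_measure nu -> translation_bounded nu M -> 0 <= M -> Cc g ->
    (forall x, nc (g x) <= nc (h x)) -> (forall x, `|x| <= L -> g x = 0) -> nc (nu g) <= M * e.
Proof.
move=> am e e0; have [N hN] := amalgam_tail am e0.
exists (N%:R + 1); first by rewrite addr_ge0.
move=> nu M g mnu tb M0 hg gh g0.
apply: (tb_sum (P := fun k => k \notin Zbox d N) mnu tb M0 hg).
  move=> k x; rewrite negbK => /mapP[f _ ->].
  have [xk|xk] := leP `|x - ez (Zpt f)| 1; last by rewrite (cc_bump d ler01).2// mulr0.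
  rewrite g0 ?mul0r//.
  have : `|ez (Zpt f)| <= N%:R.
    apply: rV_norm_le => // i; rewrite !mxE rmorphB /= ler_norml.
    have : ((f i)%:R <= (2 * N)%:R :> R) by rewrite ler_nat -ltnS.
    rewrite natrM; have : 0 <= ((f i)%:R : R) by [].
    by move=> ? ?; apply/andP; split; lra.
  by have := ler_normD (x - ez (Zpt f)) (ez (Zpt f)); rewrite subrK; lra.
move=> J y uJ /allP aJ hy; apply: le_trans (hN J y uJ aJ hy).
by apply: ler_sum.
Qed.

End Amalgam.

(** * The large sieve *)

Section LargeSieve.
Variables (R : realType) (I K : finType).
Local Notation C := R[i].
Local Notation nc := (@Normc.normc R).
Variable P : I -> I -> C.
Hypothesis Ppsd : forall c : I -> C, 0 <= \sum_i \sum_j c i * (c j)^* * P i j.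
Hypothesis Pherm : forall i j, P j i = (P i j)^*.
Implicit Types (c : I -> C) (lam : R).

Definition sesq c c' : C := \sum_i \sum_j c i * (c' j)^* * P i j.
Definition quad c : R := complex.Re (sesq c c).

Lemma quad_ge0 c : 0 <= quad c.
Proof. by have [_ h] := ge0_complex (Ppsd c); exact: h. Qed.

Lemma sesq_quad c : sesq c c = (quad c)%:C.
Proof. by have [h _] := ge0_complex (Ppsd c); exact: h. Qed.

Lemma sesqC c c' : sesq c' c = (sesq c c')^*.
Proof.
rewrite /sesq exchange_big /= cj_sum; apply: eq_bigr => i _.
rewrite cj_sum; apply: eq_bigr => j _.
by rewrite !cjM conjcK -Pherm (mulrC (c' j)).
Qed.

Lemma sesqDl c1 c2 c' : sesq (fun i => c1 i + c2 i) c' = sesq c1 c' + sesq c2 c'.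
Proof.
rewrite /sesq -big_split; apply: eq_bigr => i _; rewrite -big_split; apply: eq_bigr => j _ /=.
by rewrite !mulrDl.
Qed.

Lemma sesqZl (a : C) c c' : sesq (fun i => a * c i) c' = a * sesq c c'.
Proof.
rewrite /sesq mulr_sumr; apply: eq_bigr => i _; rewrite mulr_sumr; apply: eq_bigr => j _.
by rewrite !mulrA.
Qed.

Lemma sesq_suml (T : finType) (a : T -> C) (c : T -> I -> C) c' :
  sesq (fun i => \sum_k a k * c k i) c' = \sum_k a k * sesq (c k) c'.
Proof.
rewrite /sesq; under [RHS]eq_bigr do rewrite mulr_sumr.
rewrite [RHS]exchange_big; apply: eq_bigr => i _ /=.
under [RHS]eq_bigr do rewrite mulr_sumr.
rewrite [RHS]exchange_big; apply: eq_bigr => j _ /=.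
by rewrite !mulr_suml; apply: eq_bigr => k _; rewrite !mulrA.
Qed.

Lemma sesq_sumr (T : finType) (a : T -> C) (c : T -> I -> C) c' :
  sesq c' (fun i => \sum_k a k * c k i) = \sum_k (a k)^* * sesq c' (c k).
Proof.
rewrite sesqC sesq_suml cj_sum; apply: eq_bigr => k _.
by rewrite cjM -sesqC.
Qed.

Lemma quad_sub c c' lam : quad (fun i => c i - lam%:C * c' i) =
  quad c - 2 * lam * complex.Re (sesq c c') + lam ^+ 2 * quad c'.
Proof.
have e (x : I -> C) : sesq (fun i => c i - lam%:C * c' i) x = sesq c x - lam%:C * sesq c' x.
  rewrite -[X in _ = _ + X]mulNr -sesqZl -sesqDl; congr sesq.
  by apply/funext => i; rewrite mulNr.
rewrite /quad e (sesqC _ c) (sesqC _ c') !e !sesq_quad (sesqC c c').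
case: (sesq c c') => a b; rewrite /=; ring.
Qed.

(** After rotating [c] by the phase of [k], this is positivity of the form at the difference of the
    two vectors. *)
Lemma sesq_le (k : C) c c' : complex.Re (k * sesq c c') <= nc k * ((quad c + quad c') / 2).
Proof.
have [->|k0] := eqVneq k 0; first by rewrite mul0r Normc.normc0 mul0r.
have n0 : 0 < nc k by rewrite lt_neqAle nc_ge0 eq_sym nc_eq0 k0.
pose u := (nc k)^-1%:C * k.
have uu : u * u^* = 1.
  rewrite nc_sqr /u Normc.normcM nc_real ?invr_ge0 ?nc_ge0// mulVf ?expr1n// gt_eqF//.
have -> : k = (nc k)%:C * u by rewrite /u mulrA -rmorphM mulfV ?mul1r// gt_eqF.
have qu : quad (fun i => u * c i) = quad c.
  by rewrite /quad sesqZl sesqC sesqZl cjM mulrA uu mul1r -sesqC.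
have := quad_ge0 (fun i => u * c i - 1%:C * c' i).
rewrite quad_sub qu sesqZl => h.
have nu : nc u = 1 by rewrite /u Normc.normcM nc_real ?invr_ge0 ?nc_ge0// mulVf// gt_eqF.
rewrite Normc.normcM nc_real ?nc_ge0// nu mulr1 -mulrA.
move: h; move: (u * _) => z h; rewrite ReM /= mul0r subr0 ler_pM2l//; lra.
Qed.

Lemma nc_sesq_le c c' : nc (sesq c c') <= (quad c + quad c') / 2.
Proof.
have := sesq_le (sesq c c')^* c c'; rewrite mulrC nc_sqr /= ncJ expr2.
have [->|h] := eqVneq (nc (sesq c c')) 0.
  by move=> _; have := quad_ge0 c; have := quad_ge0 c'; lra.
by rewrite ler_pM2l// lt_neqAle nc_ge0 eq_sym h.
Qed.

(* The weights theta only have to majorize the indicator function of the rows on which P lives;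
   Schur's test for the smoothed Gram kernel replaces Plancherel's theorem. *)
Lemma large_sieve (w Cs : R) (theta : I -> R) (E : K -> I -> C) : 0 <= w -> 0 < Cs ->
  (forall i, 0 <= theta i) -> (forall i, 1 <= theta i \/ forall j, P i j = 0) ->
  (forall l, \sum_k nc (\sum_i (w * theta i)%:C * E k i * (E l i)^*) <= Cs) ->
  \sum_k quad (fun i => w%:C * E k i) <= Cs * \sum_i w * complex.Re (P i i).
Proof.
move=> w0 Cs0 th0 th1 schur.
pose G k i := w%:C * E k i.
(* Duality: pairing [S i] with the unit vector at [i] and summing with weight [w] reproduces the
   left-hand side [X] ([e1]), while the values [quad (S i)] are controlled through Schur's test by
   [Cs * X] ([e2]). *)
pose S i := fun j => \sum_k (E k i)^* * G k j.
pose dl i := fun j : I => if j == i then 1 else 0 : C.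
pose lam := Cs^-1.
have sdl i c : sesq (dl i) c = \sum_j (c j)^* * P i j.
  rewrite /sesq (bigD1 i)//= [X in _ + X]big1 ?addr0; last first.
    by move=> j ji; rewrite big1// => l _; rewrite /dl (negbTE ji) !mul0r.
  by apply: eq_bigr => j _; rewrite /dl eqxx mul1r.
have qdl i : quad (dl i) = complex.Re (P i i).
  rewrite /quad sdl (bigD1 i)//= [X in _ + X]big1 ?addr0; last first.
    by move=> j ji; rewrite /dl (negbTE ji) conjc0 mul0r.
  by rewrite /dl eqxx conjc1 mul1r.
(* Positivity of the form at [dl i - lam * S i]. The weight [theta i] may be inserted because it is
   at least 1 unless row [i] of [P] vanishes, and then the left side is 0. *)
have step i : 2 * lam * complex.Re (sesq (dl i) (S i)) <=
    complex.Re (P i i) + lam ^+ 2 * (theta i * quad (S i)).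
  have [t1|t0] := th1 i.
    have := quad_ge0 (fun j => dl i j - lam%:C * S i j); rewrite quad_sub qdl => h.
    have l2 := sqr_ge0 lam; have qS := quad_ge0 (S i).
    have : lam ^+ 2 * quad (S i) <= lam ^+ 2 * (theta i * quad (S i)).
      by rewrite ler_wpM2l// ler_peMl.
    lra.
  rewrite sdl t0 big1 => [|j _]; last by rewrite t0 mulr0.
  by rewrite /= mulr0 add0r mulr_ge0 ?sqr_ge0// mulr_ge0 ?quad_ge0.
set X := \sum_k quad (G k).
have e1 : \sum_i w * complex.Re (sesq (dl i) (S i)) = X.
  transitivity (complex.Re (\sum_i w%:C * sesq (dl i) (S i))).
    by rewrite Re_sum; apply: eq_bigr => i _; rewrite ReM /= mul0r subr0.
  transitivity (complex.Re (\sum_k sesq (G k) (G k))); last by rewrite Re_sum.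
  congr complex.Re; under eq_bigr do rewrite sesq_sumr mulr_sumr.
  rewrite exchange_big; apply: eq_bigr => k _ /=.
  have {2}-> : G k = fun j => \sum_i G k i * dl i j.
    apply/funext => j; rewrite (bigD1 j)//= big1 ?addr0 /dl ?eqxx ?mulr1// => i ij.
    by rewrite eq_sym (negbTE ij) mulr0.
  by rewrite sesq_suml; apply: eq_bigr => i _; rewrite conjcK mulrA.
have e2 : \sum_i w * (theta i * quad (S i)) <= Cs * X.
  have -> : \sum_i w * (theta i * quad (S i)) =
     \sum_k \sum_l complex.Re ((\sum_i (w * theta i)%:C * E l i * (E k i)^*) * sesq (G k) (G l)).
    transitivity (complex.Re (\sum_i (w * theta i)%:C * sesq (S i) (S i))).
      by rewrite Re_sum; apply: eq_bigr => i _; rewrite sesq_quad ReM /= mul0r subr0 mulrA.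
    under [RHS]eq_bigr do rewrite -Re_sum.
    rewrite -Re_sum; congr complex.Re.
    under eq_bigr do rewrite sesq_suml mulr_sumr.
    rewrite exchange_big; apply: eq_bigr => k _ /=.
    under eq_bigr do rewrite sesq_sumr !mulr_sumr.
    rewrite exchange_big; apply: eq_bigr => l _ /=.
    rewrite mulr_suml; apply: eq_bigr => i _; rewrite conjcK; ring.
  apply: (@le_trans _ _ (\sum_k \sum_l nc (\sum_i (w * theta i)%:C * E l i * (E k i)^*) *
      ((quad (G k) + quad (G l)) / 2))).
    by apply: ler_sum => k _; apply: ler_sum => l _; exact: sesq_le.
  set N := fun l k => nc (\sum_i (w * theta i)%:C * E l i * (E k i)^*).
  have Nsym l k : N l k = N k l.
    rewrite /N -ncJ cj_sum; congr nc; apply: eq_bigr => i _.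
    by rewrite !cjM conjcK conjc_real mulrAC.
  (* Schur's test: [N] is symmetric, so the row sums bound both halves of the arithmetic mean. *)
  have -> : \sum_k \sum_l N l k * ((quad (G k) + quad (G l)) / 2) =
      (\sum_k \sum_l N l k * quad (G k)) / 2 + (\sum_k \sum_l N l k * quad (G l)) / 2.
    rewrite !mulr_suml -big_split; apply: eq_bigr => k _ /=.
    rewrite !mulr_suml -big_split; apply: eq_bigr => l _ /=; ring.
  have a1 : \sum_k \sum_l N l k * quad (G k) <= Cs * X.
    rewrite mulr_sumr; apply: ler_sum => k _; rewrite -mulr_suml.
    by rewrite ler_wpM2r ?quad_ge0// schur.
  have a2 : \sum_k \sum_l N l k * quad (G l) <= Cs * X.
    rewrite exchange_big mulr_sumr; apply: ler_sum => k _; rewrite -mulr_suml.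
    rewrite ler_wpM2r ?quad_ge0//; under eq_bigr do rewrite Nsym; exact: schur.
  lra.
have h : \sum_i w * (2 * lam * complex.Re (sesq (dl i) (S i))) <=
    \sum_i w * (complex.Re (P i i) + lam ^+ 2 * (theta i * quad (S i))).
  by apply: ler_sum => i _; rewrite ler_wpM2l.
have {}h : 2 * lam * X <= \sum_i w * complex.Re (P i i) + lam ^+ 2 * (Cs * X).
  apply: (@le_trans _ _ (\sum_i w * (2 * lam * complex.Re (sesq (dl i) (S i))))).
    by rewrite -e1 mulr_sumr; apply: ler_sum => i _; rewrite mulrCA.
  apply: le_trans h _.
  have -> : \sum_i w * (complex.Re (P i i) + lam ^+ 2 * (theta i * quad (S i))) =
      \sum_i w * complex.Re (P i i) + lam ^+ 2 * \sum_i w * (theta i * quad (S i)).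
    by rewrite mulr_sumr -big_split; apply: eq_bigr => i _ /=; ring.
  by rewrite lerD2l ler_wpM2l// sqr_ge0.
(* With [lam = 1 / Cs] the quadratic term takes back exactly half of the left side [2 * lam * X]. *)
have e3 : lam ^+ 2 * (Cs * X) = lam * X by rewrite /lam; field; apply/eqP; lra.
rewrite e3 in h; have {}h : lam * X <= \sum_i w * complex.Re (P i i) by lra.
by rewrite mulrC -ler_pdivrMr// mulrC.
Qed.
End LargeSieve.

Section AmalgamBounds.
Variables (R : realType) (d : nat).
Local Notation C := R[i].
Local Notation V := 'rV[R]_d.
Local Notation Z := 'rV[int]_d.
Local Notation nc := (@Normc.normc R).
Local Notation ez := (@ez R d).
Local Notation e2 := (@expi2pi R).
Implicit Types (f g : V -> C) (L : R) (J : seq Z).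

(** The double integral uses the same nodes in both variables, which turns it into a form on
    functions over [I], as the large sieve requires. *)
Lemma riemann_nodes L : 0 <= L -> exists2 A : R, 0 <= A &
  forall (J1 J2 : finType) (F1 : J1 -> V -> C) (F2 : J2 -> V -> V -> C) (e : R), 0 < e ->
  (forall j, cc L (F1 j)) -> (forall j, cc2 L L (F2 j)) ->
  exists (I : finType) (w : R) (v : I -> V), [/\ 0 <= w, w * #|I|%:R <= A,
    forall j, nc (leb (F1 j) - w%:C * \sum_i F1 j (v i)) <= e &
    forall j, nc (leb (fun x => leb (F2 j x)) - w%:C * \sum_i w%:C * \sum_l F2 j (v i) (v l)) <= e].
Proof.
move=> L0; have [A A0 HA] := leb_riemann d L0; have [A' A'0 HA'] := leb_bound d L0.
exists A => // J1 J2 F1 F2 e e0 h1 h2.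
have AA : 0 <= A * A' by rewrite mulr_ge0.
have A2 : 0 <= A * A by rewrite mulr_ge0.
pose z := e / (A + A * A' + A * A + 1).
have z0 : 0 < z by rewrite divr_gt0//; lra.
have ez : (A + A * A' + A * A + 1) * z = e by rewrite /z mulrC divfK//; apply/eqP; lra.
have : \forall del \near (0:R)^'+, forall j x y, `|x - y| < del -> nc (F1 j x - F1 j y) <= z.
  apply: filter_forall => j; have [del d0 hd] := cc_unif (h1 j) z0.
  near=> r => x y xy; apply/ltW/hd; apply: lt_le_trans xy _.
  by near: r; apply: nbhs_right_le.
move=> k1; have : \forall del \near (0:R)^'+, forall j x x' y y', `|x - x'| < del -> `|y - y'| < del ->
     nc (F2 j x y - F2 j x' y') <= z.
  apply: filter_forall => j; have [del d0 hd] := cc2_unif (h2 j) z0.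
  near=> r => x x' y y' xx yy; have rd : r <= del by near: r; apply: nbhs_right_le.
  by apply/ltW/hd; [apply: lt_le_trans xx _ | apply: lt_le_trans yy _].
move=> k2; have /filter_ex[del [d0 hd1 hd2]] : \forall del \near (0:R)^'+, [/\ 0 < del,
   forall j x y, `|x - y| < del -> nc (F1 j x - F1 j y) <= z &
   forall j x x' y y', `|x - x'| < del -> `|y - y'| < del -> nc (F2 j x y - F2 j x' y') <= z].
  by near=> r; split; [near: r; exact: nbhs_right_gt | near: r | near: r].
have [I [w [v [w0 wA Iv]]]] := HA del d0.
exists I, w, v; split => // j.
  by apply: le_trans (Iv _ _ (h1 j) (hd1 j)) _; nra.
have hG : cc L (fun x => leb (F2 j x)) := meas_cc2 (leb_measure R d) (cc2_swap (h2 j)).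
have mG x y : `|x - y| < del -> nc (leb (F2 j x) - leb (F2 j y)) <= A' * z.
  move=> xy; rewrite -(lebB L0); try exact: cc2_r (h2 j).
  apply: HA'; first by apply: ccB; exact: cc2_r (h2 j).
  by move=> t; apply: hd2 => //; rewrite subrr normr0.
have k3 := Iv _ _ hG mG.
have k4 : nc (w%:C * \sum_i leb (F2 j (v i)) - w%:C * \sum_i w%:C * \sum_l F2 j (v i) (v l)) <= A * (A * z).
  rewrite -mulrBr -sumrB Normc.normcM (nc_real w0).
  apply: (@le_trans _ _ (w * (#|I|%:R * (A * z)))); last by rewrite mulrA ler_wpM2r// mulr_ge0// ltW.
  rewrite ler_wpM2l//; apply: le_trans (nc_sum _ _ _) _.
  rewrite mulr_natl -sumr_const; apply: ler_sum => i _; apply: Iv; first exact: cc2_r (h2 j).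
  by move=> x y xy; apply: hd2 => //; rewrite subrr normr0.
have := nc_triangle (w%:C * \sum_i leb (F2 j (v i))) (leb (fun x => leb (F2 j x)))
   (w%:C * \sum_i w%:C * \sum_l F2 j (v i) (v l)).
nra.
Unshelve. all: by end_near. Qed.

Lemma nc_normsq (z : C) : nc (`|z| ^+ 2) = nc z ^+ 2.
Proof. by rewrite normc_normE -rmorphXn nc_real// sqr_ge0. Qed.

Section Points.
Variables (J : seq Z) (y : Z -> V).
Hypothesis uJ : uniq J.
Hypothesis hy : forall k, k \in J -> `|y k - ez k| <= 1.
Let pt (a : 'I_(size J)) : V := y (nth 0 J a).

Lemma sum_points (F : V -> R) : \sum_(k <- J) F (y k) = \sum_a F (pt a).
Proof. by rewrite (big_nth 0) big_mkord. Qed.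

Lemma points_separated a : \sum_b \prod_j (1 + ((pt b - pt a) ord0 j) ^+ 2)^-1 <= 72 ^+ d.
Proof.
rewrite -(sum_points (fun t => \prod_j (1 + ((t - pt a) ord0 j) ^+ 2)^-1)).
by apply: (sum_separated (k0 := nth 0 J a)) => //; apply: hy; exact: mem_nth.
Qed.

(** The smoothed Gram kernel of the characters is a Riemann sum for the transform of [theta] at
    differences of sample points. Decay and separation bound its row sums by [B * 72 ^+ d], and the
    1 absorbs the Riemann errors. *)
Lemma points_schur (I : finType) (w B e : R) (v : I -> V) (theta : V -> C) : 0 <= w -> 0 <= B -> 0 <= e ->
  e * (size J)%:R <= 1 -> (forall x, 0 <= theta x) ->
  (forall t, nc (checkf theta t) <= B * \prod_j (1 + (t ord0 j) ^+ 2)^-1) ->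
  (forall a b, nc (checkf theta (pt b - pt a) -
      w%:C * \sum_i theta (v i) * e2 (dotv (v i) (pt b - pt a))) <= e) ->
  forall a, \sum_b nc (\sum_i (w * complex.Re (theta (v i)))%:C * e2 (dotv (v i) (pt b)) *
     (e2 (dotv (v i) (pt a)))^*) <= B * 72 ^+ d + 1.
Proof.
move=> w0 B0 e0 eJ th0 hB happ a.
apply: (@le_trans _ _ (\sum_b (B * \prod_j (1 + ((pt b - pt a) ord0 j) ^+ 2)^-1 + e))).
  apply: ler_sum => b _.
  have -> : \sum_i (w * complex.Re (theta (v i)))%:C * e2 (dotv (v i) (pt b)) * (e2 (dotv (v i) (pt a)))^* =
      w%:C * \sum_i theta (v i) * e2 (dotv (v i) (pt b - pt a)).
    rewrite mulr_sumr; apply: eq_bigr => i _.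
    by rewrite dotvBr expiD expiN (ge0_complex (th0 (v i))).1 rmorphM !mulrA.
  have := happ a b; have := hB (pt b - pt a).
  move: (checkf _ _) (w%:C * _) => p q h1 h2.
  have := ncD (q - p) p; rewrite subrK (ncBC q); lra.
rewrite big_split /= -mulr_sumr sumr_const card_ord -[e *+ _]mulr_natr.
by apply: lerD => //; rewrite ler_wpM2l// points_separated.
Qed.
End Points.

Lemma sum_rank1 (I : finType) (c c' a : I -> C) :
  \sum_i \sum_j c i * (c' j)^* * (a i * (a j)^*) = (\sum_i c i * a i) * (\sum_i c' i * a i)^*.
Proof.
rewrite cj_sum mulr_suml; apply: eq_bigr => i _; rewrite mulr_sumr; apply: eq_bigr => j _.
rewrite cjM; ring.
Qed.

(** A Riemann error that stays below 1 after summation over [n] sample points, so that the final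
    bounds do not depend on the size of the sample. *)
Lemma small_tolerance (n : nat) : exists2 e : R, 0 < e & e <= 1 /\ e * n%:R <= 1.
Proof.
exists (n%:R + 1)^-1; first by rewrite invr_gt0; have : 0 <= (n%:R : R) by []; lra.
have n0 : 0 <= (n%:R : R) by [].
by split; [rewrite invf_le1; lra | rewrite mulrC ler_pdivrMr; lra].
Qed.

Lemma amalgam_check_sq g : Cc g -> exists2 S : R, 0 <= S & amalgam (fun y => `|checkf g y| ^+ 2) S.
Proof.
move=> /Cc_cc[L L0 hg]; have [b b0 hb] := cc_bounded hg.
have [theta [L' [B [L'0 hth th0 th1 [B0 hB]]]]] := majorant d L0.
pose Lm := Order.max L L'.
have LL : L <= Lm by rewrite le_max lexx.
have LL' : L' <= Lm by rewrite le_max lexx orbT.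
have Lm0 : 0 <= Lm := le_trans L0 LL.
have {}hg' := ccW LL hg; have hth' := ccW LL' hth.
have [A A0 HA] := riemann_nodes Lm0.
pose Cs := B * 72 ^+ d + 1.
have Cs0 : 0 < Cs by rewrite /Cs; have : 0 <= B * 72 ^+ d by [rewrite mulr_ge0// exprn_ge0]; lra.
have S0 : 0 <= 2 * (Cs * (A * b ^+ 2)) + 2.
  by rewrite addr_ge0// mulr_ge0// mulr_ge0 ?(ltW Cs0)// mulr_ge0// sqr_ge0.
exists (2 * (Cs * (A * b ^+ 2)) + 2) => // J y uJ hy.
pose pt (a : 'I_(size J)) : V := y (nth 0 J a).
rewrite (sum_points J y (fun t => nc (`|checkf g t| ^+ 2))).
have [e e0 [e1 eJ]] := small_tolerance (size J).
pose F1 (j : ('I_(size J) * 'I_(size J)) + 'I_(size J)) (x : V) : C :=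
  match j with inl p => theta x * e2 (dotv x (pt p.2 - pt p.1)) | inr a => g x * e2 (dotv x (pt a)) end.
have [|[p|a]|[]|I [w [v [w0 wA Iv _]]]] := HA _ void F1 (fun=> fun=> fun=> 0) e; rewrite /F1//.
- exact: cc_exp.
- exact: cc_exp.
pose E (a : 'I_(size J)) (i : I) : C := e2 (dotv (v i) (pt a)).
(* With a rank one kernel, the form at a weighted character is the squared modulus of a Riemann sum
   for the transform of [g], and the diagonal is a Riemann sum for the squared modulus of [g]. *)
pose P (i j : I) : C := g (v i) * (g (v j))^*.
have hP c : 0 <= \sum_i \sum_j c i * (c j)^* * P i j by rewrite sum_rank1 mulcJ_ge0.
have Ph i j : P j i = (P i j)^* by rewrite /P cjM conjcK mulrC.
have schur := points_schur uJ hy w0 B0 (ltW e0) eJ th0 hB (fun a b => Iv (inl (a, b))).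
have th1' i : 1 <= complex.Re (theta (v i)) \/ forall j, P i j = 0.
  have [vL|vL] := leP `|v i| L; [left | right => j].
    by have := th1 _ vL; rewrite (ge0_complex (th0 (v i))).1 lecR.
  by rewrite /P hg.2// mul0r.
have := large_sieve hP Ph w0 Cs0 (fun i => (ge0_complex (th0 (v i))).2) th1' (E := E) schur.
have -> : \sum_k quad P (fun i => w%:C * E k i) = \sum_k nc (w%:C * \sum_i g (v i) * e2 (dotv (v i) (pt k))) ^+ 2.
  apply: eq_bigr => k _; rewrite /quad /sesq sum_rank1 nc_sqr /=.
  congr (nc _ ^+ 2); rewrite mulr_sumr; apply: eq_bigr => i _; rewrite /E; ring.
have hPb : \sum_i w * complex.Re (P i i) <= A * b ^+ 2.
  apply: (@le_trans _ _ (\sum_(i : I) w * b ^+ 2)).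
    apply: ler_sum => i _; rewrite ler_wpM2l// /P nc_sqr /=.
    by rewrite ler_sqr ?nnegrE ?nc_ge0.
  by rewrite sumr_const -mulr_natr mulrAC ler_wpM2r// sqr_ge0.
move=> h; have {}h := le_trans h (ler_wpM2l (ltW Cs0) hPb).
(* Returning from Riemann sums to the transform: [(q + e)^2 <= 2 q^2 + 2 e^2], and [e^2 <= e] as
   [e <= 1]. Summed over the sample, the second term contributes at most 2. *)
apply: (@le_trans _ _ (\sum_k (2 * nc (w%:C * \sum_i g (v i) * e2 (dotv (v i) (pt k))) ^+ 2 + 2 * e))).
  apply: ler_sum => k _; rewrite nc_normsq.
  have := Iv (inr k); rewrite -/(checkf g (pt k)); move: (checkf _ _) (w%:C * _) => p q hpq.
  have := ncD (p - q) q; rewrite subrK => hp.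
  have p0 := nc_ge0 p; have q0 := nc_ge0 q.
  have k1 : nc p ^+ 2 <= (nc q + e) ^+ 2 by rewrite ler_sqr ?nnegrE ?addr_ge0 ?(ltW e0)//; lra.
  have k2 := sqr_ge0 (nc q - e); have k3 : e * e <= e by rewrite ler_piMr// ltW.
  by move: k1 k2; rewrite sqrrD sqrrB; move: k3; rewrite !mulr2n -!expr2; lra.
rewrite big_split /= -mulr_sumr sumr_const card_ord -[_ *+ _]mulr_natr.
by apply: lerD; [rewrite ler_pM2l | lra].
Qed.

End AmalgamBounds.

Section Plateau.
Variables (R : realType) (d : nat).
Local Notation C := R[i].
Local Notation V := 'rV[R]_d.
Local Notation nc := (@Normc.normc R).
Implicit Types (L : R) (x : V).

Lemma ramp_lip (s t : R) : `|ramp s - ramp t| <= `|s - t|.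
Proof.
have := ler_norm (s - t); have := ler_norm (t - s); rewrite (distrC t) ler_norml => k1 k2.
have := normr_ge0 (s - t).
by case: (rampP s) => -[h1 ->]; case: (rampP t) => -[h2 ->] k3; apply/andP; split; lra.
Qed.

Lemma ramp01 (s : R) : 0 <= ramp s <= 1.
Proof. by case: (rampP s) => -[h1 ->]; apply/andP; split; lra. Qed.

Definition plateau L x : C := (ramp (L + 1 - `|x|))%:C.

Lemma plateau_in L x : `|x| <= L -> plateau L x = 1.
Proof.
move=> h; rewrite /plateau (_ : ramp _ = 1)//.
by case: (rampP (L + 1 - `|x|)) => -[h1 ->]; lra.
Qed.

Lemma plateau01 L x : 0 <= plateau L x <= 1.
Proof. by rewrite ler0c lecR ramp01. Qed.

Lemma nc_plateau L x : nc (plateau L x) <= 1.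
Proof. by have /andP[h0 h1] := ramp01 (L + 1 - `|x|); rewrite /plateau nc_real. Qed.

Lemma cts_plateau L : cts (plateau L).
Proof.
apply: cts_unif => e e0; exists e => // x y xy.
rewrite /plateau -rmorphB ncR; apply: le_trans (ramp_lip _ _) _.
rewrite (_ : _ - _ = `|y| - `|x|); last by ring.
by apply: le_trans (ler_dist_dist _ _) _; rewrite distrC ltW.
Qed.

Lemma cc_plateau L : cc (L + 1) (plateau L).
Proof.
split; first exact: cts_plateau.
move=> x h; rewrite /plateau (_ : ramp _ = 0)//.
by case: (rampP (L + 1 - `|x|)) => -[h1 ->]; lra.
Qed.

Lemma Cc_plateau L : Cc (plateau L).
Proof. exact: cc_Cc (cc_plateau L). Qed.
End Plateau.

(** * Transforms of positive definite functions *)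

Section PositiveDefinite.
Variables (R : realType) (d : nat).
Local Notation C := R[i].
Local Notation V := 'rV[R]_d.
Local Notation nc := (@Normc.normc R).
Local Notation e2 := (@expi2pi R).
Implicit Types (f : V -> C) (L : R) (x y : V).

Lemma posdef_psd f (I : finType) (v : I -> V) (c : I -> C) : posdef f ->
  0 <= \sum_i \sum_j c i * (c j)^* * f (v i - v j).
Proof.
move=> /(_ #|I| (fun a => c (enum_val a)) (fun a => v (enum_val a))) h.
rewrite (reindex _ (onW_bij _ (@enum_val_bij I))) /=.
rewrite (eq_bigr (fun i => \sum_(j < #|I|) c (enum_val i) * (c (enum_val j))^* *
   f (v (enum_val i) - v (enum_val j)))); first exact: h.
by move=> i _; rewrite (reindex _ (onW_bij _ (@enum_val_bij I))).
Qed.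

Local Arguments conjc : simpl never.

(** Positivity at the points [x] and 0 with coefficients 1 and [a] makes an expression real;
    [a = 0], [a = 1] and [a = 'i] settle in turn the value at 0, the imaginary parts and the real
    parts. *)
Lemma posdef_herm f x : posdef f -> f (- x) = (f x)^*.
Proof.
move=> pf.
have h (a : C) : complex.Im (f 0 + a^* * f x + (a * f (- x) + a * a^* * f 0)) = 0.
  have := @posdef_psd f bool (fun b => if b then x else 0) (fun b => if b then 1 else a) pf.
  rewrite !big_bool /= !subrr subr0 sub0r !conjc1 !mul1r mulr1 => /ge0_complex[-> _] //.
have h0 : complex.Im (f 0) = 0.
  have := h 0; rewrite conjc0 !mul0r !addr0 //.
have h1 := h 1; have h2 := h 'i.
move: h0 h1 h2; rewrite conjc1; case: (f 0) (f x) (f (- x)) => a0 b0 [a1 b1] [a2 b2] ; rewrite /conjc /= => -> h1 h2.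
by apply: complex_eq => /=; lra.
Qed.

Lemma cc2W A B A' B' (F : V -> V -> C) : A <= A' -> B <= B' -> cc2 A B F -> cc2 A' B' F.
Proof.
by move=> AA BB [hF F0]; split => // x y /F0[h1 h2]; split; [exact: le_trans AA | exact: le_trans BB].
Qed.

Section Kernel.
Variables (f : V -> C) (Lf : R).
Hypotheses (Lf0 : 0 <= Lf) (hf : cc Lf f).

(** Splitting the character over [u] and [v] exhibits the double integral of this kernel as the form
    with kernel [f (u - v)], taken at a modulated plateau and a modulated bump. On the support of
    the bump the plateau is 1 wherever [f (u - v)] is nonzero, so the integral over [u] is a full
    one and yields the transform of [f]. *)
Let F y (u v : V) := f (u - v) * e2 (dotv (u - v) y) * (plateau (Lf + 1) u * bump 1 v).

Lemma cc2_kernel y : cc2 (Lf + 2) 1 (F y).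
Proof.
split.
  apply: ctsM.
    have cs : continuous (fun p : V * V => p.1 - p.2).
      by apply: continuous_sub; [exact: continuous_fst | exact: continuous_snd].
    apply: ctsM; first exact: (cts_comp (h := fun p : V * V => p.1 - p.2) (f := f) cs hf.1).
    exact: (cts_comp (h := fun p : V * V => p.1 - p.2) (f := fun z => e2 (dotv z y)) cs (cts_expdotl y)).
  apply: ctsM.
    apply: (cts_comp (h := fun p : V * V => p.1) (f := plateau (Lf + 1))); last exact: cts_plateau.
    exact: continuous_fst.
  apply: (cts_comp (h := fun p : V * V => p.2) (f := @bump R d 1)); last by have [] := cc_bump d (@ler01 R).
  exact: continuous_snd.
move=> u v; rewrite /F; rewrite !mulf_eq0 !negb_or => /andP[_ /andP[h1 h2]].
split; rewrite leNgt; apply/negP => h.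
  by move/eqP: h1; apply; apply: (cc_plateau d (Lf + 1)).2; lra.
by move/eqP: h2; apply; exact: (cc_bump d ler01).2.
Qed.

Lemma leb_kernel y : leb (fun u => leb (F y u)) = checkf f y * leb (@bump R d 1).
Proof.
rewrite (meas_fubini (leb_measure R d) ler01 (cc2_kernel y)) -(lebZ _ ler01 (cc_bump d ler01)).
congr leb; apply/funext => v.
have [v1|v1] := leP `|v| 1; last first.
  rewrite (cc_bump d ler01).2// mulr0 -[RHS](leb0 R d); congr leb; apply/funext => u.
  by rewrite /F (cc_bump d ler01).2// !mulr0.
rewrite mulrC /checkf -(leb_shift (- v) Lf0 (cc_exp y hf)).
have hs : cc (Lf + `|- v|) (fun u => f (u - v) * e2 (dotv (u - v) y)).
  exact: (cc_shift (- v) (cc_exp y hf)).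
rewrite -(lebZ _ (_ : 0 <= Lf + `|- v|) hs) ?addr_ge0//; congr leb; apply/funext => u.
rewrite /F; have [uv|uv] := leP `|u - v| Lf; last by rewrite hf.2// !mul0r mulr0.
rewrite plateau_in ?mul1r 1?mulrC//.
by have := ler_normD (u - v) v; rewrite subrK; lra.
Qed.
End Kernel.

(** The values of the transform are, up to the factor [W], mixed values of the form with kernel
    [f (v i - v j)]. The arithmetic-geometric inequality bounds them by quadratic values at the two
    cut-offs, and the large sieve sums each of these. Hence the first power is summable. *)
Lemma amalgam_check_posdef f : Cc f -> posdef f -> exists2 S : R, 0 <= S & amalgam (checkf f) S.
Proof.
move=> /Cc_cc[Lf Lf0 hf] pf; pose Lq := Lf + 2; have Lq0 : 0 <= Lq by rewrite /Lq; lra.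
have [theta [L' [B [L'0 hth th0 th1 [B0 hB]]]]] := majorant d Lq0.
pose Lm := Order.max Lq L'.
have LL : Lq <= Lm by rewrite le_max lexx.
have LL' : L' <= Lm by rewrite le_max lexx orbT.
have Lm0 : 0 <= Lm := le_trans Lq0 LL.
have hth' := ccW LL' hth.
have L1m : 1 <= Lm by apply: le_trans LL; rewrite /Lq; lra.
have hF y : cc2 Lm Lm _ := cc2W LL L1m (cc2_kernel hf y).
have [A A0 HA] := riemann_nodes d Lm0.
pose Cs := B * 72 ^+ d + 1.
have Cs0 : 0 < Cs by rewrite /Cs; have : 0 <= B * 72 ^+ d by [rewrite mulr_ge0// exprn_ge0]; lra.
have [WE W0] := ge0_complex (ltW (leb_bump_gt0 d (@ltr01 R))).
set W := complex.Re (leb (@bump R d 1)) in WE W0.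
have {}W0 : 0 < W by have := leb_bump_gt0 d (@ltr01 R); rewrite WE ltcR.
have S0 : 0 <= (Cs * (A * nc (f 0)) + 1) / W.
  by rewrite divr_ge0 ?(ltW W0)// addr_ge0// mulr_ge0 ?(ltW Cs0)// mulr_ge0 ?nc_ge0.
exists ((Cs * (A * nc (f 0)) + 1) / W) => // J y uJ hy.
pose pt (a : 'I_(size J)) : V := y (nth 0 J a).
rewrite (sum_points J y (fun t => nc (checkf f t))).
have [e e0 [e1 eJ]] := small_tolerance R (size J).
pose F1 (p : 'I_(size J) * 'I_(size J)) (x : V) : C := theta x * e2 (dotv x (pt p.2 - pt p.1)).
have [|I [w [v [w0 wA Iv1 Iv2]]]] := HA _ 'I_(size J) F1 _ e e0 _ (fun a => hF (pt a)).
  by move=> p; exact: cc_exp.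
pose E (a : 'I_(size J)) (i : I) : C := e2 (dotv (v i) (pt a)).
pose P (i j : I) : C := f (v i - v j).
have hP c : 0 <= \sum_i \sum_j c i * (c j)^* * P i j by exact: posdef_psd.
have Ph i j : P j i = (P i j)^* by rewrite /P -posdef_herm// opprB.
have schur := points_schur uJ hy w0 B0 (ltW e0) eJ th0 hB (fun a b => Iv1 (a, b)).
(* The cut-off [u] goes into the kernel, not into [E], because the Schur bound concerns pure
   characters. The modified kernel stays positive, its rows vanish off the ball where [theta >= 1],
   and its diagonal is bounded by the modulus of [f 0]. *)
have sieve (u : V -> C) : (forall x, Lq < `|x| -> u x = 0) -> (forall x, nc (u x) <= 1) ->
    \sum_k quad P (fun i => w%:C * E k i * u (v i)) <= Cs * (A * nc (f 0)).
  move=> u0 u1; pose P' i j := u (v i) * (u (v j))^* * P i j.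
  have eP c c' : sesq P' c c' = sesq P (fun i => c i * u (v i)) (fun i => c' i * u (v i)).
    by apply: eq_bigr => i _; apply: eq_bigr => j _; rewrite /P' cjM; ring.
  have hP' c : 0 <= \sum_i \sum_j c i * (c j)^* * P' i j.
    by have := hP (fun i => c i * u (v i)); rewrite -[X in 0 <= X](eP c c).
  have Ph' i j : P' j i = (P' i j)^* by rewrite /P' !cjM conjcK -Ph (mulrC (u (v j))).
  have th1' i : 1 <= complex.Re (theta (v i)) \/ forall j, P' i j = 0.
    have [vL|vL] := leP `|v i| Lq; [left | right => j].
      by have := th1 _ vL; rewrite (ge0_complex (th0 (v i))).1 lecR.
    by rewrite /P' u0// !mul0r.
  have := large_sieve hP' Ph' w0 Cs0 (fun i => (ge0_complex (th0 (v i))).2) th1' (E := E) schur.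
  rewrite (eq_bigr (fun k => quad P (fun i => w%:C * E k i * u (v i)))); last first.
    by move=> k _; rewrite /quad eP.
  move=> /le_trans; apply; rewrite ler_pM2l//.
  apply: (@le_trans _ _ (\sum_(i : I) w * nc (f 0))); last first.
    by rewrite sumr_const -mulr_natr mulrAC ler_wpM2r// nc_ge0.
  apply: ler_sum => i _; rewrite ler_wpM2l//; apply: le_trans (ler_norm _) _.
  apply: le_trans (nc_Re _) _; rewrite /P' !Normc.normcM ncJ /P subrr.
  by rewrite ler_piMl ?nc_ge0// mulr_ile1 ?nc_ge0.
have s1 := sieve (plateau (Lf + 1)) _ (nc_plateau _).
have {}s1 := s1 ltac:(move=> x h; apply: (cc_plateau d (Lf + 1)).2; move: h; rewrite /Lq; lra).
have s2 := sieve (@bump R d 1) _ (@nc_bump1 R d).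
have {}s2 := s2 ltac:(move=> x h; apply: (cc_bump d ler01).2; move: h; rewrite /Lq; lra).
rewrite ler_pdivlMr// mulr_suml.
apply: (@le_trans _ _ (\sum_k ((quad P (fun i => w%:C * E k i * plateau (Lf + 1) (v i)) +
   quad P (fun i => w%:C * E k i * bump 1 (v i))) / 2 + e))).
  apply: ler_sum => k _.
  have := Iv2 k; rewrite (leb_kernel Lf0 hf) WE.
  have -> : w%:C * \sum_i w%:C * \sum_l f (v i - v l) * e2 (dotv (v i - v l) (pt k)) *
       (plateau (Lf + 1) (v i) * bump 1 (v l)) =
     sesq P (fun i => w%:C * E k i * plateau (Lf + 1) (v i)) (fun i => w%:C * E k i * bump 1 (v i)).
    rewrite /sesq mulr_sumr; apply: eq_bigr => i _; rewrite !mulr_sumr; apply: eq_bigr => l _.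
    rewrite /P /E !cjM conjc_real dotvBl expiD expiN bump_real conjc_real; ring.
  have := nc_sesq_le hP Ph (fun i => w%:C * E k i * plateau (Lf + 1) (v i)) (fun i => w%:C * E k i * bump 1 (v i)).
  move: (sesq _ _ _) => X h1 h2.
  have -> : nc (checkf f (pt k)) * W = nc (checkf f (pt k) * W%:C).
    by rewrite Normc.normcM nc_real// ltW.
  by have := ncD (checkf f (pt k) * W%:C - X) X; rewrite subrK; lra.
rewrite big_split /= -mulr_suml big_split /= sumr_const card_ord -[e *+ _]mulr_natr.
by apply: lerD => //; lra.
Qed.
End PositiveDefinite.

(** * Integration against measures *)

Section Integrability.
Variables (R : realType) (d : nat).
Local Notation C := R[i].
Local Notation V := 'rV[R]_d.
Local Notation nc := (@Normc.normc R).
Local Notation integrable := (@Defs.integrable R d).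
Implicit Types (f g h phi : V -> C) (L S M e : R) (nu : (V -> C) -> C).

Lemma varm_le nu h M : (varm nu h <= M%:E)%E <->
  forall g, Cc g -> (forall x, `|g x| <= h x) -> nc (nu g) <= M.
Proof.
split=> [hM g hg gh|H].
  rewrite -lee_fin; apply: le_trans hM; apply: ereal_sup_ubound.
  by exists g.
by apply: ge_ereal_sup => _ [g [hg gh] <-]; rewrite lee_fin; exact: H.
Qed.

(* The integral of |h| against |nu| is at most S. *)
Definition ibd nu h S := forall g, Cc g -> (forall x, nc (g x) <= nc (h x)) -> nc (nu g) <= S.

Lemma integrable_ibd nu h : integrable nu h <-> exists S, ibd nu h S.
Proof.
split=> [[M hM]|[S hS]].
  exists M => g hg gh; have /Cc_cc[L L0 [_ g0]] := hg.
  move/varm_le: (hM (plateau L) (@Cc_plateau R d L) (plateau01 L)); apply => // x.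
  rewrite normc_normE; have [xL|xL] := leP `|x| L; first by rewrite plateau_in// mul1r lecR.
  by rewrite g0// Normc.normc0 mulr_ge0//; have /andP[] := plateau01 L x.
exists S => phi hphi phi01; apply/varm_le => g hg gh; apply: hS => // x.
rewrite -lecR; apply: le_trans (gh x) _; rewrite -[X in _ <= X]mul1r.
by rewrite ler_wpM2r//; have /andP[] := phi01 x.
Qed.

Lemma unimodular (z : C) : exists2 u : C, nc u = 1 & u * z = (nc z)%:C.
Proof.
have [->|z0] := eqVneq z 0; first by exists 1; [exact: Normc.normc1 | rewrite mulr0 Normc.normc0].
have n0 : nc z != 0 by rewrite nc_eq0.
exists ((nc z)^-1%:C * z^*).
  by rewrite Normc.normcM ncJ nc_real ?invr_ge0 ?nc_ge0// mulVf.
by rewrite -mulrA (mulrC z^*) nc_sqr -rmorphM expr2 mulKf.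
Qed.

(** Take [g0] almost attaining the supremum and [g] vanishing on a ball that contains its support.
    With phases aligned, the moduli of [nu g0] and [nu g] add up to a value at an admissible
    function, so little is left for [g]. *)
Lemma ibd_tail nu h S : is_measure nu -> ibd nu h S -> forall e, 0 < e -> exists2 L, 0 <= L &
  forall g, Cc g -> (forall x, nc (g x) <= nc (h x)) -> (forall x, `|x| <= L -> g x = 0) -> nc (nu g) <= e.
Proof.
move=> mnu hS e e0.
pose E := [set s : R | exists g, [/\ Cc g, forall x, nc (g x) <= nc (h x) & s = nc (nu g)]].
have hE : has_sup E.
  split; last by exists S => _ [g [hg gh ->]]; exact: hS.
  exists (nc (nu (fun=> 0))), (fun=> 0); split => //; first by apply: (cc_Cc (L := 0)); exact: cc0.
  by move=> x; rewrite Normc.normc0 nc_ge0.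
have [s [g0 [hg0 gh0 ->]] hs] := sup_adherent e0 hE.
have /Cc_cc[L L0 [_ gL]] := hg0; exists L => // g hg gh gv.
have [u0 n0 e1] := unimodular (nu g0); have [u1 n1 e2] := unimodular (nu g).
have : nc (nu (fun x => u0 * g0 x + u1 * g x)) <= sup E.
  apply: sup_upper_bound => //; exists (fun x => u0 * g0 x + u1 * g x); split => //.
    by apply: CcD; exact: CcZ.
  move=> x; have [xL|xL] := leP `|x| L.
    by rewrite gv// mulr0 addr0 Normc.normcM n0 mul1r.
  by rewrite gL// mulr0 add0r Normc.normcM n1 mul1r.
rewrite (measD mnu); try exact: CcZ.
rewrite !(measZ mnu)// e1 e2 -rmorphD nc_real ?addr_ge0 ?nc_ge0//; lra.
Qed.

Lemma mintD nu h1 h2 (I1 I2 : C) : is_measure nu -> cts h1 -> cts h2 ->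
  mint nu h1 I1 -> mint nu h2 I2 -> mint nu (fun x => h1 x + h2 x) (I1 + I2).
Proof.
move=> mnu c1 c2 m1 m2 e e0; have e2 : 0 < e / 2 by rewrite divr_gt0.
have [K1 [cK1 h1K]] := m1 _ e2; have [K2 [cK2 h2K]] := m2 _ e2.
exists (K1 `|` K2); split; first exact: compactU.
move=> phi hphi p01 p1.
have k1 := h1K phi hphi p01 (fun x Kx => p1 x (or_introl Kx)).
have k2 := h2K phi hphi p01 (fun x Kx => p1 x (or_intror Kx)).
rewrite (_ : (fun x => _) = fun x => phi x * h1 x + phi x * h2 x); last first.
  by apply/funext => x; rewrite mulrDr.
rewrite (measD mnu); try exact: CcMr.
rewrite nc_lt; rewrite nc_lt in k1; rewrite nc_lt in k2.
rewrite opprD addrACA; have := ncD (nu (fun x => phi x * h1 x) - I1) (nu (fun x => phi x * h2 x) - I2).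
lra.
Qed.

Lemma mintZ nu h (c I : C) : is_measure nu -> cts h ->
  mint nu h I -> mint nu (fun x => c * h x) (c * I).
Proof.
move=> mnu ch m e e0; have c0 := nc_ge0 c.
have e1 : 0 < e / (nc c + 1) by rewrite divr_gt0//; lra.
have [K [cK hK]] := m _ e1; exists K; split => // phi hphi p01 p1.
have := hK phi hphi p01 p1; rewrite !nc_lt => k.
rewrite (_ : (fun x => _) = fun x => c * (phi x * h x)); last by apply/funext => x; rewrite mulrCA.
rewrite (measZ mnu); last exact: CcMr.
rewrite -mulrBr Normc.normcM.
have z0 := nc_ge0 (nu (fun x => phi x * h x) - I).
move: k; rewrite ltr_pdivlMr; last lra.
nra.
Qed.

Lemma nc_sub_le1 phi psi x : (forall x, 0 <= phi x <= 1) -> (forall x, 0 <= psi x <= 1) ->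
  nc (phi x - psi x) <= 1.
Proof.
move=> /(_ x) /andP[p0 p1] /(_ x) /andP[q0 q1].
have [E r0] := ge0_complex p0; have [E' r0'] := ge0_complex q0.
move: p1 q1; rewrite E E' -[1]/(1%:C) !lecR -rmorphB ncR ler_norml => h1 h2; apply/andP; split; lra.
Qed.

(** Makes the limit over cut-offs quantitative: a given cut-off differs from a much larger one by a
    function living outside the ball of radius [L], where the tail hypothesis applies. *)
Lemma mint_tail nu h (I : C) L b phi : is_measure nu -> cts h -> mint nu h I ->
  (forall g, Cc g -> (forall x, nc (g x) <= nc (h x)) -> (forall x, `|x| <= L -> g x = 0) -> nc (nu g) <= b) ->
  Cc phi -> (forall x, 0 <= phi x <= 1) -> (forall x, `|x| <= L -> phi x = 1) ->
  nc (nu (fun x => phi x * h x) - I) <= b.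
Proof.
move=> mnu ch m tail hphi p01 p1; apply/ler_addgt0Pr => e e0.
have [K [cK hK]] := m e e0; have [L' L'0 KL'] := compact_box cK.
pose L2 := Order.max L L'; pose psi := @plateau R d L2.
have hpsi : Cc psi by exact: Cc_plateau.
have := hK psi hpsi (plateau01 L2) (fun x Kx => plateau_in (le_trans (KL' x Kx) _)).
move=> /(_ ltac:(by rewrite le_max lexx orbT)); rewrite nc_lt => h1.
have h2 : nc (nu (fun x => phi x * h x) - nu (fun x => psi x * h x)) <= b.
  rewrite -(measB mnu); try exact: CcMr.
  apply: tail; first by apply: CcB; exact: CcMr.
    move=> x; rewrite -mulrBl Normc.normcM ler_piMl ?nc_ge0//.
    by apply: nc_sub_le1 => //; exact: plateau01.
  move=> x xL; rewrite p1// /psi plateau_in ?subrr//.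
  by apply: le_trans xL _; rewrite le_max lexx.
by have := nc_triangle (nu (fun x => psi x * h x)) (nu (fun x => phi x * h x)) I; lra.
Qed.

Lemma leb_norm_le L f g : 0 <= L -> cc L f -> cc L g -> (forall x, 0 <= g x) ->
  (forall x, nc (f x) <= complex.Re (g x)) -> nc (leb f) <= complex.Re (leb g).
Proof.
move=> L0 hf hg g0 fg; have [A A0 HA] := leb_riemann_fam d L0.
apply/ler_addgt0Pr => e e0; have e2 : 0 < e / 2 by rewrite divr_gt0.
pose F (j : bool) := if j then f else g.
have [[]|I [w [v [w0 wA Iv]]]] := HA _ F (e / 2) e2; rewrite /F//.
have h1 := Iv true; have := le_trans (nc_Re _) (Iv false); rewrite /= in h1 *.
rewrite ReD ReN ReM /= mul0r subr0 Re_sum ler_norml => /andP[h2 h3].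
have h4 : nc (w%:C * \sum_i f (v i)) <= w * \sum_i complex.Re (g (v i)).
  rewrite Normc.normcM nc_real// ler_wpM2l//; apply: le_trans (nc_sum _ _ _) _.
  by apply: ler_sum => i _; exact: fg.
have := ncD (leb f - w%:C * \sum_i f (v i)) (w%:C * \sum_i f (v i)); rewrite subrK; lra.
Qed.

Section Mollifier.
Variables (k : V -> C) (r : R).
Hypotheses (r0 : 0 <= r) (hk : cc r k) (k0 : forall x, 0 <= k x) (k1 : leb k = 1).

Lemma nc_density x : nc (k x) = complex.Re (k x).
Proof. by have [E h] := ge0_complex (k0 x); rewrite [in LHS]E nc_real. Qed.

Lemma nc_check_density y : nc (checkf k y) <= 1.
Proof.
have -> : 1 = complex.Re (leb k) by rewrite k1.
apply: (leb_norm_le r0) => //; first exact: cc_exp.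
by move=> x; rewrite Normc.normcM nc_expi mulr1 nc_density.
Qed.

Lemma check_density_near1 y : nc (checkf k y - 1) <= 4 * pi * (d%:R * (r * `|y|)).
Proof.
have pi0 := pi_ge0 R.
set c := 4 * pi * (d%:R * (r * `|y|)).
have c0 : 0 <= c by rewrite /c !mulr_ge0.
have hck : cc r (fun x => c%:C * k x) by exact: ccZ.
have -> : c = complex.Re (leb (fun x => c%:C * k x)).
  by rewrite (lebZ _ r0 hk) k1 mulr1.
rewrite -k1 /checkf -(lebB r0)//; last exact: cc_exp.
apply: (leb_norm_le r0) => //.
- by apply: ccB => //; exact: cc_exp.
- by move=> x; rewrite mulr_ge0// ler0c.
move=> x; rewrite ReM /= mul0r subr0 -nc_density.
have -> : k x * expi2pi (dotv x y) - k x = (expi2pi (dotv x y) - expi2pi 0) * k x by rewrite expi0; ring.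
rewrite Normc.normcM; have [xr|xr] := leP `|x| r; last by rewrite hk.2// Normc.normc0 !mulr0.
rewrite ler_wpM2r ?nc_ge0//; apply: le_trans (nc_expi_lip _ _) _.
rewrite subr0 /c ler_wpM2l ?mulr_ge0//; apply: le_trans (dotv_bound _ _) _.
by rewrite ler_wpM2l// ler_wpM2r.
Qed.

Lemma conv_near Lh h x e : cc Lh h -> (forall t, `|t| <= r -> nc (h (x - t) - h x) <= e) ->
  nc (Defs.conv h k x - h x) <= e.
Proof.
move=> hh he; have e0 : 0 <= e by apply: le_trans (he 0 _); rewrite ?nc_ge0 ?normr0.
have h1 : cc r (fun t => h (x - t) * k t) := cc2_r x (cc2_conv hh hk).
have hck : cc r (fun x => e%:C * k x) by exact: ccZ.
have -> : Defs.conv h k x - h x = leb (fun t => h (x - t) * k t - h x * k t).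
  by rewrite (lebB r0 h1 (ccZ (h x) hk)) (lebZ _ r0 hk) k1 mulr1.
have -> : e = complex.Re (leb (fun x => e%:C * k x)) by rewrite (lebZ _ r0 hk) k1 mulr1.
apply: (leb_norm_le r0) => //.
- by apply: ccB => //; exact: ccZ.
- by move=> t; rewrite mulr_ge0// ler0c.
move=> t; rewrite ReM /= mul0r subr0 -nc_density -mulrBl Normc.normcM.
have [tr|tr] := leP `|t| r; last by rewrite hk.2// Normc.normc0 !mulr0.
by rewrite ler_wpM2r ?nc_ge0// he.
Qed.
End Mollifier.

Lemma mollifier (r : R) : 0 < r -> exists k : V -> C, [/\ cc r k, forall x, 0 <= k x & leb k = 1].
Proof.
move=> r0; have b0 := leb_bump_gt0 d r0.
exists (fun x => (leb (@bump R d r))^-1 * bump r x); split.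
- by apply: ccZ; apply: cc_bump; exact: ltW.
- by move=> x; rewrite mulr_ge0 ?bump_ge0// invr_ge0 ltW.
- by rewrite (lebZ _ (ltW r0)) ?mulVf ?gt_eqF//; apply: cc_bump; exact: ltW.
Qed.
End Integrability.

(** * Translation boundedness and the inversion formula *)

Section UltraLimit.
Variable R : realType.
Local Notation C := R[i].
Local Notation nc := (@Normc.normc R).
Variable U : set_system nat.
Hypothesis uU : UltraFilter U.

(** With an ultrafilter every bounded sequence has a limit, and limits are compatible with the
    vector space operations; this is what turns limits of measures into a linear functional. *)
Definition ulim (u : nat -> C) (l : C) := forall e : R, 0 < e -> U [set n | nc (u n - l) < e].

Lemma ulimD u v a b : ulim u a -> ulim v b -> ulim (fun n => u n + v n) (a + b).
Proof.
move=> ua vb e e0; have e2 : 0 < e / 2 by rewrite divr_gt0.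
apply: filterS (filterI (ua _ e2) (vb _ e2)) => n [/= h1 h2].
have := ncD (u n - a) (v n - b); rewrite (_ : u n - a + (v n - b) = u n + v n - (a + b)); last by ring.
by lra.
Qed.

Lemma ulimZ c u a : ulim u a -> ulim (fun n => c * u n) (c * a).
Proof.
move=> ua e e0; have c0 := nc_ge0 c; have c1 : 0 < nc c + 1 by lra.
have e1 : 0 < e / (nc c + 1) by rewrite divr_gt0.
apply: filterS (ua _ e1) => n /=; rewrite -mulrBr Normc.normcM ltr_pdivlMr// => h.
by have := nc_ge0 (u n - a); nra.
Qed.

Lemma ulim_le u l (b : R) : (forall n, nc (u n) <= b) -> ulim u l -> nc l <= b.
Proof.
move=> ub ul; apply/ler_addgt0Pr => e e0; have [n /= h] := filter_ex (ul e e0).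
by have := ncD (l - u n) (u n); rewrite subrK ncBC; have := ub n; lra.
Qed.

Lemma ulim_unique u a b : ulim u a -> ulim u b -> a = b.
Proof.
move=> ua ub; apply/subr0_eq/nc_small => e e0; have e2 : 0 < e / 2 by rewrite divr_gt0.
have [n [/= h1 h2]] := filter_ex (filterI (ua _ e2) (ub _ e2)).
by have := nc_triangle (u n) a b; rewrite (ncBC a (u n)); lra.
Qed.

Lemma ulim_real (u : nat -> R) (b : R) : (forall n, `|u n| <= b) ->
  exists l : R, forall e, 0 < e -> U [set n | `|u n - l| < e].
Proof.
(* The limit is the supremum of the levels that the sequence exceeds on a set of [U]. The
   ultrafilter dichotomy is used once, to see that a level above the supremum is missed on a set of
   [U]. *)
move=> ub; pose E := [set r : R | U [set n | r <= u n]].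
have hE : has_sup E.
  split; first by exists (- b); apply: filterS filterT => n _; have := ub n; rewrite ler_norml => /andP[].
  exists b => r /filter_ex[n /= rn]; apply: le_trans rn _.
  by have := ub n; rewrite ler_norml => /andP[].
exists (sup E) => e e0; have [r Er hr] := sup_adherent e0 hE.
have [Us|Us] := in_ultra_setVsetC [set n | sup E + e / 2 <= u n] uU.
  by have := ub_le_sup hE.2 Us; lra.
apply: filterS (filterI Er Us) => n [/= h1 /negP]; rewrite -ltNge => h2.
by rewrite ltr_norml; apply/andP; split; lra.
Qed.

Lemma ulim_exists u (b : R) : (forall n, nc (u n) <= b) -> exists l, ulim u l.
Proof.
move=> ub.
have [a ha] := @ulim_real (fun n => complex.Re (u n)) b (fun n => le_trans (nc_Re _) (ub n)).
have [c hc] := @ulim_real (fun n => complex.Im (u n)) b (fun n => le_trans (nc_Im _) (ub n)).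
exists (a +i* c) => e e0; have e2 : 0 < e / 2 by rewrite divr_gt0.
apply: filterS (filterI (ha _ e2) (hc _ e2)) => n [/= h1 h2].
apply: le_lt_trans (nc_ReIm _) _; case: (u n) h1 h2 => p q /=; lra.
Qed.
End UltraLimit.

(** * Uniform boundedness for quadratic functionals *)

Section UniformBoundedness.
Variables (R : realType) (d : nat).
Local Notation C := R[i].
Local Notation V := 'rV[R]_d.
Local Notation nc := (@Normc.normc R).
Variable nu : (V -> C) -> C.
Hypothesis mnu : is_measure nu.
Hypothesis hint : forall g, Cc g -> exists S : R, ibd nu (fun y => `|checkf g y| ^+ 2) S.
Variable r : R.
Hypothesis r0 : 0 <= r.
Implicit Types (f g h phi x z : V -> C) (e : R).

Let T phi z : C := nu (fun y => phi y * `|checkf z y| ^+ 2).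

Lemma cts_sqnorm z : cc r z -> cts (fun y => `|checkf z y| ^+ 2).
Proof.
move=> hz; have h := cts_norm (cts_check r0 hz).
rewrite (_ : (fun y => _) = fun y => `|checkf z y| * `|checkf z y|); last first.
  by apply/funext => y; rewrite expr2.
exact: ctsM.
Qed.

Lemma quadratic_Cc phi z : Cc phi -> cc r z -> Cc (fun y => phi y * `|checkf z y| ^+ 2).
Proof. by move=> hphi /cts_sqnorm h; exact: CcMr. Qed.

Lemma quadratic_parallelogram phi x h : Cc phi -> cc r x -> cc r h ->
  T phi (fun v => x v + h v) + T phi (fun v => x v - h v) = 2%:R * T phi x + 2%:R * T phi h.
Proof.
move=> hphi hx hh; have hp := ccD hx hh; have hm := ccB hx hh.
rewrite /T -!(measZ mnu); try exact: quadratic_Cc.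
rewrite -!(measD mnu); try exact: quadratic_Cc; try (apply: CcZ; exact: quadratic_Cc).
congr nu; apply/funext => y; rewrite (checkD y r0 hx hh) (checkB y r0 hx hh).
rewrite !sqr_normc !rmorphD rmorphN /=; ring.
Qed.

Lemma quadratic_scale phi (c : R) h : Cc phi -> cc r h ->
  T phi (fun v => c%:C * h v) = (c ^+ 2)%:C * T phi h.
Proof.
move=> hphi hh; rewrite /T -(measZ mnu); last exact: quadratic_Cc.
congr nu; apply/funext => y; rewrite (checkZ _ y r0 hh) !normrM exprMn.
rewrite [`|c%:C|]normc_normE ncR -rmorphXn real_normK ?num_real//; ring.
Qed.

Lemma quadratic_cont phi x : Cc phi -> cc r x -> forall e, 0 < e -> exists2 del : R, 0 < del &
  forall z, cc r z -> (forall v, nc (z v - x v) <= del) -> nc (T phi z - T phi x) <= e.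
Proof.
move=> hphi hx e e0; have /Cc_cc[L L0 hL] := hphi.
have [b b0 hb] := cc_bounded hL; have [bx bx0 hbx] := cc_bounded hx.
have [A A0 HA] := check_bound d r0; have [M M0 hM] := meas_bound mnu L.
pose Q := M * (b * (A * (A * (2 * bx + 1)))).
have Q0 : 0 <= Q by rewrite /Q !mulr_ge0//; lra.
pose del : R := Order.min 1 (e / (Q + 1)).
have d0 : 0 < del by rewrite lt_min ltr01 divr_gt0//; lra.
have d1 : del <= 1 by rewrite ge_min lexx.
have dQ : Q * del <= e.
  have : del <= e / (Q + 1) by rewrite ge_min lexx orbT.
  rewrite ler_pdivlMr; last lra.
  by move=> h; nra.
exists del => // z hz hzx; rewrite /T -(measB mnu); try exact: quadratic_Cc.
apply: le_trans dQ; rewrite -!mulrA (mulrC _ del); apply: hM.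
  apply: ccB; apply: ccMr => //; exact: cts_sqnorm.
move=> y; rewrite -mulrBr Normc.normcM ler_pM ?nc_ge0//.
have h1 : nc (checkf z y - checkf x y) <= A * del.
  rewrite -(checkB y r0 hz hx); apply: HA => //; exact: ccB.
have h2 : nc (checkf x y) <= A * bx by apply: HA.
have h3 : nc (checkf z y) <= A * (bx + del).
  apply: HA => // v; have := ncD (z v - x v) (x v); rewrite subrK.
  by have := hzx v; have := hbx v; lra.
rewrite !normc_normE -!rmorphXn -rmorphB ncR subr_sqr normrM.
have h4 := nc_distD (checkf z y) (checkf x y).
apply: (@le_trans _ _ ((A * del) * (A * (2 * bx + 1)))).
  apply: ler_pM => //; first exact: le_trans h4 h1.
  rewrite ger0_norm ?addr_ge0 ?nc_ge0//; nra.
by rewrite le_eqVlt; apply/orP; left; apply/eqP; ring.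
Qed.

Lemma nested_limit (a : nat -> C) (del : nat -> R) :
  (forall n m, (n <= m)%N -> nc (a m - a n) <= del n) -> exists l, forall n, nc (l - a n) <= 2 * del n.
Proof.
move=> h; have [U [uU hU]] := @ultraFilterLemma nat \oo _.
have [|l hl] := @ulim_exists R U uU a (nc (a 0%N) + del 0%N).
  by move=> n; have := ncD (a n - a 0%N) (a 0%N); rewrite subrK; have := h 0%N n (leq0n n); lra.
exists l => n; have dn : 0 <= del n := le_trans (nc_ge0 _) (h n n (leqnn n)).
apply/ler_addgt0Pr => e e0.
have hge : U [set m | (n <= m)%N] by apply: hU; exists n.
have [m [/= h1 h2]] := filter_ex (filterI (hl e e0) hge).
by have := nc_triangle (a m) l (a n); have := h n m h2; rewrite (ncBC l (a m)); lra.
Qed.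

(* Sokal's argument for the uniform boundedness principle: since T is quadratic, the
   parallelogram law plays the role of linearity when a small vector is added. *)
Lemma uniform_bound (I : Type) (G : I -> V -> C) (b0 : R) : (forall i, cc r (G i)) ->
  (forall i v, nc (G i v) <= b0) ->
  exists S : R, forall i phi, Cc phi -> (forall y, nc (phi y) <= 1) -> nc (T phi (G i)) <= S.
Proof.
move=> hG hb; apply: contrapT => hn.
have big (S : R) : exists i phi, [/\ Cc phi, forall y, nc (phi y) <= 1 & S < nc (T phi (G i))].
  apply: contrapT => h; apply: hn; exists S => i phi h1 h2; rewrite leNgt; apply/negP => h3.
  by apply: h; exists i, phi.
(* A state is a ball in sup norm, given by centre and radius. Each step moves the centre by at most
   half the radius and halves it, and [T] becomes large on the doubled new ball, which is the one in
   which [nested_limit] locates the limit. *)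
pose st := {p : (V -> C) * R | cc r p.1 /\ 0 < p.2}.
have step (p : nat * st) : exists q : st, [/\ (sval q).2 <= (sval p.2).2 / 2,
    forall v, nc ((sval q).1 v - (sval p.2).1 v) <= (sval p.2).2 / 2 &
    exists phi, [/\ Cc phi, forall y, nc (phi y) <= 1 & forall z, cc r z ->
      (forall v, nc (z v - (sval q).1 v) <= 2 * (sval q).2) -> p.1%:R <= nc (T phi z)]].
  move: p => [n [[x del] /= [hx d0]]].
  (* Scales [G i] down to sup norm at most [del / 2]. As [T] is homogeneous of degree 2, the
     threshold divided by [c ^+ 2] still leaves more than [2 * (n + 1)] after scaling. *)
  pose c : R := (del / 2) / (`|b0| + 1).
  have b1 : 0 < `|b0| + 1 by have := normr_ge0 b0; lra.
  have c0 : 0 < c by rewrite divr_gt0// divr_gt0.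
  have [i [phi [hphi phi1 hT]]] := big (2 * (n%:R + 1) / c ^+ 2).
  have hci : cc r (fun v => c%:C * G i v) by exact: ccZ.
  have hc v : nc (c%:C * G i v) <= del / 2.
    rewrite Normc.normcM (nc_real (ltW c0)).
    have -> : del / 2 = c * (`|b0| + 1) by rewrite /c divfK// gt_eqF.
    by rewrite ler_pM2l//; have := hb i v; have := ler_norm b0; lra.
  have {}hT : 2 * (n%:R + 1) < nc (T phi (fun v => c%:C * G i v)).
    rewrite quadratic_scale// Normc.normcM nc_real ?sqr_ge0// [X in _ < X]mulrC.
    by move: hT; rewrite ltr_pdivrMr ?exprn_gt0.
  (* If [T phi] were below [n + 1] in modulus at [x] and at both [x + c G] and [x - c G], the
     parallelogram law would make twice its value at [c G] smaller than [4 * (n + 1)], against the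
     choice of [i]. *)
  have [x' [hx' xx' hTx']] : exists x', [/\ cc r x', forall v, nc (x' v - x v) <= del / 2 &
      n%:R + 1 <= nc (T phi x')].
    have [h1|h1] := leP (n%:R + 1) (nc (T phi x)).
      by exists x; split => // v; rewrite subrr Normc.normc0 divr_ge0// ltW.
    have [h2|h2] := leP (n%:R + 1) (nc (T phi (fun v => x v + c%:C * G i v))).
      by exists (fun v => x v + c%:C * G i v); split => //; [exact: ccD | move=> v; rewrite addrAC subrr add0r].
    exists (fun v => x v - c%:C * G i v); split => //; first exact: ccB.
      by move=> v; rewrite addrAC subrr add0r ncN.
    have := quadratic_parallelogram hphi hx hci; move: hT h1 h2.
    move: (T phi x) (T phi (fun v => x v + c%:C * G i v)) (T phi (fun v => c%:C * G i v))
      (T phi (fun v => x v - c%:C * G i v)) => p q s t h1 h2 h3 e.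
    have : nc (2%:R * s) <= nc q + nc t + nc (2%:R * p).
      have -> : 2%:R * s = q + t + (- (2%:R * p)) by rewrite e; ring.
      apply: le_trans (ncD _ _) _; rewrite ncN; apply: lerD => //; exact: ncD.
    have n2 : nc (2%:R : C) = 2 by rewrite -(rmorph_nat (real_complex R)) nc_real.
    rewrite !Normc.normcM n2; have := ler0n R n; lra.
  (* Within [d1] of [x'] the value moves by at most 1, hence stays above [n]; halving [d1] makes
     room for the doubled ball. *)
  have [d1 d10 hd1] := quadratic_cont hphi hx' ltr01.
  have q0 : 0 < Order.min (del / 2) (d1 / 2) by rewrite lt_min !divr_gt0.
  exists (exist _ (x', Order.min (del / 2) (d1 / 2)) (conj hx' q0)); split => //=.
    by rewrite ge_min lexx.
  exists phi; split => // z hz hzx.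
  have := hd1 z hz; have h v : nc (z v - x' v) <= d1.
    apply: le_trans (hzx v) _.
    have : Order.min (del / 2) (d1 / 2) <= d1 / 2 by rewrite ge_min lexx orbT.
    lra.
  move=> /(_ h) h1; have := nc_distD (T phi z) (T phi x').
  rewrite ler_norml => /andP[h2 h3]; lra.
have [F hF] := choice step.
have s0 : st by exists ((fun=> 0), 1); split; [exact: cc0 | exact: ltr01].
pose s := fix s n : st := if n is m.+1 then F (m, s m) else s0.
pose X n := (sval (s n)).1; pose D n := (sval (s n)).2.
have hX n : cc r (X n) by exact: (svalP (s n)).1.
have D0 n : 0 < D n by exact: (svalP (s n)).2.
have DS n : D n.+1 <= D n / 2 by have [] := hF (n, s n).
have XS n v : nc (X n.+1 v - X n v) <= D n / 2 by have [_ h _] := hF (n, s n); exact: h.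
have Dsmall e : 0 < e -> exists n, D n < e.
  move=> e0.
  have Dn n : D n * 2 ^+ n <= D 0%N.
    elim: n => [|n IH]; first by rewrite mulr1.
    apply: le_trans IH; rewrite exprS mulrA ler_pM2r ?exprn_gt0//; have := DS n; lra.
  pose N := Num.bound (D 0%N / e); exists N.
  have h1 : D 0%N / e < N%:R by apply: archi_boundP; rewrite divr_ge0// ltW.
  have h2 : (N%:R : R) < 2 ^+ N by rewrite -natrX ltr_nat ltn_expl.
  rewrite -(ltr_pM2r (_ : 0 < 2 ^+ N :> R)) ?exprn_gt0//; apply: le_lt_trans (Dn N) _.
  rewrite ltr_pdivrMr// in h1; apply: lt_trans h1 _.
  by rewrite mulrC ltr_pM2l.
have Xm v n m : (n <= m)%N -> nc (X m v - X n v) <= D n.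
  move=> nm; suff : nc (X m v - X n v) <= D n - D m by have := D0 m; lra.
  elim: m nm => [|m IH]; first by rewrite leqn0 => /eqP ->; rewrite !subrr Normc.normc0.
  rewrite leq_eqVlt => /orP[/eqP ->|/IH h]; first by rewrite !subrr Normc.normc0.
  have := nc_triangle (X m v) (X m.+1 v) (X n v); have := XS m v; have := DS m; lra.
have [x hx] := choice (fun v => nested_limit (Xm v)).
have ccx : cc r x.
  split.
    apply: cts_unif => e e0; have e6 : 0 < e / 6 by rewrite divr_gt0.
    have [n hn'] := Dsmall _ e6; have e3 : 0 < e / 3 by rewrite divr_gt0.
    have [del d0 hd] := cc_unif (hX n) e3; exists del => // u v /hd uv.
    have := nc_triangle (X n u) (x u) (x v); have := nc_triangle (X n v) (X n u) (x v).
    have := hx u n; have := hx v n; rewrite (ncBC (x v)); lra.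
  move=> v rv; apply: nc_small => e e0; have e2 : 0 < e / 2 by rewrite divr_gt0.
  have [n hn'] := Dsmall _ e2; have := hx v n; rewrite (hX n).2// subr0; lra.
(* The limit lies in all the doubled balls, so the one bound available at [x] would dominate every
   natural number. *)
have [S hS] := hint (cc_Cc ccx).
have k n : n%:R <= S.
  have [_ _ [phi [hphi phi1 /(_ x ccx) h]]] := hF (n, s n).
  apply: le_trans (h _) _; first by move=> v; exact: (hx v n.+1).
  apply: hS; first exact: quadratic_Cc.
  by move=> y; rewrite Normc.normcM ler_piMl ?nc_ge0.
have := k (Num.bound S); rewrite leNgt archi_boundP//.
by apply: le_trans (k 0%N).
Qed.
End UniformBoundedness.

(** * The defining identity beyond squares *)

Section TransformIdentity.
Variables (R : realType) (d : nat).
Local Notation C := R[i].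
Local Notation V := 'rV[R]_d.
Local Notation nc := (@Normc.normc R).
Local Notation e2 := (@expi2pi R).
Local Notation cv := (@Defs.conv R d).
Implicit Types (f g h k phi : V -> C) (e L M S : R) (mu nu : (V -> C) -> C).

Lemma small_factor M e (c : R) : 0 <= M -> 0 < e -> 0 < c -> M * (e / (c * (M + 1))) <= e / c.
Proof.
move=> M0 e0 c0; have M1 : 0 < M + 1 by lra.
have -> : e / c = (M + 1) * (e / (c * (M + 1))) by field; rewrite !gt_eqF.
by rewrite ler_wpM2r ?divr_ge0 ?mulr_ge0 ?ltW//; lra.
Qed.

(** Modulating a mollifier translates its transform without changing its sup norm or support. The
    uniform bound therefore controls the mass of [nu] near [t] uniformly in [t], as soon as the
    transform of the mollifier is bounded below on the unit ball. *)
Lemma tb_of_integrable nu : is_measure nu ->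
  (forall g, Cc g -> exists S : R, ibd nu (fun y => `|checkf g y| ^+ 2) S) ->
  exists2 M, 0 <= M & translation_bounded nu M.
Proof.
move=> mnu hint.
have pi0 := pi_ge0 R; have d0 := ler0n R d.
(* Makes [4 * pi * d * r <= 1 / 2], so on the unit ball the transform of [k] is within 1/2 of 1; the
   added 1 covers [d = 0]. *)
pose r : R := (8 * pi * d%:R + 1)^-1.
have q0 : 0 < 8 * pi * (d%:R : R) + 1 by have : 0 <= 8 * pi * (d%:R : R) by [rewrite mulr_ge0 ?mulr_ge0]; lra.
have r0 : 0 < r by rewrite invr_gt0.
have hr : 8 * pi * d%:R * r <= 1 by rewrite /r ler_pdivrMr// mul1r; lra.
have [k [hk k0 k1]] := mollifier d r0.
have near y : `|y| <= 1 -> 1 / 2 <= nc (checkf k y).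
  move=> y1; have := check_density_near1 (ltW r0) hk k0 k1 y.
  have : 4 * pi * (d%:R * (r * `|y|)) <= 1 / 2.
    have : 4 * pi * (d%:R * (r * `|y|)) <= 4 * pi * (d%:R * (r * 1)).
      by rewrite ler_wpM2l ?mulr_ge0// ler_wpM2l// ler_pM2l.
    lra.
  by have := ncD (1 - checkf k y) (checkf k y); rewrite subrK Normc.normc1 ncBC; lra.
have [b b0 hb] := cc_bounded hk.
have hb' (t x : V) : nc (k x * e2 (dotv x t)) <= b by rewrite Normc.normcM nc_expi mulr1.
have [S hS] := uniform_bound mnu hint (ltW r0) (fun t => cc_exp t hk) hb'.
pose S' := Order.max 0 S.
have S'0 : 0 <= S' by rewrite le_max lexx.
have SS' : S <= S' by rewrite le_max lexx orbT.
exists (4 * S'); first by rewrite mulr_ge0.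
apply: (tb_of_pos mnu) => t g bg bp hg gt gb.
pose q (y : V) : R := nc (checkf k (y - t)) ^+ 2.
(* Dividing [g] by the squared modulus of the translated transform must give a continuous function
   everywhere. The cut at 1/4 ensures it and changes nothing on the support of [g]. *)
pose m (y : V) : R := Order.max (q y) (1 / 4).
have m4 y : 1 / 4 <= m y by rewrite le_max lexx orbT.
have mp y : 0 < m y by apply: lt_le_trans (m4 y); lra.
have cq : continuous (q : V -> R).
  have h : cts (fun y : V => checkf k (y - t)).
    apply: (cts_comp (h := fun y : V => y - t) (f := checkf k)); first exact: continuous_addl.
    exact: cts_check (ltW r0) hk.
  exact: continuous_nc_sqr.
have cm : continuous (m : V -> R) by exact: continuous_max_cst.
have cmi : cts (fun y : V => ((4 * bg)^-1 * (m y)^-1)%:C).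
  by apply: cts_real; apply: continuous_scale_inv => // y; rewrite gt_eqF.
pose phi y := ((4 * bg)^-1 * (m y)^-1)%:C * g y.
have hphi : Cc phi by exact: CcMl.
have b4 : 0 < 4 * bg by lra.
have phi1 y : nc (phi y) <= 1.
  rewrite Normc.normcM nc_real; last by rewrite mulr_ge0// invr_ge0 ltW.
  rewrite -invfM mulrC ler_pdivrMr ?mulr_gt0// mul1r; apply: le_trans (gb y) _.
  by have := m4 y; nra.
have := hS (- t) phi hphi phi1.
rewrite (_ : (fun y => _) = fun y => (4 * bg)^-1%:C * g y); last first.
  apply/funext => y; rewrite check_mod normc_normE -rmorphXn -/(q y) /phi mulrAC -rmorphM.
  have [yt|yt] := leP `|y - t| 1; last by rewrite gt// !mulr0.
  rewrite (_ : m y = q y) -?mulrA ?mulVf ?mulr1//.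
    have h := near _ yt; rewrite gt_eqF// exprn_gt0//; lra.
  by rewrite /m max_l// /q; have h := near _ yt; rewrite expr2; nra.
have -> : nc (nu (fun y => (4 * bg)^-1%:C * g y)) = nc (nu g) / (4 * bg).
  by rewrite (measZ mnu)// Normc.normcM nc_real ?invr_ge0 ?(ltW b4)// mulrC.
rewrite ler_pdivrMr//.
by move=> h; apply: le_trans h _; rewrite mulrA (mulrC 4) -mulrA; nra.
Qed.

Lemma polarization mu nu : is_measure mu -> is_measure nu ->
  (forall f, Cc f -> mint nu (fun y => `|checkf f y| ^+ 2) (mu (cv f (tilde f)))) ->
  forall L f g, 0 <= L -> cc L f -> cc L g ->
    mint nu (fun y => checkf f y * (checkf g y)^*) (mu (cv f (tilde g))).
Proof.
move=> mmu mnu H L f g L0 hf hg.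
pose F (c : C) x := f x + c * g x.
have hF c : cc L (F c) by apply: ccD => //; exact: ccZ.
have Cv u v : cc L u -> cc L v -> Cc (cv u (tilde v)).
  by move=> hu hv; apply: (cc_Cc (L := L + L)); apply: cc_conv => //; exact: cc_tilde.
have ht (u : V -> C) : cc L u -> cc L (tilde u) by exact: cc_tilde.
have tF c : tilde (F c) = fun x => tilde f x + c^* * tilde g x.
  by apply/funext => x; rewrite /tilde /F cjD cjM.
have muF c : mu (cv (F c) (tilde (F c))) = mu (cv f (tilde f)) + c^* * mu (cv f (tilde g))
    + (c * mu (cv g (tilde f)) + c * (c^* * mu (cv g (tilde g)))).
  rewrite -!(measZ mmu); try exact: Cv; try (apply: CcZ; exact: Cv).
  rewrite -!(measD mmu); try exact: Cv; try (apply: CcZ; exact: Cv); try (apply: CcZ; apply: CcZ; exact: Cv).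
  - congr mu; apply/funext => x.
    rewrite (convDl x L0 hf (ccZ c hg) (ht _ (hF c))) (convZl c x L0 hg (ht _ (hF c))) tF.
    rewrite (convDr x L0 hf (ht _ hf) (ccZ c^* (ht _ hg))) (convDr x L0 hg (ht _ hf) (ccZ c^* (ht _ hg))).
    by rewrite (convZr c^* x L0 hf (ht _ hg)) (convZr c^* x L0 hg (ht _ hg)) mulrDr.
  - exact: (CcD (Cv f f hf hf) (CcZ c^* (Cv f g hf hg))).
  - exact: (CcD (CcZ c (Cv g f hg hf)) (CcZ c (CcZ c^* (Cv g g hg hg)))).
have cS c : cts (fun y => `|checkf (F c) y| ^+ 2) by exact: (cts_sqnorm L0 (hF c)).
have m4 (c1 c2 c3 c4 : C) : mint nu (fun y => c1 * `|checkf (F 1) y| ^+ 2 + c2 * `|checkf (F (-1)) y| ^+ 2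
   + (c3 * `|checkf (F 'i) y| ^+ 2 + c4 * `|checkf (F (- 'i)) y| ^+ 2))
   (c1 * mu (cv (F 1) (tilde (F 1))) + c2 * mu (cv (F (-1)) (tilde (F (-1))))
   + (c3 * mu (cv (F 'i) (tilde (F 'i))) + c4 * mu (cv (F (- 'i)) (tilde (F (- 'i)))))).
  have hz c a := mintZ a mnu (cS c) (H _ (cc_Cc (hF c))).
  have ca c a : cts (fun y => a * `|checkf (F c) y| ^+ 2) by exact: ctsZ.
  by apply: (mintD mnu); [exact: ctsD|exact: ctsD|apply: (mintD mnu)|apply: (mintD mnu)];
    try exact: ca; exact: hz.
(* The usual polarization: the weight of the square at [f + c * g] is [c / 4], for the four fourth
   roots of unity [c]. *)
have := m4 (1/4) (-(1/4)) ('i/4) (-('i/4)).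
rewrite (_ : (fun y => _) = fun y => checkf f y * (checkf g y)^*); last first.
  apply/funext => y; rewrite !sqr_normc /F !(checkD y L0 hf (ccZ _ hg)) !(checkZ _ y L0 hg).
  move: (checkf f y) (checkf g y) => [a1 a2] [b1 b2].
  by apply: complex_eq; rewrite /=; field.
rewrite !muF.
move: (mu (cv f (tilde f))) (mu (cv f (tilde g))) (mu (cv g (tilde f))) (mu (cv g (tilde g))) => [a1 a2] [b1 b2] [c1 c2] [d1 d2].
set z := (X in mint _ _ X -> _); rewrite (_ : z = b1 +i* b2) => //.
by apply: complex_eq; rewrite /z /=; field.
Qed.

Lemma mollifier_tilde r k : 0 <= r -> cc r k -> (forall x, 0 <= k x) -> leb k = 1 ->
  [/\ cc r (tilde k), forall x, 0 <= tilde k x & leb (tilde k) = 1].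
Proof.
move=> r0 hk k0 k1; have e : tilde k = fun x => k (- x).
  by apply/funext => x; rewrite /tilde (ge0_complex (k0 (- x))).1 conjc_real.
split; first exact: cc_tilde.
  by move=> x; rewrite e.
by rewrite e (leb_opp r0 hk).
Qed.

(** The form [h * k * tilde k] is dictated by the polarized identity, applied to the pair [h * k]
    and [k]. The second mollification acts on [h * k], which is only within [e / 4] of [h] at each
    of two points, hence [3 * (e / 4)]. *)
Lemma conv_mollify Lh h : 0 <= Lh -> cc Lh h -> forall e, 0 < e -> exists2 del : R, 0 < del &
  forall r k, 0 <= r -> r < del -> cc r k -> (forall x, 0 <= k x) -> leb k = 1 ->
    forall x, nc (cv (cv h k) (tilde k) x - h x) <= e.
Proof.
move=> Lh0 hh e e0; have e4 : 0 < e / 4 by rewrite divr_gt0.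
have [del d0 hd] := cc_unif hh e4; exists del => // r k r0 rd hk k0 k1 x.
have h1 y : nc (cv h k y - h y) <= e / 4.
  apply: (conv_near r0 hk k0 k1 hh) => t tr; apply/ltW/hd.
  by rewrite addrAC subrr add0r normrN; exact: le_lt_trans tr rd.
have [ht t0 t1] := mollifier_tilde r0 hk k0 k1.
have h2 : nc (cv (cv h k) (tilde k) x - cv h k x) <= 3 * (e / 4).
  apply: (conv_near r0 ht t0 t1 (cc_conv hh hk)) => t tr.
  have := nc_triangle (h (x - t)) (cv h k (x - t)) (cv h k x).
  have := nc_triangle (h x) (h (x - t)) (cv h k x).
  have := h1 x; have := h1 (x - t); rewrite (ncBC (h x)).
  have : nc (h (x - t) - h x) < e / 4.
    by apply: hd; rewrite addrAC subrr add0r normrN; exact: le_lt_trans tr rd.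
  lra.
by have := nc_triangle (cv h k x) (cv (cv h k) (tilde k) x) (h x); have := h1 x; lra.
Qed.

(** Polarization gives the identity for [h * k * tilde k], whose transform is that of [h] times the
    squared modulus of check k. As [k] shrinks this factor tends to 1 on the cut-off ball; outside,
    its being at most 1 lets the tail bound for [h] serve both sides. *)
Lemma transform_identity mu nu M S Lh h : is_measure mu -> is_measure nu ->
  (forall f, Cc f -> mint nu (fun y => `|checkf f y| ^+ 2) (mu (cv f (tilde f)))) ->
  0 <= M -> translation_bounded nu M -> 0 <= Lh -> cc Lh h -> amalgam (checkf h) S ->
  mint nu (checkf h) (mu h).
Proof.
move=> mmu mnu H M0 tb Lh0 hh am e e0.
have pi0 := pi_ge0 R; have dd := ler0n R d.
have e1 : 0 < e / (4 * (M + 1)) by rewrite divr_gt0// mulr_gt0//; lra.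
have [L0 L00 tail] := tb_amalgam_tail am e1.
have {}tail g : Cc g -> (forall x, nc (g x) <= nc (checkf h x)) -> (forall x, `|x| <= L0 -> g x = 0) ->
    nc (nu g) <= e / 4.
  by move=> hg gh g0; apply: le_trans (tail nu M g mnu tb M0 hg gh g0) _; exact: small_factor.
have ch : cts (checkf h) := cts_check Lh0 hh.
exists [set x : V | `|x| <= L0]; split; first exact: box_compact.
move=> phi hphi p01 p1; rewrite nc_lt.
pose phi0 := @plateau R d L0.
have hphi0 : Cc phi0 by exact: Cc_plateau.
have s1 : nc (nu (fun x => phi x * checkf h x) - nu (fun x => phi0 x * checkf h x)) <= e / 4.
  rewrite -(measB mnu); try exact: CcMr.
  apply: tail; first by apply: CcB; exact: CcMr.
    move=> x; rewrite -mulrBl Normc.normcM ler_piMl ?nc_ge0//.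
    by apply: nc_sub_le1 => //; exact: plateau01.
  by move=> x xL; rewrite p1// /phi0 plateau_in// subrr.
have [bh bh0 hbh] := cts_bounded (@box_compact R d (L0 + 1)) ch.
have [Mn Mn0 hMn] := meas_bound mnu (L0 + 1).
have [Mm Mm0 hMm] := meas_bound mmu (Lh + 2).
have e8 : 0 < e / (8 * (Mm + 1)) by rewrite divr_gt0// mulr_gt0//; lra.
have [del d0 hd] := conv_mollify Lh0 hh e8.
(* [Q * r] is the cost of putting the factor in on the cut-off region: [1 - |z|^2] is at most
   [2 |z - 1|] when [|z| <= 1], and [check_density_near1] bounds [|z - 1|] linearly in [r]. *)
pose Q := Mn * (bh * (2 * (4 * pi * (d%:R * (L0 + 1))))).
have Q0 : 0 <= Q by rewrite /Q !mulr_ge0// addr_ge0.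
pose r : R := Order.min 1 (Order.min (del / 2) (e / (8 * (Q + 1)))).
have r0 : 0 < r by rewrite !lt_min ltr01 !divr_gt0// mulr_gt0//; lra.
have r1 : r <= 1 by rewrite ge_min lexx.
have rd : r < del.
  have : r <= del / 2 by rewrite !ge_min lexx !orbT.
  lra.
have rQ : Q * r <= e / 8.
  have : r <= e / (8 * (Q + 1)) by rewrite !ge_min lexx !orbT.
  by rewrite ler_pdivlMr; [nra | lra].
have [k [hk k0 k1]] := mollifier d r0.
have hkk := hd r k (ltW r0) rd hk k0 k1.
have hck : cts (fun x => checkf k x * (checkf k x)^*).
  have h1 := cts_check (ltW r0) hk.
  by apply: ctsM => //; exact: ctsJ.
have nck := nc_check_density (ltW r0) hk k0 k1.
pose hk2 x := checkf h x * (checkf k x * (checkf k x)^*).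
have chk2 : cts hk2 by exact: ctsM.
have nhk2 x : nc (hk2 x) <= nc (checkf h x).
  by rewrite /hk2 !Normc.normcM ncJ ler_piMr ?nc_ge0// mulr_ile1 ?nc_ge0.
have s2 : nc (nu (fun x => phi0 x * checkf h x) - nu (fun x => phi0 x * hk2 x)) <= e / 8.
  rewrite -(measB mnu); try exact: CcMr.
  apply: le_trans rQ; rewrite /Q -mulrA; apply: hMn.
    by apply: ccB; apply: ccMr => //; exact: cc_plateau.
  move=> x; rewrite /hk2 -mulrBr -[X in X - _]mulr1 -mulrBr !Normc.normcM.
  have [xL|xL] := leP `|x| (L0 + 1); last first.
    rewrite /phi0 (cc_plateau d L0).2// Normc.normc0 mul0r.
    by rewrite !mulr_ge0// ?ltW//; lra.
  apply: (@le_trans _ _ (1 * (bh * (2 * (4 * pi * (d%:R * (r * (L0 + 1)))))))); last first.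
    by rewrite mul1r le_eqVlt; apply/orP; left; apply/eqP; ring.
  apply: ler_pM; rewrite ?mulr_ge0 ?nc_ge0 ?nc_plateau//.
  apply: ler_pM; rewrite ?nc_ge0 ?hbh//.
  have h1 : nc (checkf k x - 1) <= 4 * pi * (d%:R * (r * (L0 + 1))).
    apply: le_trans (check_density_near1 (ltW r0) hk k0 k1 x) _.
    by rewrite ler_wpM2l ?mulr_ge0// ler_wpM2l// ler_pM2l.
  have -> : 1 - checkf k x * (checkf k x)^* = - (checkf k x - 1) - checkf k x * (checkf k x - 1)^*.
    by rewrite rmorphB rmorph1; ring.
  apply: le_trans (ncD _ _) _; rewrite !ncN Normc.normcM ncJ.
  by have := nck x; have := nc_ge0 (checkf k x - 1); nra.
have hLk : cc (Lh + 2) (cv h k) by apply: ccW (cc_conv hh hk); lra.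
have hk' : cc (Lh + 2) k by apply: ccW hk; lra.
have L20 : 0 <= Lh + 2 by lra.
have := polarization mmu mnu H L20 hLk hk'.
rewrite (_ : (fun y => _) = hk2); last first.
  by apply/funext => y; rewrite (check_conv y Lh0 (ltW r0) hh hk) /hk2 mulrA.
move=> m; have s3 : nc (nu (fun x => phi0 x * hk2 x) - mu (cv (cv h k) (tilde k))) <= e / 4.
  apply: (mint_tail (L := L0) mnu chk2 m _ hphi0 (plateau01 L0) (@plateau_in R d L0)) => g hg gh.
  by apply: tail => // x; exact: le_trans (gh x) (nhk2 x).
have s5 : nc (mu (cv (cv h k) (tilde k)) - mu h) <= e / 8.
  have hc : cc (Lh + 2) (cv (cv h k) (tilde k)).
    by apply: ccW (cc_conv (cc_conv hh hk) (cc_tilde hk)); lra.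
  have hh' : cc (Lh + 2) h by apply: ccW hh; lra.
  rewrite -(measB mmu); [|exact: cc_Cc hc|exact: cc_Cc hh'].
  by apply: le_trans (hMm _ _ (ccB hc hh') hkk) _; exact: small_factor.
set a0 := nu _ in s1 *; set a1 := nu _ in s1 s2; set a2 := nu _ in s2 s3.
set a4 := mu _ in s3 s5; set a5 := mu _ in s5 *.
by have := nc_triangle a1 a0 a5; have := nc_triangle a2 a1 a5; have := nc_triangle a4 a2 a5; lra.
Qed.
End TransformIdentity.

(** * Transforms of test functions *)

Section TestFunctions.
Variables (R : realType) (d : nat).
Local Notation C := R[i].
Local Notation V := 'rV[R]_d.
Local Notation nc := (@Normc.normc R).
Local Notation e2 := (@expi2pi R).
Local Notation dir j := (delta_mx 0 j : 'rV[R]_d).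
Implicit Types (u w D : V -> R) (x y : V) (L : R) (j : 'I_d).

Lemma derivable_line u x v (t : R) : derivable u (x + t *: v) v ->
  is_derive t (1:R) (fun s : R => u (x + s *: v)) ('D_v u (x + t *: v)).
Proof.
move=> h.
have e : (fun h : R => h^-1 *: (((fun s : R => u (x + s *: v)) \o shift t) (h *: (1:R)) - u (x + t *: v))) =
   (fun h : R => h^-1 *: ((u \o shift (x + t *: v)) (h *: v) - u (x + t *: v))).
  apply/funext => s /=; congr (_ *: (u _ - _)).
  by rewrite [s *: 1]mulr1 scalerDl addrCA.
split; first by rewrite /derivable e.
by rewrite /derive e.
Qed.

Lemma dotv_dir y j (t : R) : dotv (t *: dir j) y = t * y ord0 j.
Proof.
rewrite /dotv (bigD1 j)//= big1 ?addr0; last first.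
  by move=> i ij; rewrite !mxE eqxx (negbTE ij) mulr0 mul0r.
by rewrite !mxE !eqxx mulr1.
Qed.

Lemma norm_dir j : `|dir j| <= 1.
Proof.
apply: rV_norm_le => // i; rewrite mxE eqxx /=.
by case: (i == j); rewrite ?normr1 ?normr0.
Qed.

(** Mean value theorem for the sine, at a point where the cosine exceeds 1/2; together with
    [pi >= 2] the slope is then at least 1. *)
Lemma nc_expi_lower : exists2 del : R, 0 < del & forall (t : R), `|t| < del -> `|t| <= nc (e2 t - 1).
Proof.
have pi2 : 2 <= pi :> R := pi_ge2 R.
have /cvgrPdist_lt/(_ (1 / 2) ltac:(lra))/nbhs_ballP[r /= r0 hr] := @continuous_cos R 0.
exists (r / (2 * pi)); first by rewrite divr_gt0//; lra.
move=> t; rewrite ltr_pdivlMr; last lra.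
have -> : nc (e2 t - 1) = nc (e2 `|t| - 1).
  have [t0|t0] := leP 0 t; first by rewrite ger0_norm.
  by rewrite ltr0_norm// expiN -[X in _ = nc (_ - X)]conjc1 -rmorphB ncJ.
move: (normr_ge0 t); move: `|t| => {}t t0 ht.
have [c + hc] := @MVT_segment R (@sin R) (@cos R) 0 (2 * pi * t) ltac:(nra) (fun (a : R) _ => is_derive_sin a)
  (continuous_subspaceT (@continuous_sin R)).
rewrite in_itv /= => /andP[c0 ct]; rewrite sin0 !subr0 in hc.
have : `|cos 0 - cos c| < 1 / 2.
  by apply: hr; rewrite -ball_normE /= sub0r normrN ger0_norm//; lra.
rewrite cos0 ltr_norml => /andP[_ h1].
apply: le_trans (le_trans (ler_norm _) (nc_Im _)); rewrite ImD ImN /= subr0 hc.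
by have : t <= t * (2 * pi * cos c) by [rewrite ler_peMr//; nra]; lra.
Qed.

Section CheckDerivative.
Variables (j : 'I_d) (L : R) (w D : V -> R) (y : V).
Hypotheses (L0 : 0 <= L) (hw : cc L (fun x => (w x)%:C)) (hD : cc L (fun x => (D x)%:C)).
Hypothesis wD : forall x (t : R), is_derive t (1:R) (fun s : R => w (x + s *: dir j)) (D (x + t *: dir j)).

(* Translating by s along the j-th axis multiplies the transform at y by a phase of angle s y_j, so the
   difference quotients of w, which converge uniformly to D, pick up the factor y_j. *)
Lemma nc_check_derivative : `|y ord0 j| * nc (checkf (fun x => (w x)%:C) y) <= nc (checkf (fun x => (D x)%:C) y).
Proof.
apply/ler_addgt0Pr => e e0.
have L1 : 0 <= L + 1 := addr_ge0 L0 ler01.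
have [A A0 HA] := check_bound d L1.
have eA : 0 < e / (A + 1) by rewrite divr_gt0//; lra.
have [del d0 hd] := cc_unif hD eA; have [eta eta0 heta] := nc_expi_lower.
have y0 := normr_ge0 (y ord0 j); have y1 : 0 < 2 * (`|y ord0 j| + 1) by lra.
(* The step keeps the translate within radius [L + 1], keeps the oscillation of [D] along it below
   [e / (A + 1)], and keeps the phase in the range of [heta]. *)
pose s : R := Order.min 1 (Order.min (del / 2) (eta / (2 * (`|y ord0 j| + 1)))).
have s0 : 0 < s by rewrite !lt_min ltr01 !divr_gt0.
have s1 : s <= 1 by rewrite ge_min lexx.
have sd : s < del by have : s <= del / 2 by [rewrite !ge_min lexx !orbT]; lra.
have sy : `|s * y ord0 j| < eta.
  have : s <= eta / (2 * (`|y ord0 j| + 1)) by rewrite !ge_min lexx !orbT.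
  by rewrite ler_pdivlMr// normrM (gtr0_norm s0); nra.
have ns (t : R) : 0 <= t -> t <= s -> `|t *: dir j| <= s.
  move=> t0 ts; rewrite normrZ ger0_norm//.
  by apply: le_trans ts; rewrite ler_piMr// norm_dir.
have hw1 : cc (L + 1) (fun x => (w (x + s *: dir j))%:C).
  apply: ccW (cc_shift (s *: dir j) hw); rewrite lerD2l.
  by apply: le_trans (ns s (ltW s0) (lexx s)) s1.
have LL : L <= L + 1 by lra.
have hw' := ccW LL hw; have hD' := ccW LL hD.
have hsD : cc (L + 1) (fun x => s%:C * (D x)%:C) by exact: ccZ.
have : nc (checkf (fun x => (w (x + s *: dir j))%:C - (w x)%:C - s%:C * (D x)%:C) y) <= A * (s * (e / (A + 1))).
  apply: HA; first by apply: ccB => //; exact: ccB.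
  move=> x.
  have [c + hc] := @MVT_segment R (fun t : R => w (x + t *: dir j)) (fun t : R => D (x + t *: dir j)) 0 s (ltW s0)
    (fun t _ => wD x t) ltac:(apply: continuous_subspaceT => t;
     apply/differentiable_continuous/derivable1_diffP; apply: (ex_derive (is_derive := wD x t))).
  rewrite in_itv /= => /andP[c0 cs].
  rewrite scale0r addr0 subr0 in hc.
  have -> : (w (x + s *: dir j))%:C - (w x)%:C - s%:C * (D x)%:C =
      s%:C * ((D (x + c *: dir j))%:C - (D x)%:C).
    by rewrite -rmorphB hc rmorphM; ring.
  rewrite Normc.normcM (nc_real (ltW s0)) ler_pM2l//; apply/ltW/hd.
  by rewrite addrAC subrr add0r; apply: le_lt_trans (ns c c0 cs) sd.
rewrite (checkB y L1 (ccB hw1 hw') hsD) (checkB y L1 hw1 hw') (checkZ _ y L1 hD').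
have -> : checkf (fun x => (w (x + s *: dir j))%:C) y = e2 (- (s * y ord0 j)) * checkf (fun x => (w x)%:C) y.
  rewrite -dotv_dir -dotvNl -(check_shift _ y L0 hw); congr checkf.
  by apply/funext => x; rewrite opprK.
move: (checkf (fun x => (w x)%:C) y) (checkf (fun x => (D x)%:C) y) => a c.
have -> : e2 (- (s * y ord0 j)) * a - a - s%:C * c = (e2 (- (s * y ord0 j)) - 1) * a - s%:C * c by ring.
have := heta (- (s * y ord0 j)); rewrite normrN => /(_ sy).
move: (e2 _) => z h1 h2; have := ncD ((z - 1) * a - s%:C * c) (s%:C * c).
rewrite subrK !Normc.normcM (nc_real (ltW s0)) => h3.
have h4 : s * (`|y ord0 j| * nc a) <= nc (z - 1) * nc a.
  by rewrite mulrA ler_wpM2r ?nc_ge0//; move: h1; rewrite normrM (gtr0_norm s0).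
rewrite -(ler_pM2l s0); apply: le_trans h4 (le_trans h3 _).
have h5 : A * (e / (A + 1)) <= e by rewrite mulrA ler_pdivrMr; [nra | lra].
by move: h2 h5; move: (e / _) => q h2 h5; nra.
Qed.
End CheckDerivative.

Lemma pd_out L u j : (forall x, L < `|x| -> u x = 0) -> forall x, L < `|x| -> pd j u x = 0.
Proof.
move=> u0 x Lx; rewrite /pd (@near_eq_derive _ _ _ u (fun=> 0)) ?derive_cst//.
have xL : 0 < `|x| - L by rewrite subr_gt0.
apply/nbhs_ballP; exists (`|x| - L) => //= z; rewrite -ball_normE /= => h.
by apply: u0; have := ler_normD (x - z) z; rewrite subrK; lra.
Qed.

Lemma pds_out L u js : (forall x, L < `|x| -> u x = 0) -> forall x, L < `|x| -> pds js u x = 0.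
Proof. by move=> h; elim: js => [|j js IH] //=; exact: pd_out. Qed.

Lemma cc_pds L u js : smoothR u -> (forall x, L < `|x| -> u x = 0) -> cc L (fun x => (pds js u x)%:C).
Proof.
move=> su u0; split; first by apply: cts_real; exact: (su js).1.
by move=> x /(pds_out js u0) ->.
Qed.

Lemma nc_check_pds L u js y : 0 <= L -> smoothR u -> (forall x, L < `|x| -> u x = 0) ->
  \prod_(j <- js) `|y ord0 j| * nc (checkf (fun x => (u x)%:C) y) <= nc (checkf (fun x => (pds js u x)%:C) y).
Proof.
move=> L0 su u0; elim: js => [|j js IH]; first by rewrite big_nil mul1r.
rewrite big_cons -mulrA; apply: le_trans (ler_wpM2l (normr_ge0 _) IH) _.
apply: (nc_check_derivative y L0 (cc_pds js su u0) (cc_pds (j :: js) su u0)) => x t.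
by apply: derivable_line; exact: (su js).2.
Qed.

(** The monomial over these coordinates, squared, dominates the product of all [1 + x_j^2] up to
    [2 ^+ d]. A monomial of degree at most [2 * d], depending on [x], therefore suffices for
    decay. *)
Definition large_coords x : seq 'I_d := [seq j <- enum 'I_d | 1 <= `|x ord0 j|].

Lemma size_large_coords x : (size (large_coords x ++ large_coords x) <= 2 * d)%N.
Proof.
have h : (size (large_coords x) <= d)%N by rewrite size_filter (leq_trans (count_size _ _))// size_enum_ord.
by rewrite size_cat mul2n -addnn leq_add.
Qed.

Lemma prod_large_coords x :
  \prod_j (1 + (x ord0 j) ^+ 2) <= 2 ^+ d * (\prod_(j <- large_coords x) `|x ord0 j|) ^+ 2.
Proof.
rewrite -[X in 2 ^+ X](card_ord d) -prodr_const -prodrXl big_filter big_enum_cond /=.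
rewrite [X in _ * X]big_mkcond -big_split /=; apply: ler_prod => j _.
have x2 := sqr_ge0 (x ord0 j); have x1 : `|x ord0 j| ^+ 2 = x ord0 j ^+ 2 by rewrite real_normK ?num_real.
apply/andP; split; first lra.
case: ifP => [h|/negbT]; first by rewrite x1; have : 1 <= `|x ord0 j| ^+ 2 by [rewrite exprn_ege1]; lra.
rewrite -ltNge => h; have : `|x ord0 j| ^+ 2 <= 1 by rewrite expr_le1// ltW.
by rewrite x1; lra.
Qed.

Lemma prod_inv_sqr x : \prod_j (1 + (x ord0 j) ^+ 2)^-1 = (\prod_j (1 + (x ord0 j) ^+ 2))^-1.
Proof. by rewrite (big_morph _ (@invfM R) (@invr1 R)). Qed.

Lemma prod_sqr_gt0 x : 0 < \prod_j (1 + (x ord0 j) ^+ 2).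
Proof. by apply: prodr_gt0 => j _; have := sqr_ge0 (x ord0 j); lra. Qed.

Lemma lattice_near (p : V) : exists k, `|p - ez R k| <= 1.
Proof.
exists (\row_j Num.floor (p ord0 j)); apply: rV_norm_le => // j; rewrite !mxE ger0_norm.
  by have := lt_succ_floor (p ord0 j); rewrite intrD; lra.
by rewrite subr_ge0 ge_floor.
Qed.

Lemma decay_amalgam (h : V -> C) (B : R) (p : V) : 0 <= B ->
  (forall x, nc (h x) <= B * \prod_j (1 + ((x - p) ord0 j) ^+ 2)^-1) -> amalgam h (B * 72 ^+ d).
Proof.
move=> B0 hB J y uJ hy.
apply: (@le_trans _ _ (\sum_(k <- J) B * \prod_j (1 + ((y k - p) ord0 j) ^+ 2)^-1)).
  by apply: ler_sum => k _.
rewrite -mulr_sumr ler_wpM2l//.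
by have [k0 hk0] := lattice_near p; exact: sum_separated hk0 hy.
Qed.

Lemma decay_of_monomials (h : V -> C) (b : R) : 0 <= b ->
  (forall (al : seq 'I_d) x, (size al <= 2 * d)%N -> `|monom al x| * nc (h x) <= b) ->
  forall x, nc (h x) <= (2 ^+ d * b) * \prod_j (1 + (x ord0 j) ^+ 2)^-1.
Proof.
move=> b0 hb x; rewrite prod_inv_sqr ler_pdivlMr ?prod_sqr_gt0//.
have := hb (large_coords x ++ large_coords x) x (size_large_coords x).
rewrite /monom big_cat /= -expr2 normrX normr_prod => h1.
apply: le_trans (_ : nc (h x) * (2 ^+ d * (\prod_(j <- large_coords x) `|x ord0 j|) ^+ 2) <= _).
  by rewrite ler_wpM2l ?nc_ge0// prod_large_coords.
by rewrite mulrCA ler_pM2l ?exprn_gt0// mulrC.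
Qed.

Lemma leb_tb : exists2 M : R, 0 <= M & translation_bounded (@leb R d) M.
Proof.
have [A A0 HA] := leb_bound d (@ler01 R); exists A => // t g b hg gt gb.
have /Cc_cc[L L0 hL] := hg.
rewrite -(leb_shift t L0 hL); apply: HA => //; split.
  apply: (cts_comp (h := fun x : V => x + t) (f := g)); first exact: continuous_addl.
  exact: Cc_cts.
by move=> x x1; apply: gt; rewrite addrK.
Qed.

(** Monomial bounds make the derivatives of [u] decay, so translation boundedness of Lebesgue
    measure bounds their transforms pointwise. Derivatives of order up to [2 * d] then give decay of
    the transform of [u], hence lattice summability. Decay is used on both sides, which is why
    [2 ^+ d * 72 ^+ d] occurs twice. *)
Lemma amalgam_check_test : exists2 A : R, 0 <= A & forall u (b : R), test_function u ->
  (forall (al js : seq 'I_d) x, (size al <= 2 * d)%N -> (size js <= 2 * d)%N ->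
     `|monom al x * pds js u x| <= b) ->
  exists2 L : R, 0 <= L & cc L (fun x => (u x)%:C) /\ amalgam (checkf (fun x => (u x)%:C)) (A * b).
Proof.
have [M M0 tbM] := leb_tb.
exists (2 ^+ d * (M * (2 ^+ d * 72 ^+ d)) * 72 ^+ d); first by rewrite !mulr_ge0// exprn_ge0.
move=> u b [su [K [cK uK]]] hb; have [L L0 KL] := compact_box cK.
have u0 x : L < `|x| -> u x = 0.
  by move=> Lx; apply/eqP; apply: contraTT Lx => /uK/KL; rewrite -leNgt.
have b0 : 0 <= b := le_trans (normr_ge0 _) (hb [::] [::] 0 (leq0n _) (leq0n _)).
exists L => //; split; first exact: (cc_pds [::] su u0).
have am js : (size js <= 2 * d)%N -> amalgam (fun x => (pds js u x)%:C) ((2 ^+ d * b) * 72 ^+ d).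
  move=> hjs; apply: (@decay_amalgam _ _ 0); first by rewrite mulr_ge0// exprn_ge0.
  move=> x; rewrite subr0; apply: (@decay_of_monomials (fun x => (pds js u x)%:C)) => // al {}x hal.
  by rewrite ncR -normrM; exact: hb.
have hcheck js y : (size js <= 2 * d)%N -> nc (checkf (fun x => (pds js u x)%:C) y) <= M * ((2 ^+ d * b) * 72 ^+ d).
  move=> hjs; apply: (tb_amalgam (leb_measure R d) tbM M0 (am js hjs)).
    exact: cc_Cc (cc_exp y (cc_pds js su u0)).
  by move=> x; rewrite Normc.normcM nc_expi mulr1.
have -> : 2 ^+ d * (M * (2 ^+ d * 72 ^+ d)) * 72 ^+ d * b =
   (2 ^+ d * (M * ((2 ^+ d * b) * 72 ^+ d))) * 72 ^+ d by ring.
apply: (@decay_amalgam _ _ 0); first by rewrite !mulr_ge0// exprn_ge0.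
move=> y; rewrite subr0 prod_inv_sqr ler_pdivlMr ?prod_sqr_gt0//.
have := hcheck _ y (size_large_coords y); move/(le_trans (nc_check_pds _ y L0 su u0)).
rewrite big_cat /= -expr2 => h1.
apply: le_trans (_ : nc (checkf (fun x => (u x)%:C) y) *
   (2 ^+ d * (\prod_(j <- large_coords y) `|y ord0 j|) ^+ 2) <= _).
  by rewrite ler_wpM2l ?nc_ge0// prod_large_coords.
by rewrite mulrCA ler_pM2l ?exprn_gt0// mulrC.
Qed.
End TestFunctions.

(** * From transformability to densities *)

Section Forward.
Variables (R : realType) (d : nat).
Local Notation C := R[i].
Local Notation V := 'rV[R]_d.
Local Notation nc := (@Normc.normc R).
Local Notation e2 := (@expi2pi R).
Local Notation cv := (@Defs.conv R d).
Implicit Types (f g h phi : V -> C) (mu nu : (V -> C) -> C).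

Lemma mint_bound nu h (I : C) (B : R) : mint nu h I ->
  (forall phi, Cc phi -> (forall x, nc (phi x) <= 1) -> nc (nu (fun x => phi x * h x)) <= B) -> nc I <= B.
Proof.
move=> m hB; apply/ler_addgt0Pr => e e0; have [K [cK hK]] := m e e0.
have [L L0 KL] := compact_box cK.
have := hK (plateau L) (@Cc_plateau R d L) (plateau01 L) (fun x Kx => plateau_in (KL x Kx)).
rewrite nc_lt => k1; have k2 := hB (plateau L) (@Cc_plateau R d L) (nc_plateau L).
have := ncD (I - nu (fun x => plateau L x * h x)) (nu (fun x => plateau L x * h x)).
by rewrite subrK ncBC; lra.
Qed.

Lemma even_density f : (forall x, 0 <= f x) -> posdef f -> forall x, f (- x) = f x.
Proof. by move=> f0 pf x; rewrite posdef_herm// (ge0_complex (f0 x)).1 conjc_real. Qed.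

Lemma varK_le nu (K : set V) (L B : R) (t : V) : (forall x, K x -> `|x - t| <= L) ->
  (forall g, Cc g -> (forall x, nc (g x) <= 1) -> (forall x, L + 1 < `|x - t| -> g x = 0) -> nc (nu g) <= B) ->
  (varK nu K <= B%:E)%E.
Proof.
move=> KL hB; pose h (x : V) : C := plateau L (x - t).
have hh : cc (L + 1 + `|- t|) h := cc_shift (- t) (@cc_plateau R d L).
apply: le_trans (_ : varm nu h <= B%:E)%E.
  apply: ereal_inf_lbound; exists h => //; split; first exact: cc_Cc hh.
  split; first by move=> x; have /andP[] := plateau01 L (x - t).
  by move=> x /KL xK; rewrite /h plateau_in.
apply/varm_le => g hg gh; apply: hB => // x.
  rewrite -lecR; apply: le_trans (gh x) _; by have /andP[] := plateau01 L (x - t).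
move=> hx; apply/eqP; rewrite -normr_le0; apply: le_trans (gh x) _.
by rewrite /h (cc_plateau d L).2.
Qed.

(** Instead of covering the ball by cubes, a bounded function on it is dominated by a multiple of
    the decaying product weight centred at [t], whose lattice sums are bounded independently of
    [t]. *)
Lemma tb_ball nu M (L b : R) (t : V) g : is_measure nu -> translation_bounded nu M -> 0 <= M -> 0 <= L ->
  Cc g -> (forall x, nc (g x) <= b) -> (forall x, L < `|x - t| -> g x = 0) ->
  nc (nu g) <= M * (b * (1 + L ^+ 2) ^+ d * 72 ^+ d).
Proof.
move=> mnu tb M0 L0 hg gb gt; have b0 : 0 <= b := le_trans (nc_ge0 _) (gb 0).
have L2 : 0 <= 1 + L ^+ 2 by have := sqr_ge0 L; lra.
apply: (@tb_amalgam R d nu M (b * (1 + L ^+ 2) ^+ d * 72 ^+ d) g g mnu tb M0) => //.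
apply: (@decay_amalgam _ _ _ _ t); first by rewrite mulr_ge0 ?exprn_ge0.
move=> x; have [xt|xt] := leP `|x - t| L; last first.
  by rewrite gt// Normc.normc0 !mulr_ge0 ?exprn_ge0// prodr_ge0// => j _; exact: inv_sqr_ge0.
apply: le_trans (gb x) _; rewrite -mulrA -[X in X <= _]mulr1 ler_wpM2l//.
rewrite -[X in _ ^+ X](card_ord d) -prodr_const -big_split /=.
rewrite -[X in X <= _](@expr1n _ #|'I_d|) -prodr_const; apply: ler_prod => j _; rewrite ler01 /=.
have z2 := sqr_ge0 ((x - t) ord0 j).
rewrite ler_pdivlMr; last lra.
rewrite mul1r lerD2l -[X in X <= _]real_normK ?num_real// ler_sqr ?nnegrE//.
exact: le_trans (rV_norm_ge (x - t) j) xt.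
Qed.

Section Fixed.
Variables mu nu : (V -> C) -> C.
Hypotheses (mmu : is_measure mu) (mnu : is_measure nu).
Hypothesis hmint : forall f, Cc f -> mint nu (fun y => `|checkf f y| ^+ 2) (mu (cv f (tilde f))).
Variable M : R.
Hypotheses (M0 : 0 <= M) (tb : translation_bounded nu M).

Lemma tempered_of_transform : tempered mu.
Proof.
have [A A0 HA] := amalgam_check_test R d.
exists (2 * d)%N, (M * A) => u tu b hb.
have [L L0 [cu am]] := HA u b tu hb.
rewrite nc_le; apply: (mint_bound (transform_identity mmu mnu hmint M0 tb L0 cu am)).
move=> phi hphi phi1; rewrite -mulrA; apply: (tb_amalgam mnu tb M0 am).
  by apply: CcMr => //; exact: cts_check L0 cu.
by move=> x; rewrite Normc.normcM ler_piMl ?nc_ge0.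
Qed.

Section Density.
Variable f : V -> C.
Hypotheses (hf : Cc f) (f0 : forall x, 0 <= f x) (f1 : leb f = 1) (pf : posdef f).

Definition weighted : (V -> C) -> C := fun phi => nu (fun y => phi y * checkf f y).

Lemma cts_checkf_Cc : cts (checkf f).
Proof. by have /Cc_cc[L L0 hL] := hf; exact: cts_check L0 hL. Qed.

Lemma nc_checkf_le1 y : nc (checkf f y) <= 1.
Proof. by have /Cc_cc[L L0 hL] := hf; exact: nc_check_density L0 hL f0 f1 y. Qed.

Lemma weighted_measure : is_measure weighted.
Proof.
have cf := cts_checkf_Cc; split.
- move=> g h hg hh; rewrite /weighted -(measD mnu); try exact: CcMr.
  by congr nu; apply/funext => y; rewrite mulrDl.
- move=> c g hg; rewrite /weighted -(measZ mnu); last exact: CcMr.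
  by congr nu; apply/funext => y; rewrite mulrA.
- move=> K /compact_box[L L0 KL]; have [B B0 hB] := meas_bound mnu L; exists B => g b hg sg gb.
  have gL : cc L g.
    split; first exact: Cc_cts.
    by move=> x; apply: contraTeq => /sg/KL; rewrite leNgt.
  rewrite nc_le; apply: hB; first exact: ccMr.
  move=> x; have := gb x; rewrite nc_le Normc.normcM => h.
  by apply: le_trans h; rewrite ler_piMr ?nc_ge0 ?nc_checkf_le1.
Qed.

Lemma weighted_finite : finite_measure weighted.
Proof.
split; first exact: weighted_measure.
have [S S0 am] := amalgam_check_posdef hf pf; exists (M * S) => h hh h01.
apply/varm_le => g hg gh; apply: (tb_amalgam mnu tb M0 am); first exact: CcMr cts_checkf_Cc hg.
move=> x; rewrite Normc.normcM ler_piMl ?nc_ge0// -lecR.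
by apply: le_trans (gh x) _; have /andP[] := h01 x.
Qed.

(** The translate of [f] by [x] has transform [e2 (dotv x y) * checkf f y]. Integrating it against
    [nu] is thus the inverse transform of [weighted] at [x], and [transform_identity] evaluates it;
    evenness of [f] matches the translate with [conv_m]. *)
Lemma weighted_density : check_eq_density weighted (conv_m f mu).
Proof.
exists (conv_m f mu) => // x.
have /Cc_cc[L L0 hL] := hf.
have [S S0 am] := amalgam_check_posdef hf pf.
pose h (y : V) := f (y - x).
have hh : cc (L + `|- x|) h := cc_shift (- x) hL.
have L1 : 0 <= L + `|- x| by rewrite addr_ge0.
have eh y : checkf h y = e2 (dotv x y) * checkf f y := check_shift x y L0 hL.
have amh : amalgam (checkf h) S.
  move=> J y uJ hy; apply: le_trans (am J y uJ hy); apply: ler_sum => k _.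
  by rewrite eh Normc.normcM nc_expi mul1r.
have -> : conv_m f mu x = mu h.
  by congr mu; apply/funext => y; rewrite /h -(even_density f0 pf) opprB.
move=> e e0; have [K [cK hK]] := transform_identity mmu mnu hmint M0 tb L1 hh amh e0.
exists K; split => // phi hphi p01 p1; have := hK phi hphi p01 p1.
rewrite /weighted (_ : (fun y => _) = (fun y => phi y * e2 (dotv x y) * checkf f y))//.
by apply/funext => y; rewrite eh mulrA.
Qed.

Lemma weighted_cell (L : R) (t : V) g : 0 <= L -> Cc g -> (forall x, nc (g x) <= 1) ->
  (forall x, L < `|x - t| -> g x = 0) -> nc (weighted g) <= M * (1 * (1 + L ^+ 2) ^+ d * 72 ^+ d).
Proof.
move=> L0 hg g1 gt; apply: (tb_ball (t := t) mnu tb M0 L0); first exact: CcMr cts_checkf_Cc hg.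
  by move=> x; rewrite Normc.normcM mulr_ile1 ?nc_ge0 ?nc_checkf_le1.
by move=> x /gt ->; rewrite mul0r.
Qed.
End Density.
End Fixed.

Lemma transform_density (f : nat -> V -> C) mu : (forall n, Cc (f n)) -> (forall n x, 0 <= f n x) ->
  (forall n, leb (f n) = 1) -> (forall n, posdef (f n)) -> is_measure mu ->
  Fourier_transformable mu -> tempered mu /\
    exists nu : nat -> (V -> C) -> C, (forall n, finite_measure (nu n)) /\
      equi_translation_bounded nu /\ (forall n, check_eq_density (nu n) (conv_m (f n) mu)).
Proof.
move=> hf f0 f1 pf mmu [nu [mnu hnu]].
have hint g : Cc g -> exists S : R, ibd nu (fun y => `|checkf g y| ^+ 2) S.
  by move=> /hnu[/integrable_ibd].
have hmint g : Cc g -> mint nu (fun y => `|checkf g y| ^+ 2) (mu (cv g (tilde g))) by move=> /hnu[].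
have [M M0 tb] := tb_of_integrable mnu hint.
split; first by have := tempered_of_transform mmu mnu hmint M0 tb.
exists (fun n => weighted nu (f n)); split; first by move=> n; exact: (weighted_finite mnu M0 tb).
split; last by move=> n; exact: (weighted_density mmu mnu hmint M0 tb).
move=> W /compact_box[L L0 WL]; exists (M * (1 * (1 + (L + 1) ^+ 2) ^+ d * 72 ^+ d)) => n t.
apply: (@varK_le _ _ L _ t).
  by move=> _ [w /WL wL <-]; rewrite addrC addKr.
by move=> g hg g1 gt; apply: (weighted_cell mnu M0 tb (hf n) (f0 n) (f1 n) _ hg g1 gt); lra.
Qed.
End Forward.

(** * From densities to transformability *)

Section LimitMeasure.
Variables (R : realType) (d : nat).
Local Notation C := R[i].
Local Notation V := 'rV[R]_d.
Local Notation nc := (@Normc.normc R).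
Variables (U : set_system nat) (nu : nat -> (V -> C) -> C) (M : R).
Hypotheses (uU : UltraFilter U) (mnu : forall n, is_measure (nu n)) (M0 : 0 <= M).
Hypothesis tb : forall n, translation_bounded (nu n) M.

Lemma ulim_measure : exists2 hatmu : (V -> C) -> C, is_measure hatmu /\ translation_bounded hatmu M &
  forall g, Cc g -> ulim U (fun n => nu n g) (hatmu g).
Proof.
have bd g (L b : R) : 0 <= L -> Cc g -> (forall x, nc (g x) <= b) -> (forall x, L < `|x| -> g x = 0) ->
    forall n, nc (nu n g) <= M * ((1 + L ^+ 2) ^+ d * 72 ^+ d) * b.
  move=> L0 hg gb gL n.
  apply: le_trans (tb_ball (t := 0) (mnu n) (@tb n) M0 L0 hg gb _) _; first by move=> x; rewrite subr0; exact: gL.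
  by rewrite le_eqVlt; apply/orP; left; apply/eqP; ring.
have [g|hatmu hl] := @choice (V -> C) C (fun g l => Cc g -> ulim U (fun n => nu n g) l).
  (* Outside C_c nothing is demanded of the limit functional; 0 is a default value. *)
  have [hg|ng] := pselect (Cc g); last by exists 0.
  have /Cc_cc[L L0 hL] := hg; have [b b0 hb] := cc_bounded hL.
  by have [l ul] := ulim_exists uU (bd g L b L0 hg hb hL.2); exists l.
exists hatmu => //; split.
  split.
  - move=> g h hg hh; apply: (ulim_unique uU (hl _ (CcD hg hh))).
    under eq_fun do rewrite (measD (mnu _))//.
    exact: ulimD (hl g hg) (hl h hh).
  - move=> c g hg; apply: (ulim_unique uU (hl _ (CcZ c hg))).
    under eq_fun do rewrite (measZ (mnu _))//.
    exact: ulimZ (hl g hg).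
  - move=> K /compact_box[L L0 KL]; exists (M * ((1 + L ^+ 2) ^+ d * 72 ^+ d)) => g b hg sg gb.
    rewrite nc_le; apply: (ulim_le uU _ (hl g hg)) => n; apply: bd => //.
      by move=> x; have := gb x; rewrite nc_le.
    by move=> x; apply: contraTeq => /sg/KL; rewrite leNgt.
by move=> t g b hg gt gb; apply: (ulim_le uU _ (hl g hg)) => n; exact: (@tb n t g b hg gt gb).
Qed.
End LimitMeasure.

Section Backward.
Variables (R : realType) (d : nat).
Local Notation C := R[i].
Local Notation V := 'rV[R]_d.
Local Notation nc := (@Normc.normc R).
Local Notation e2 := (@expi2pi R).
Local Notation cv := (@Defs.conv R d).
Implicit Types (f g h phi : V -> C) (mu nu : (V -> C) -> C) (L e b : R).

(** Taking [W] to be the closed unit ball. Any [h] admissible for [varK] is at least 1 on the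
    translated ball and hence dominates [g / b]; the slack [e] provides an [h] close to the
    infimum. *)
Lemma tb_of_equi (nu : nat -> (V -> C) -> C) : (forall n, is_measure (nu n)) ->
  equi_translation_bounded nu -> exists2 M : R, 0 <= M & forall n, translation_bounded (nu n) M.
Proof.
move=> mnu /(_ _ (@box_compact R d 1))[M0 hM]; exists (Order.max 0 M0); first by rewrite le_max lexx.
move=> n; apply: (tb_of_pos (mnu n)) => t g b b0 hg gt gb.
rewrite -ler_pdivrMr//; apply/ler_addgt0Pr => e e0.
have lt : (varK (nu n) ((fun w => (t + w)%R) @` [set x : V | (`|x| <= 1)%R]) < (Order.max 0 M0 + e)%:E)%E.
  apply: le_lt_trans (hM n t) _; rewrite lte_fin.
  by have : M0 <= Order.max 0 M0 by [rewrite le_max lexx orbT]; lra.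
have [_ [h [hh [h0 h1]] <-] hlt] := ereal_inf_lt lt.
have -> : nc (nu n g) / b = nc (nu n (fun x => (b^-1)%:C * g x)).
  by rewrite (measZ (mnu n))// Normc.normcM nc_real ?invr_ge0 ?(ltW b0)// mulrC.
move/varm_le: (ltW hlt); apply; first exact: CcZ.
move=> x; have [xt|xt] := leP `|x - t| 1; last by rewrite gt// mulr0 normr0.
apply: (@le_trans _ _ 1); last by apply: h1; exists (x - t) => //; rewrite addrC subrK.
by rewrite nc_le Normc.normcM nc_real ?invr_ge0 ?(ltW b0)// ler_pdivrMl// mulr1.
Qed.

(** Fubini for a measure without compact support: since characters have modulus 1 and [nu] is
    finite, the tails are small uniformly in [x]. Cut-off integrals thus converge to [cn] uniformly,
    and Fubini is needed only for kernels of compact support. *)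
Lemma density_pairing nu (cn : V -> C) Lh h : finite_measure nu ->
  (forall x, mint nu (fun y => e2 (dotv x y)) (cn x)) -> 0 <= Lh -> cc Lh h ->
  mint nu (checkf h) (leb (fun x => h x * cn x)).
Proof.
move=> [mnu [Mf hMf]] hcn Lh0 hh.
have [S hS] : exists S : R, ibd nu (fun=> 1) S.
  apply/integrable_ibd; exists Mf => phi hphi p01.
  by rewrite normr1; under eq_fun do rewrite mulr1; exact: hMf.
have near e : 0 < e -> exists2 L, 0 <= L & forall phi, Cc phi -> (forall x, 0 <= phi x <= 1) ->
    (forall x, `|x| <= L -> phi x = 1) -> forall x, nc (nu (fun y => phi y * e2 (dotv x y)) - cn x) <= e.
  move=> e0; have [L L0 tail] := ibd_tail mnu hS e0; exists L => // phi hphi p01 p1 x.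
  apply: (mint_tail mnu (@cts_expdotr R d x) (hcn x) _ hphi p01 p1) => g hg gb.
  by apply: tail => // y; apply: le_trans (gb y) _; rewrite nc_expi Normc.normc1.
pose F phi (y x : V) := phi y * (h x * e2 (dotv x y)).
have hF L phi : cc L phi -> cc2 L Lh (F phi).
  move=> [cphi phi0]; split.
    apply: ctsM; first by apply: (cts_comp (h := fun p : V * V => p.1) (f := phi)) => //; exact: continuous_fst.
    apply: ctsM; first by apply: (cts_comp (h := fun p : V * V => p.2) (f := h)); [exact: continuous_snd|exact: hh.1].
    apply: (cts_comp (h := fun p : V * V => (p.2, p.1)) (f := fun p : V * V => e2 (dotv p.1 p.2))).
      by apply: continuous_pair; [exact: continuous_snd | exact: continuous_fst].
    exact: cts_expdot.
  move=> y x; rewrite /F !mulf_eq0 !negb_or => /and3P[hy hx _]; split.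
    by apply: contraNT hy; rewrite -ltNge => /phi0 ->.
  by apply: contraNT hx; rewrite -ltNge => /hh.2 ->.
have eF phi x : Cc phi -> nu (fun y => F phi y x) = h x * nu (fun y => phi y * e2 (dotv x y)).
  move=> hphi; rewrite -(measZ mnu); last by apply: CcMr => //; exact: cts_expdotr.
  by congr nu; apply/funext => y; rewrite /F mulrCA.
have [bh bh0 hbh] := cc_bounded hh.
have gap phi e : 0 < e -> Cc phi -> (forall x, nc (nu (fun y => phi y * e2 (dotv x y)) - cn x) <= e / (bh + 1)) ->
    forall x, nc (nu (fun y => F phi y x) - h x * cn x) <= e.
  move=> e0 hphi hx x; rewrite eF// -mulrBr Normc.normcM.
  have b1 : 0 < bh + 1 by lra.
  apply: (@le_trans _ _ (bh * (e / (bh + 1)))); first by apply: ler_pM; rewrite ?nc_ge0.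
  by rewrite mulrA ler_pdivrMr//; nra.
(* [cn] is given only pointwise; being a uniform limit makes its product with [h] continuous, so
   that the bounds on [leb] apply to it. *)
have hcc : cc Lh (fun x => h x * cn x).
  split; last by move=> x /hh.2 ->; rewrite mul0r.
  apply: cts_unif => e e0; have e3 : 0 < e / 3 by rewrite divr_gt0.
  have e4 : 0 < e / 3 / (bh + 1) by rewrite divr_gt0//; lra.
  have [L L0 hL] := near _ e4.
  have hp := hL _ (@Cc_plateau R d L) (plateau01 L) (@plateau_in R d L).
  have hg := gap _ _ e3 (@Cc_plateau R d L) hp.
  have [del d0 hd] := cc_unif (meas_cc2 mnu (hF _ _ (@cc_plateau R d L))) e3.
  exists del => // x y /hd h1.
  have := nc_triangle (nu (fun z => F (plateau L) z x)) (h x * cn x) (h y * cn y).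
  have := nc_triangle (nu (fun z => F (plateau L) z y)) (nu (fun z => F (plateau L) z x)) (h y * cn y).
  by have := hg x; have := hg y; rewrite (ncBC (h x * cn x) (nu _)); lra.
move=> e e0; have [A A0 HA] := leb_bound d Lh0.
have e1 : 0 < e / (2 * (A + 1)) by rewrite divr_gt0// mulr_gt0//; lra.
have e4 : 0 < e / (2 * (A + 1)) / (bh + 1) by rewrite divr_gt0//; lra.
have [L L0 hL] := near _ e4; exists [set x : V | `|x| <= L]; split; first exact: box_compact.
move=> phi hphi p01 p1; have /Cc_cc[Lp Lp0 hp] := hphi.
have -> : nu (fun y => phi y * checkf h y) = leb (fun x => nu (fun y => F phi y x)).
  rewrite -(meas_fubini mnu Lh0 (hF _ _ hp)); congr nu; apply/funext => y.
  by rewrite /F (lebZ _ Lh0)//; exact: cc_exp.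
have hG := meas_cc2 mnu (hF _ _ hp).
rewrite nc_lt -(lebB Lh0 hG hcc).
apply: le_lt_trans (HA _ (e / (2 * (A + 1))) (ccB hG hcc) _) _.
  by apply: gap => // x; exact: hL.
by have := small_factor A0 e0 (ltr0n R 2); lra.
Qed.

(** Fubini produces [mu] of [f (y - x)], while [conv_m] evaluates [f (x - y)]; evenness of [f]
    reconciles the two. *)
Lemma leb_conv_m mu f h Lf Lh : is_measure mu -> cc Lf f -> (forall x, f (- x) = f x) -> 0 <= Lh -> cc Lh h ->
  leb (fun x => h x * conv_m f mu x) = mu (cv f h).
Proof.
move=> mmu hf fe Lh0 hh; rewrite (meas_fubini mmu Lh0 (cc2_conv hf hh)).
congr leb; apply/funext => x; rewrite /conv_m -(measZ mmu); last first.
  by have /cc_Cc := cc_refl x hf.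
by congr mu; apply/funext => y; rewrite -(fe (x - y)) opprB mulrC.
Qed.

Lemma density_transform (f : nat -> V -> C) (K : set V) mu (nu : nat -> (V -> C) -> C) :
  approx_identity f -> compact K -> (forall n, Cc (f n)) -> (forall n, supported_in (f n) K) ->
  (forall n x, 0 <= f n x) -> (forall n, posdef (f n)) -> is_measure mu ->
  (forall n, finite_measure (nu n)) -> equi_translation_bounded nu ->
  (forall n, check_eq_density (nu n) (conv_m (f n) mu)) -> Fourier_transformable mu.
Proof.
move=> af /compact_box[Lf Lf0 KLf] hf sf f0 pf mmu fnu eq hnu.
have mnu n : is_measure (nu n) := (fnu n).1.
have [M M0 tb] := tb_of_equi mnu eq.
have [U [uU hU]] := @ultraFilterLemma nat \oo _.
have [hatmu [mhat tbh] hl] := ulim_measure uU mnu M0 tb.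
have fL n : cc Lf (f n).
  split; first exact: Cc_cts.
  by move=> x; apply: contraTeq => /sf/KLf; rewrite leNgt.
have conv_lim Lh h : 0 <= Lh -> cc Lh h -> forall e, 0 < e -> exists N : nat, forall n, (N <= n)%N ->
    nc (mu (cv (f n) h) - mu h) <= e.
  move=> Lh0 hh e e0; have [B B0 hB] := meas_bound mmu (Lf + Lh).
  have e1 : 0 < e / (1 * (B + 1)) by rewrite divr_gt0// mulr_gt0//; lra.
  have ch : Cu h.
    split; first by have [b _ hb] := cc_bounded hh; exists b => x; rewrite nc_le.
    by move=> z /(cc_unif hh)[del d0 hd]; exists del => // x y /hd; rewrite nc_lt.
  have [N hN] := af h ch _ e1; exists N => n /hN h1.
  have hc := cc_conv (fL n) hh; have hh' : cc (Lf + Lh) h by apply: ccW hh; lra.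
  rewrite -(measB mmu); [|exact: cc_Cc hc|exact: cc_Cc hh'].
  apply: le_trans (hB _ (e / (1 * (B + 1))) (ccB hc hh') _) _.
    by move=> x; have := h1 x; rewrite nc_lt => /ltW; exact.
  by have := small_factor B0 e0 ltr01; rewrite divr1.
have hint Lh h S : 0 <= Lh -> cc Lh h -> amalgam (checkf h) S -> mint hatmu (checkf h) (mu h).
  move=> Lh0 hh am e e0; have e4 : 0 < e / 4 by rewrite divr_gt0.
  have e1 : 0 < e / (4 * (M + 1)) by rewrite divr_gt0// mulr_gt0//; lra.
  have [L L0 tail] := tb_amalgam_tail am e1; have ch : cts (checkf h) := cts_check Lh0 hh.
  exists [set x : V | `|x| <= L]; split; first exact: box_compact.
  move=> phi hphi p01 p1; rewrite nc_lt.
  have [N hN] := conv_lim _ _ Lh0 hh _ e4.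
  have hlim := hl _ (CcMr ch hphi) _ e4.
  have hge : U [set n | (N <= n)%N] by apply: hU; exists N.
  (* A single index that is both late and in the ultrafilter set for this [phi]: there the cut-off
     integrals of [nu n] and [hatmu] are close, and so are [mu (cv (f n) h)] and [mu h]. The tail
     bound, uniform in [n], links the two pairs. *)
  have [n [/= h1 /hN h2]] := filter_ex (filterI hlim hge).
  have [cn hcn ecn] := hnu n.
  have m := density_pairing (fnu n) hcn Lh0 hh.
  rewrite ecn ?(leb_conv_m mmu (fL n) (even_density (f0 n) (pf n)) Lh0 hh) in m; last exact: cc_Cc hh.
  have h3 : nc (nu n (fun x => phi x * checkf h x) - mu (cv (f n) h)) <= e / 4.
    apply: (mint_tail (mnu n) ch m _ hphi p01 p1) => g hg gh g0.
    by apply: le_trans (tail _ _ _ (mnu n) (@tb n) M0 hg gh g0) _; exact: small_factor.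
  have := nc_triangle (nu n (fun x => phi x * checkf h x)) (hatmu (fun x => phi x * checkf h x)) (mu h).
  have := nc_triangle (mu (cv (f n) h)) (nu n (fun x => phi x * checkf h x)) (mu h).
  by rewrite (ncBC (hatmu _) (nu n _)); lra.
exists hatmu; split => // g hg; have [S S0 am] := amalgam_check_sq hg; split.
  by apply/integrable_ibd; exists (M * S) => p hp; exact: tb_amalgam.
have /Cc_cc[L L0 gL] := hg.
have ech : checkf (cv g (tilde g)) = fun y => `|checkf g y| ^+ 2.
  apply/funext => y; rewrite (check_conv y L0 L0 gL (cc_tilde gL)) (check_tilde y L0 gL).
  by rewrite sqr_normc.
by rewrite -ech; apply: (hint (L + L) _ S); rewrite ?addr_ge0// ?ech//; exact: cc_conv gL (cc_tilde gL).
Qed.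
End Backward.

Unset Implicit Arguments. Set Strict Implicit.

Theorem theorem7p3 (R : realType) (d : nat) (f : nat -> 'rV[R]_d -> R[i])
  (K : set 'rV[R]_d) (mu : ('rV[R]_d -> R[i]) -> R[i]) :
  approx_identity f ->
  compact K ->
  (forall n, Cc (f n)) ->
  (forall n, supported_in (f n) K) ->
  (forall n x, 0 <= f n x) ->
  (forall n, leb (f n) = 1) ->
  (forall n, posdef (f n)) ->
  is_measure mu ->
  (Fourier_transformable mu <->
    tempered mu /\
    exists nu : nat -> ('rV[R]_d -> R[i]) -> R[i],
      (forall n, finite_measure (nu n)) /\
      equi_translation_bounded nu /\
      (forall n, check_eq_density (nu n) (conv_m (f n) mu))).
Proof.
move=> af cK hf sf f0 f1 pf mmu; split; first exact: transform_density.
by move=> [_ [nu [fnu [eq hnu]]]]; exact: (density_transform af cK hf sf f0 pf mmu fnu eq hnu).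
Qed.
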